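(* Suppose that $Z\subset S^1$ is an admissible discrete subset. Let $L_1(Z)$ be the set of limit points of $Z$ in $S^1$ and, for $n\ge1$, let $L_{n+1}(Z)$ be the set of limit points of $L_n(Z)$. Suppose that $L_n(Z)$ is empty for sufficiently large $n$. Then $\mathcal C_{can}(Z)$ contains a triangulation cluster.
   Context: A subset $Z\subset S^1$ is an admissible discrete subset if: (1) every element of $Z$ has an open neighborhood in $S^1$ containing no other element of $Z$; (2) every point of $S^1$ which is a limit point of $Z$ is a limit of $Z$ from both sides; (3) $Z$ has at least four elements. Then each $z\in Z$ has a successor $z^+\in Z$ and predecessor $z^-\in Z$. $L(Z)=L_1(Z)$ denotes the set of limit points of $Z$. $\mathcal C_{can}(Z)$ is the triangulated category associated to the cyclically ordered set $Z$ with its canonical automorphism $z\mapsto z^+$ (the stable category of a Frobenius category of matrix factorizations of $t$ over $k[[t]]$). For the present statement only the following is needed: its indecomposable objects, up to isomorphism, are $E(x,y)\cong E(y,x)$ for $x,y\in Z$ with $y\neq x,x^+,x^-$; to $E(x,y)$ one associates the closed hyperbolic geodesic $\widehat{xy}$ in the closed unit disk $D^2$ (Poincaré model) with endpoints $x,y$; two such objects are compatible if and only if their geodesics do not cross in the interior of $D^2$. A cluster is a maximal set of pairwise compatible, pairwise nonisomorphic indecomposable objects. For a cluster $\mathcal S$, the simplicial complex $K(\mathcal S)$ has vertex set $Z$; $\{x,y\}$ is a 1-simplex iff either $E(x,y)\in\mathcal S$ (up to isomorphism) or $y\in\{x^+,x^-\}$; $\{x,y,z\}$ is a 2-simplex iff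 all three pairs are 1-simplices; there are no higher simplices. The map $\psi_{\mathcal S}:|K(\mathcal S)|\to D^2$ from the geometric realization (weak topology) sends each vertex to itself, each 1-simplex $\{z,z^+\}$ homeomorphically to the arc of $S^1$ from $z$ to $z^+$, every other 1-simplex $\{x,y\}$ homeomorphically to $\widehat{xy}$, and each 2-simplex by a homeomorphism (extending the given boundary map) onto the closed region of $D^2$ enclosed by the image of its boundary. The cluster $\mathcal S$ is a triangulation cluster if $\psi_{\mathcal S}$ is a homeomorphism of $|K(\mathcal S)|$ onto $D^2\setminus L(Z)$. *)

(* Defs.v *)
From HB Require Import structures.
From mathcomp Require Import all_boot all_order all_algebra finmap.
From mathcomp Require Import all_classical all_reals all_analysis.

Set Implicit Arguments.
Unset Strict Implicit.
Unset Printing Implicit Defensive.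

Import Order.TTheory GRing.Theory Num.Theory.
Import numFieldNormedType.Exports.

Local Open Scope classical_set_scope.
Local Open Scope ring_scope.

Definition homeomorphism_on (T U : topologicalType) (f : T -> U)
    (A : set T) (B : set U) : Prop :=
  exists g : U -> T,
    [/\ {within A, continuous f}, {within B, continuous g},
        forall a, A a -> B (f a) /\ g (f a) = a &
        forall b, B b -> A (g b) /\ f (g b) = b].

Section Realization.
Variables (R : realType) (V : choiceType) (K : set {fset V}).

(* Points are barycentric coordinate functions supported on a simplex. *)
Record realization := Realization {
  bary : V -> R;
  _ : forall v, 0 <= bary v;
  _ : exists2 s : {fset V}, K s &
        (forall v, v \notin s -> bary v = 0) /\ \sum_(v <- s) bary v = 1
}.

Definition face (s : {fset V}) : set realization :=
  [set a | forall v, v \notin s -> bary a v = 0].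

Definition face_boundary (s : {fset V}) : set realization :=
  face s `&` [set a | exists2 v, v \in s & bary a v = 0].

(* Weak topology: a set is open when its trace on every closed simplex is
   open for the Euclidean topology of that simplex. *)
Definition weak_open (U : set realization) : Prop :=
  forall s, K s -> forall a, face s a -> U a ->
  exists2 e : R, 0 < e & forall b, face s b ->
    (forall v, v \in s -> `|bary b v - bary a v| < e) -> U b.

Lemma weak_openT : weak_open setT.
Proof. by move=> s _ a _ _; exists 1. Qed.

Lemma weak_openI : setI_closed weak_open.
Proof.
move=> A B oA oB s Ks a sa [Aa Ba].
have [e e0 eA] := oA s Ks a sa Aa.
have [d d0 dB] := oB s Ks a sa Ba.
exists (Num.min e d); first by rewrite lt_min e0 d0.
move=> b sb ab; split.
  by apply: eA => // v vs; have := ab v vs; rewrite lt_min => /andP[].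
by apply: dB => // v vs; have := ab v vs; rewrite lt_min => /andP[].
Qed.

Lemma weak_open_bigU (I : Type) (f : I -> set realization) :
  (forall i, weak_open (f i)) -> weak_open (\bigcup_i f i).
Proof.
move=> of_ s Ks a sa [i _ fia].
have [e e0 ef] := of_ i s Ks a sa fia.
by exists e => // b sb ab; exists i => //; exact: ef.
Qed.

HB.instance Definition _ := gen_eqMixin realization.
HB.instance Definition _ := gen_choiceMixin realization.
HB.instance Definition _ := @isOpenTopological.Build realization weak_open
  weak_openT weak_openI weak_open_bigU.

End Realization.

Section Disk.
Variable R : realType.
Local Notation plane := (R * R)%type.
Implicit Types (p q c x y z w : plane) (Z C : set plane).

Definition sqnorm p : R := p.1 ^+ 2 + p.2 ^+ 2.
Definition det2 p q : R := p.1 * q.2 - p.2 * q.1.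

Definition circle : set plane := [set p | sqnorm p = 1].
Definition disk : set plane := [set p | sqnorm p <= 1].
Definition open_disk : set plane := [set p | sqnorm p < 1].

(* For x, y, z on the circle: going counterclockwise from x, one meets y
   strictly before z (i.e. the triangle xyz is positively oriented). *)
Definition ccw x y z : Prop := 0 < det2 (y - x) (z - x).

(* The closed arc from x counterclockwise to y, for x <> y. *)
Definition circle_arc x y : set plane :=
  [set p | circle p /\ [\/ p = x, p = y | ccw x p y]].

(* The closed geodesic of the Poincare disk between two distinct points of the
   circle: a diameter, or an arc of a circle (of center c and radius r)
   orthogonal to the unit circle. *)
Definition geodesic x y : set plane :=
  [set p | disk p /\
    ((x + y = 0 /\ exists t : R, p = (t * x.1, t * x.2)) \/
     exists c, exists2 r : R, 0 < r &
       [/\ sqnorm c = 1 + r ^+ 2, sqnorm (x - c) = r ^+ 2,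
           sqnorm (y - c) = r ^+ 2 & sqnorm (p - c) = r ^+ 2])].

(* C together with the bounded components of its complement. *)
Definition enclosed C : set plane :=
  C `|` [set p | (~` C) p /\ bounded_set (connected_component (~` C) p)].

(* L_n(Z) for n >= 1; index 0 is Z itself. *)
Definition limit_set n Z : set plane :=
  iter n (fun A : set plane => circle `&` limit_point A) Z.

(* For q close to p on the circle, the sign of det2 p q tells on which side
   of p the point q lies. *)
Definition limit_from_both_sides Z p : Prop :=
  forall U, nbhs p U ->
    (exists q, [/\ Z q, U q & 0 < det2 p q]) /\
    (exists q, [/\ Z q, U q & det2 p q < 0]).

Definition admissible Z : Prop :=
  [/\ Z `<=` circle,
      Z `<=` isolated Z,
      forall p, limit_set 1 Z p -> limit_from_both_sides Z p &
      (`I_4 #<= Z)%card].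

(* w is the successor z^+ of z, equivalently z is the predecessor w^-. *)
Definition successor Z z w : Prop :=
  [/\ Z z, Z w, z <> w & forall q, Z q -> ~ ccw z q w].

(* The pair (x, y) stands for the object E(x,y). *)
Definition indecomposable Z (e : plane * plane) : Prop :=
  [/\ Z e.1, Z e.2, e.2 <> e.1, ~ successor Z e.1 e.2 &
      ~ successor Z e.2 e.1].

Definition isomorphic (e f : plane * plane) : Prop :=
  f = e \/ f = (e.2, e.1).

Definition crossing (e f : plane * plane) : Prop :=
  geodesic e.1 e.2 <> geodesic f.1 f.2 /\
  geodesic e.1 e.2 `&` geodesic f.1 f.2 `&` open_disk !=set0.

Definition compatible e f : Prop := ~ crossing e f.

Definition precluster Z (S : set (plane * plane)) : Prop :=
  S `<=` indecomposable Z /\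
  forall e f, S e -> S f -> e <> f -> compatible e f /\ ~ isomorphic e f.

Definition cluster Z (S : set (plane * plane)) : Prop :=
  precluster Z S /\ forall T, precluster Z T -> S `<=` T -> T = S.

Definition in_upto_iso (S : set (plane * plane)) x y : Prop :=
  exists2 e, S e & isomorphic e (x, y).

Definition edge Z (S : set (plane * plane)) x y : Prop :=
  [\/ in_upto_iso S x y, successor Z x y | successor Z y x].

Definition cluster_complex Z (S : set (plane * plane)) : set {fset plane} :=
  [set s | [/\ (0 < #|` s| <= 3)%N,
               forall v, v \in s -> Z v &
               forall u v, u \in s -> v \in s -> u <> v -> edge Z S u v]].

Definition is_psi Z (S : set (plane * plane))
    (psi : realization R (cluster_complex Z S) -> plane) : Prop :=
  [/\ forall z a, Z z -> face [fset z]%fset a -> psi a = z,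
      forall z w, successor Z z w ->
        homeomorphism_on psi (face [fset z; w]%fset) (circle_arc z w),
      forall x y, in_upto_iso S x y ->
        homeomorphism_on psi (face [fset x; y]%fset) (geodesic x y) &
      forall s, cluster_complex Z S s -> #|` s| = 3%N ->
        homeomorphism_on psi (face s) (enclosed (psi @` face_boundary s))].

(* psi is determined by Z and S only up to a self-homeomorphism of the
   realization preserving every simplex, so the choice of psi is immaterial. *)
Definition triangulation_cluster Z (S : set (plane * plane)) : Prop :=
  cluster Z S /\
  exists psi : realization R (cluster_complex Z S) -> plane,
    is_psi psi /\ homeomorphism_on psi setT (disk `\` limit_set 1 Z).

End Disk.

(* Main.v *)
(* In the Klein model of the disk geodesics are straight chords. Give the points
   of Z distinct ranks in nat and insert them by increasing rank: a new point z
   falls into an arc from a to b between consecutive earlier points and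
   contributes the triangle a z b. Two points are joined by an edge iff one of
   the two arcs between them contains only points of rank larger than both; the
   edges other than the pairs {z, z^+} form the cluster. Since limit points of Z
   are limits from both sides, compactness of the circle shows that the arcs
   which are still subdivided after stage n are uniformly small for n large.
   Hence the triangles are locally finite in the disk minus L(Z), and they cover
   it. On each triangle psi is a radial map from the centroid, which bulges the
   sides {z, z^+} out to the circle and fixes the other sides pointwise. Its
   inverse is continuous on each triangle, hence globally by local finiteness. *)
From HB Require Import structures.
Require Import Defs.
From mathcomp Require Import all_boot all_order all_algebra finmap.
From mathcomp Require Import all_classical all_reals all_analysis.
From mathcomp Require Import ring lra zify.

Set Implicit Arguments.
Unset Strict Implicit.
Unset Printing Implicit Defensive.

Import Order.TTheory GRing.Theory Num.Theory.
Import numFieldNormedType.Exports.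

Local Open Scope classical_set_scope.
Local Open Scope ring_scope.

(** * Orientation and caps of the disk *)

(** The whole geometry runs through the sign of [orient]. Between points of the circle this sign is
    a cyclic order, which [pos] turns into an order of real numbers, so that facts about arcs become
    linear arithmetic. For a point of the disk it tells on which side of a chord the point lies, and
    nested arcs cut off nested caps. A triangle and its bulged version are both star-shaped about
    the centroid, hence unit balls of gauges. The radial map between them fixes every point at which
    the two gauges agree; this is why the maps of neighbouring triangles fit together. A curve given
    by a gauge also has a computable enclosed region. The weak topology makes psi continuous as soon
    as it is so on each simplex; the difficulty is the inverse, as infinitely many triangles may
    accumulate. An arc still to be subdivided cannot contain a point of Z already inserted, so near
    an isolated point it disappears, and near a limit point it is trapped between two inserted
    points, one on each side. *)

HB.lock Definition orient (R : realType) (x y z : R * R) : R :=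
  det2 (y - x) (z - x).

Section Orientation.
Variable R : realType.
Local Notation plane := (R * R)%type.
Implicit Types (x y z w p q a b u v : plane).

Definition dot p q : R := p.1 * q.1 + p.2 * q.2.

Lemma orientE x y z :
  orient x y z = (y.1 - x.1) * (z.2 - x.2) - (y.2 - x.2) * (z.1 - x.1).
Proof. by rewrite unlock. Qed.

Lemma ccwE x y z : ccw x y z = (0 < orient x y z) :> Prop.
Proof. by rewrite unlock. Qed.

Lemma orient_rot x y z : orient y z x = orient x y z.
Proof. by rewrite !orientE; ring. Qed.

Lemma orient_swap x y z : orient x z y = - orient x y z.
Proof. by rewrite !orientE; ring. Qed.

Lemma orientxxy x y : orient x x y = 0.
Proof. by rewrite !orientE; ring. Qed.

Lemma orientxyy x y : orient x y y = 0.
Proof. by rewrite !orientE; ring. Qed.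

Lemma orientxyx x y : orient x y x = 0.
Proof. by rewrite !orientE; ring. Qed.

Lemma orient_neq x y z : 0 < orient x y z -> [/\ x <> y, y <> z & z <> x].
Proof.
move=> h; split=> e; move: h; rewrite e.
- by rewrite orientxxy ltxx.
- by rewrite orientxyy ltxx.
- by rewrite orientxyx ltxx.
Qed.

Lemma circle_sqr x : circle x -> x.2 ^+ 2 = 1 - x.1 ^+ 2.
Proof. by move=> <-; rewrite /sqnorm; ring. Qed.

Lemma circle_disk x : circle x -> disk x.
Proof. by rewrite /disk /= => ->. Qed.

Lemma pair_sqr_eq0 x : x.1 ^+ 2 + x.2 ^+ 2 = 0 -> x = 0.
Proof.
case: x => a b /= /eqP; rewrite paddr_eq0 ?sqr_ge0// !sqrf_eq0.
by move=> /andP[/eqP -> /eqP ->].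
Qed.

Lemma dot_le1 x p : circle x -> disk p -> dot p x <= 1.
Proof.
move=> /circle_sqr hx; rewrite /disk /sqnorm /dot /= => hp.
have := sqr_ge0 (p.1 - x.1); have := sqr_ge0 (p.2 - x.2); nra.
Qed.

Lemma sqnorm_sub_circle x p : circle x ->
  sqnorm (p - x) = sqnorm p + 1 - 2 * dot p x.
Proof. by move=> /circle_sqr hx; rewrite /sqnorm /dot /=; ring: hx. Qed.

Lemma dot_eq1 x y : circle x -> disk y -> dot x y = 1 -> x = y.
Proof.
move=> cx dy xy; apply/esym/eqP; rewrite -subr_eq0; apply/eqP.
apply: pair_sqr_eq0; apply/eqP; rewrite eq_le addr_ge0 ?sqr_ge0// andbT.
rewrite -/(sqnorm (y - x)) sqnorm_sub_circle// (_ : dot y x = 1).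
  by move: dy; rewrite /disk/=; lra.
by rewrite -xy /dot; ring.
Qed.

Lemma dot_lt1 x y : circle x -> disk y -> x <> y -> dot x y < 1.
Proof.
move=> cx dy xy; rewrite lt_neqAle; apply/andP; split.
  by apply/eqP => /(dot_eq1 cx dy).
by rewrite (_ : dot x y = dot y x) ?dot_le1// /dot; ring.
Qed.

(** Up to sign, [orient] is twice the area of the triangle. For a triangle inscribed in the unit
    circle the area is a quarter of the product of the side lengths, and the squared length of a
    side is 2 (1 - dot). *)
Lemma orient_sqr x y z : circle x -> circle y -> circle z ->
  orient x y z ^+ 2 = 2 * (1 - dot x y) * (1 - dot y z) * (1 - dot z x).
Proof.
move=> /circle_sqr hx /circle_sqr hy /circle_sqr hz; rewrite !orientE /dot.
ring: hx hy hz.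
Qed.

Lemma orient_eq0 x y z : circle x -> circle y -> circle z ->
  orient x y z = 0 -> [\/ x = y, y = z | z = x].
Proof.
move=> cx cy cz /eqP; rewrite -sqrf_eq0 orient_sqr// !mulf_eq0 pnatr_eq0/=.
move: (circle_disk cx) (circle_disk cy) (circle_disk cz) => dx dy dz.
move=> /orP[/orP[]|]; rewrite subr_eq0 => /eqP/esym.
- by move=> /(dot_eq1 cx dy); constructor 1.
- by move=> /(dot_eq1 cy dz); constructor 2.
- by move=> /(dot_eq1 cz dx); constructor 3.
Qed.

(* The cap cut off by the chord ab is contained in the one cut off by xb:
   at b the linear form of the latter is a nonnegative combination of the linear
   form of the former and of the tangent form [1 - dot p b]. *)
Lemma orient_cap_l x a b p : circle x -> circle a -> circle b ->
  (1 - dot a b) * orient x p b =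
  (1 - dot x b) * orient a p b + orient x a b * (1 - dot p b).
Proof.
move=> /circle_sqr hx /circle_sqr ha /circle_sqr hb; rewrite !orientE /dot.
ring: hb.
Qed.

Lemma orient_cap_r x y b p : circle x -> circle y -> circle b ->
  (1 - dot b x) * orient x p y =
  (1 - dot y x) * orient x p b + orient x b y * (1 - dot p x).
Proof.
move=> /circle_sqr hx /circle_sqr ha /circle_sqr hb; rewrite !orientE /dot.
ring: hx.
Qed.

(** For x, a, b, y in cyclic order the cap grows by one endpoint at a time: from the chord ab to xb,
    then to xy. *)
Lemma cap_sub x y a b p : circle x -> circle y -> circle a -> circle b ->
  disk p -> a <> b -> x <> b -> 0 <= orient x a b -> 0 <= orient x b y ->
  0 <= orient a p b -> 0 <= orient x p y.
Proof.
move=> cx cy ca cb dp ab xb xab xby apb.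
have ab1 := dot_lt1 ca (circle_disk cb) ab.
have bx1 := dot_lt1 cb (circle_disk cx) (nesym xb).
have xpb : 0 <= orient x p b.
  rewrite -(pmulr_rge0 _ (x := 1 - dot a b)) ?subr_gt0// (orient_cap_l _ cx)//.
  by rewrite addr_ge0// mulr_ge0// subr_ge0 dot_le1//; exact: circle_disk.
rewrite -(pmulr_rge0 _ (x := 1 - dot b x)) ?subr_gt0// (orient_cap_r _ cx)//.
by rewrite addr_ge0// mulr_ge0// subr_ge0 dot_le1//; exact: circle_disk.
Qed.

Lemma cap_sub_lt x y a b p : circle x -> circle y -> circle a -> circle b ->
  disk p -> x <> y -> a <> b -> x <> b -> 0 <= orient x a b -> 0 <= orient x b y ->
  0 < orient a p b -> 0 < orient x p y.
Proof.
move=> cx cy ca cb dp xy ab xb xab xby apb.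
have ab1 := dot_lt1 ca (circle_disk cb) ab.
have bx1 := dot_lt1 cb (circle_disk cx) (nesym xb).
have xb1 := dot_lt1 cx (circle_disk cb) xb.
have yx1 := dot_lt1 cy (circle_disk cx) (nesym xy).
have xpb : 0 < orient x p b.
  rewrite -subr_gt0 in ab1; rewrite -(pmulr_rgt0 _ ab1) (orient_cap_l _ cx)//.
  rewrite ltr_wpDr// ?mulr_gt0 ?subr_gt0//.
  by rewrite mulr_ge0// subr_ge0 dot_le1//; exact: circle_disk.
rewrite -subr_gt0 in bx1; rewrite -(pmulr_rgt0 _ bx1) (orient_cap_r _ cx)//.
rewrite ltr_wpDr// ?mulr_gt0 ?subr_gt0//.
by rewrite mulr_ge0// subr_ge0 dot_le1//; exact: circle_disk.
Qed.

(* On a cap containing al, the linear form [dot al] is minimal at an endpoint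
   of the chord; hu and hw are the Lagrange multiplier identities there. *)
Lemma cap_dot_ge al u w p : circle al -> circle u -> circle w -> disk p ->
  u <> w -> det2 al u <= 0 -> 0 <= det2 al w -> 0 <= orient u p w ->
  Num.min (dot al u) (dot al w) <= dot al p.
Proof.
move=> ca cu cw dp uw au aw upw; rewrite ge_min.
have uw1 : 0 < 1 - dot u w.
  by rewrite subr_gt0 dot_lt1//; exact: circle_disk.
have hu : (1 - dot u w) * (dot al p - dot al u) =
    - det2 al u * orient u p w + (dot al w - dot al u) * (1 - dot p u).
  move: ca cu cw => /circle_sqr ha /circle_sqr hu /circle_sqr hw.
  rewrite !orientE /dot /det2; ring: hu hw.
have hw : (1 - dot u w) * (dot al p - dot al w) =
    det2 al w * orient u p w + (dot al u - dot al w) * (1 - dot p w).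
  move: ca cu cw => /circle_sqr ha /circle_sqr hu' /circle_sqr hw.
  rewrite !orientE /dot /det2; ring: hu' hw.
have [le|/ltW le] := leP (dot al u) (dot al w); apply/orP; [left|right].
  rewrite -subr_ge0 -(pmulr_rge0 _ uw1) hu addr_ge0 ?mulr_ge0 ?oppr_ge0//.
    by rewrite subr_ge0.
  by rewrite subr_ge0 dot_le1.
rewrite -subr_ge0 -(pmulr_rge0 _ uw1) hw addr_ge0 ?mulr_ge0 ?oppr_ge0//.
  by rewrite subr_ge0.
by rewrite subr_ge0 dot_le1.
Qed.

End Orientation.

(** * The cyclic order of the circle *)

Section CyclicOrder.
Variable R : realType.
Local Notation plane := (R * R)%type.
Implicit Types (x y z w p q : plane) (a b c d e : R).

Definition cyc a b c := [|| a < b < c, b < c < a | c < a < b].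

(** The product is invariant under rotation and changes sign under a transposition; it is the factor
    that [orient_stereo] finds in [orient]. *)
Lemma cyc_prod a b c : (0 < (b - a) * (c - b) * (c - a)) = cyc a b c.
Proof.
rewrite /cyc; have [ab|ba|->] := ltgtP a b; last first.
- by rewrite subrr !mul0r ltxx; have [] := ltgtP b c; lra.
- rewrite -mulrA nmulr_rgt0 ?subr_lt0//.
  have [bc|cb|bc] := ltgtP b c.
  + by rewrite pmulr_rlt0 ?subr_gt0// ?subr_lt0; lra.
  + by rewrite nmulr_rlt0 ?subr_lt0// ?subr_gt0; lra.
  + by rewrite bc subrr !mul0r ltxx; lra.
- rewrite -mulrA pmulr_rgt0 ?subr_gt0//.
  have [bc|cb|bc] := ltgtP b c.
  + by rewrite pmulr_rgt0 ?subr_gt0// ?subr_gt0; lra.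
  + by rewrite nmulr_rgt0 ?subr_lt0// ?subr_lt0; lra.
  + by rewrite bc subrr !mul0r ltxx; lra.
Qed.

(** An increasing map of the line onto (-1, 1), which leaves the value -1 for the point missed by
    the stereographic projection. *)
Definition squash a : R := a / (1 + `|a|).

Lemma squash_gtN1 a : -1 < squash a.
Proof.
have := normr_ge0 a; have := ler_norm (- a); rewrite normrN /squash => h1 h2.
rewrite ltr_pdivlMr; nra.
Qed.

Lemma squash_lt a b : (squash a < squash b) = (a < b).
Proof.
rewrite /squash ltr_pdivrMr ?ltr_pwDl// mulrAC ltr_pdivlMr ?ltr_pwDl//.
by have [a0|a0] := ger0P a; have [b0|b0] := ger0P b; apply/idP/idP; nra.
Qed.

(** At angle t this is -cot(t/2); the sign makes it increase counterclockwise from (1, 0). *)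
Definition stereo p : R := - p.2 / (1 - p.1).

(* The circle cut at (1, 0), parametrized by a bounded function of the
   stereographic projection; the value at the cut is the minimum -1. *)
Definition pos p : R := if p.1 == 1 then -1 else squash (stereo p).

Lemma circle_cut p : circle p -> p.1 = 1 -> p = (1, 0).
Proof.
case: p => p1 p2 /circle_sqr /= + p1E; rewrite p1E expr1n subrr => /eqP.
by rewrite sqrf_eq0 => /eqP ->.
Qed.

Lemma circle_le1 p : circle p -> p.1 <= 1.
Proof. by case: p => p1 p2 /circle_sqr /= h; nra. Qed.

Lemma circle_cut_gt0 p : circle p -> p.1 != 1 -> 0 < 1 - p.1.
Proof. by move=> cp p1; rewrite subr_gt0 lt_neqAle p1 circle_le1. Qed.

Lemma orient_stereo x y z : circle x -> circle y -> circle z ->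
  x.1 != 1 -> y.1 != 1 -> z.1 != 1 ->
  (0 < orient x y z) = cyc (stereo x) (stereo y) (stereo z).
Proof.
move=> cx cy cz x1 y1 z1; rewrite -cyc_prod.
have ux := circle_cut_gt0 cx x1; have uy := circle_cut_gt0 cy y1.
have uz := circle_cut_gt0 cz z1.
have -> : orient x y z = 2^-1 * (1 - x.1) * (1 - y.1) * (1 - z.1) *
    ((stereo y - stereo x) * (stereo z - stereo y) * (stereo z - stereo x)).
  have hx := circle_sqr cx; have hy := circle_sqr cy; have hz := circle_sqr cz.
  rewrite !orientE /stereo; field: hx hy hz.
  by rewrite !lt0r_neq0.
by rewrite pmulr_rgt0// !mulr_gt0// invr_gt0.
Qed.

Lemma orient_cut y z : circle y -> circle z -> y.1 != 1 -> z.1 != 1 ->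
  (0 < orient (1, 0) y z) = (stereo y < stereo z).
Proof.
move=> cy cz y1 z1.
have uy := circle_cut_gt0 cy y1; have uz := circle_cut_gt0 cz z1.
have -> : orient (1, 0) y z = (1 - y.1) * (1 - z.1) * (stereo z - stereo y).
  by rewrite !orientE /stereo /=; field; rewrite !lt0r_neq0.
by rewrite pmulr_rgt0 ?subr_gt0// mulr_gt0.
Qed.

Lemma cyc_rot a b c : cyc b c a = cyc a b c.
Proof. by rewrite /cyc orbA orbC. Qed.

(** The bridge from geometry to order: unfolding [cyc] afterwards leaves inequalities between real
    numbers, which [lra] decides. *)
Lemma orient_pos x y z : circle x -> circle y -> circle z ->
  (0 < orient x y z) = cyc (pos x) (pos y) (pos z).
Proof.
(* The cut has the least value of [pos], so a cyclic triple starting there is an inequality between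
   the other two values. *)
have cut y' z' : circle y' -> circle z' ->
    (0 < orient (1, 0) y' z') = cyc (-1) (pos y') (pos z').
  move=> cy cz; rewrite /pos.
  have [/circle_cut ->//|y1] := eqVneq; first by rewrite orientxxy ltxx /cyc; lra.
  have [/circle_cut ->//|z1] := eqVneq.
    by rewrite orientxyx ltxx /cyc; have := squash_gtN1 (stereo y'); lra.
  rewrite orient_cut//; have := squash_gtN1 (stereo y').
  have := squash_gtN1 (stereo z'); rewrite /cyc -squash_lt => h1 h2.
  by move: h1 h2; lra.
have p1 : pos (1, 0) = -1 by rewrite /pos /= eqxx.
move=> cx cy cz.
have [/circle_cut xE|x1] := eqVneq x.1 1.
  by rewrite xE// cut// p1.
have [/circle_cut yE|y1] := eqVneq y.1 1.
  by rewrite yE// -orient_rot cut// p1 cyc_rot.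
have [/circle_cut zE|z1] := eqVneq z.1 1.
  by rewrite zE// orient_rot cut// p1 -cyc_rot.
by rewrite orient_stereo// /cyc /pos !ifN// !squash_lt.
Qed.

Lemma pos_inj x y : circle x -> circle y -> pos x = pos y -> x = y.
Proof.
move=> cx cy; rewrite /pos.
have [/circle_cut ->//|x1] := eqVneq; have [/circle_cut ->//|y1] := eqVneq.
- by have := squash_gtN1 (stereo y) => /[swap] <-; rewrite ltxx.
- by have := squash_gtN1 (stereo x) => /[swap] ->; rewrite ltxx.
- move=> h; have {h} : stereo x = stereo y.
    apply/eqP; rewrite eq_le !leNgt -(squash_lt (stereo x)).
    by rewrite -(squash_lt (stereo y)) h ltxx.
  have ux := circle_cut_gt0 cx x1; have uy := circle_cut_gt0 cy y1.
  move=> /(congr1 (fun t => (1 - x.1) * (1 - y.1) * t)).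
  have -> : (1 - x.1) * (1 - y.1) * stereo x = - (x.2 * (1 - y.1)).
    by rewrite /stereo; field; rewrite lt0r_neq0.
  have -> : (1 - x.1) * (1 - y.1) * stereo y = - (y.2 * (1 - x.1)).
    by rewrite /stereo; field; rewrite lt0r_neq0.
  move=> h; have h0 : orient (1, 0) x y = 0 by rewrite orientE /=; lra.
  have c1 : circle (1, 0 : R) by rewrite /circle /sqnorm /= expr0n expr1n addr0.
  have [e|//|e] := orient_eq0 c1 cx cy h0.
    by move: x1; rewrite -e eqxx.
  by move: y1; rewrite e eqxx.
Qed.

End CyclicOrder.

(** * Radial maps, Klein and Poincare models *)

Section Plane.
Variable R : realType.
Local Notation plane := (R * R)%type.
Implicit Types (x y z p q d o : plane) (t c : R) (g h : plane -> R).

Definition scale t p : plane := (t * p.1, t * p.2).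

Lemma plane_ext p q : p.1 = q.1 -> p.2 = q.2 -> p = q.
Proof. by case: p q => ? ? [? ?] /= -> ->. Qed.

Lemma scaleA s t p : scale s (scale t p) = scale (s * t) p.
Proof. by rewrite /scale /= !mulrA. Qed.

Lemma scale1 p : scale 1 p = p.
Proof. by case: p => p1 p2; rewrite /scale /= !mul1r. Qed.

Lemma scale0 t : scale t 0 = 0.
Proof. by rewrite /scale /= !mulr0. Qed.

Lemma plane_cvg (T : Type) (F : set_system T) {FF : Filter F} (f : T -> plane) p :
  (f s).1 @[s --> F] --> p.1 -> (f s).2 @[s --> F] --> p.2 -> f s @[s --> F] --> p.
Proof.
move=> f1 f2; rewrite [X in _ --> X](_ : p = (p.1, p.2)); last by case: p {f1 f2}.
have -> : f = (fun s => ((f s).1, (f s).2)) by apply/funext => s; case: (f s).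
exact: (cvg_pair f1 f2).
Qed.

Lemma fst_cvg p : q.1 @[q --> p] --> p.1.
Proof. exact: cvg_fst. Qed.

Lemma snd_cvg p : q.2 @[q --> p] --> p.2.
Proof. exact: cvg_snd. Qed.

Lemma sqnorm_continuous : continuous (@sqnorm R).
Proof.
move=> p; apply: cvgD.
  exact: (cvgM (@fst_cvg p) (@fst_cvg p)).
exact: (cvgM (@snd_cvg p) (@snd_cvg p)).
Qed.

Lemma dot_continuous p : continuous (@dot R p).
Proof.
move=> d; apply: cvgD; apply: cvgM; try exact: cvg_cst.
  exact: fst_cvg.
exact: snd_cvg.
Qed.

(** The Minkowski functional of a star-shaped body around 0, with neither convexity nor symmetry.
    [gauge_bound] says that the body is bounded; it yields the continuity of [radial] at 0 and the
    boundedness used in [enclosed_gauge]. *)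
Record gauge g : Prop := Gauge {
  gauge_continuous : continuous g;
  gauge_scale : forall t p, 0 <= t -> g (scale t p) = t * g p;
  gauge_gt0 : forall p, p <> 0 -> 0 < g p;
  gauge_bound : exists2 C, 0 < C & forall p, `|p.1| <= C * g p /\ `|p.2| <= C * g p }.

Lemma gauge0 g : gauge g -> g 0 = 0.
Proof.
by move=> gg; rewrite -[X in g X](@scale0 0) (gauge_scale gg)// mul0r.
Qed.

Lemma gauge_ge0 g p : gauge g -> 0 <= g p.
Proof.
move=> gg; have [->|p0] := pselect (p = 0); first by rewrite gauge0.
exact/ltW/gauge_gt0.
Qed.

(* Radial map carrying the unit ball of g onto the unit ball of h. *)
Definition radial g h p := scale (g p / h p) p.

Lemma radial0 g h : radial g h 0 = 0.
Proof. by rewrite /radial scale0. Qed.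

Lemma gauge_radial g h p : gauge g -> gauge h -> h (radial g h p) = g p.
Proof.
move=> gg gh; have [->|p0] := pselect (p = 0).
  by rewrite radial0 !gauge0.
have hp := gauge_gt0 gh p0; have gp := gauge_gt0 gg p0.
by rewrite (gauge_scale gh) ?divr_ge0 ?ltW// divfK// gt_eqF.
Qed.

Lemma radialK g h : gauge g -> gauge h -> cancel (radial g h) (radial h g).
Proof.
move=> gg gh p; have [->|p0] := pselect (p = 0); first by rewrite !radial0.
have hp := gauge_gt0 gh p0; have gp := gauge_gt0 gg p0.
rewrite {1}/radial gauge_radial// /radial (gauge_scale gg) ?divr_ge0 ?ltW//.
rewrite scaleA (_ : _ * _ = 1) ?scale1//.
by field; rewrite !gt_eqF.
Qed.

Lemma radial_eq g h p : gauge g -> gauge h -> g p = h p -> radial g h p = p.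
Proof.
move=> gg gh; have [->|p0 gp] := pselect (p = 0); first by rewrite radial0.
by rewrite /radial gp divff ?scale1// gt_eqF// gauge_gt0.
Qed.

Lemma radial_continuous g h : gauge g -> gauge h -> continuous (radial g h).
Proof.
move=> gg gh p; have [->|/eqP p0] := pselect (p = 0); last first.
  have q : (g q / h q) @[q --> p] --> g p / h p.
    apply: cvgM; first exact: gauge_continuous.
    apply: cvgV; last exact: gauge_continuous.
    by rewrite gt_eqF// gauge_gt0//; exact/eqP.
  apply: plane_cvg; first exact: (cvgM q (@fst_cvg p)).
  exact: (cvgM q (@snd_cvg p)).
(* At 0 the quotient g / h need not have a limit, but the image of q has gauge g q for h, hence
   coordinates at most C * g q, which tends to 0. *)
rewrite /prop_for /continuous_at radial0.
have [C C0 hC] := gauge_bound gh.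
have Cg0 : C * g q @[q --> (0 : plane)] --> (0 : R).
  rewrite -[X in _ --> X](mulr0 C) -(gauge0 gg).
  by apply: cvgM; [exact: cvg_cst|exact: gauge_continuous].
have NCg0 : - (C * g q) @[q --> (0 : plane)] --> (0 : R).
  by rewrite -[X in _ --> X]oppr0; exact: cvgN.
have bnd q : `|(radial g h q).1| <= C * g q /\ `|(radial g h q).2| <= C * g q.
  by have := hC (radial g h q); rewrite gauge_radial.
apply: plane_cvg; apply: squeeze_cvgr NCg0 Cg0; apply: nearW => q.
  by rewrite -ler_norml; have [] := bnd q.
by rewrite -ler_norml; have [] := bnd q.
Qed.

Lemma poincare_denom_gt0 p : 0 < 1 + Num.sqrt (1 - sqnorm p).
Proof. by rewrite ltr_wpDr// sqrtr_ge0. Qed.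

(* Homeomorphisms between the Poincare and the Klein model, extended by the
   identity outside the disk (where the square root below is 0). *)
Definition klein p := scale (2 / (1 + Num.min 1 (sqnorm p))) p.
Definition poincare p := scale (1 + Num.sqrt (1 - sqnorm p))^-1 p.

Lemma sqnorm_ge0 p : 0 <= sqnorm p.
Proof. by rewrite addr_ge0 ?sqr_ge0. Qed.

Lemma sqnorm_scale t p : sqnorm (scale t p) = t ^+ 2 * sqnorm p.
Proof. by rewrite /sqnorm /scale /=; ring. Qed.

Lemma klein_out p : 1 <= sqnorm p -> klein p = p.
Proof.
by move=> p1; rewrite /klein min_l// divff ?scale1// lt0r_neq0.
Qed.

Lemma klein_in p : sqnorm p <= 1 -> klein p = scale (2 / (1 + sqnorm p)) p.
Proof. by move=> p1; rewrite /klein min_r. Qed.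

Lemma poincare_out p : 1 <= sqnorm p -> poincare p = p.
Proof.
move=> p1; rewrite /poincare ler0_sqrtr ?subr_le0// addr0 invr1.
exact: scale1.
Qed.

Lemma klein_circle p : circle p -> klein p = p.
Proof. by move=> cp; rewrite klein_out// cp. Qed.

Lemma poincare_circle p : circle p -> poincare p = p.
Proof. by move=> cp; rewrite poincare_out// cp. Qed.

(** A perfect square, so that the root in [poincare (klein p)] becomes a rational function of
    [sqnorm p]. *)
Lemma one_sub_sqnorm_klein p : sqnorm p <= 1 ->
  1 - sqnorm (klein p) = ((1 - sqnorm p) / (1 + sqnorm p)) ^+ 2.
Proof.
move=> p1; rewrite klein_in// sqnorm_scale; have := sqnorm_ge0 p => p0.
by field; rewrite lt0r_neq0// ltr_wpDr.
Qed.

Lemma one_sub_sqnorm_poincare p : sqnorm p <= 1 -> 1 - sqnorm (poincare p) =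
  2 * Num.sqrt (1 - sqnorm p) / (1 + Num.sqrt (1 - sqnorm p)).
Proof.
move=> p1; have w2 := sqr_sqrtr (a := 1 - sqnorm p).
rewrite subr_ge0 p1 in w2; have {}w2 := w2 isT.
rewrite /poincare sqnorm_scale; have := poincare_denom_gt0 p.
move: (Num.sqrt _) w2 => w w2 w0.
have -> : sqnorm p = 1 - w ^+ 2 by rewrite w2; ring.
by field; rewrite lt0r_neq0.
Qed.

Lemma disk_klein p : disk (klein p) <-> disk p.
Proof.
rewrite /disk /=; have [p1|p1] := orP (le_total (sqnorm p) 1); last first.
  by rewrite klein_out//; split.
by rewrite p1; split=> // _; rewrite -subr_ge0 one_sub_sqnorm_klein// sqr_ge0.
Qed.

Lemma open_disk_klein p : open_disk (klein p) <-> open_disk p.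
Proof.
rewrite /open_disk /=; have [p1|p1] := orP (le_total (sqnorm p) 1); last first.
  by rewrite klein_out//; split.
have s0 : 0 < 1 + sqnorm p by rewrite ltr_wpDr ?sqnorm_ge0.
rewrite -subr_gt0 one_sub_sqnorm_klein// lt_neqAle sqr_ge0 andbT eq_sym.
rewrite sqrf_eq0 mulf_eq0 invr_eq0 (gt_eqF s0) orbF subr_eq0 eq_sym.
by rewrite [in X in _ <-> X]lt_neqAle p1 andbT.
Qed.

Lemma kleinK : cancel klein poincare.
Proof.
move=> p; have [p1|p1] := orP (le_total (sqnorm p) 1); last first.
  by rewrite klein_out// poincare_out.
have p0 := sqnorm_ge0 p.
rewrite /poincare one_sub_sqnorm_klein// sqrtr_sqr ger0_norm; last first.
  by rewrite divr_ge0 ?subr_ge0// addr_ge0.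
rewrite klein_in// scaleA (_ : _ * _ = 1) ?scale1//.
have s0 : 0 < 1 + sqnorm p by rewrite ltr_wpDr.
have s2 : 1 + sqnorm p + (1 - sqnorm p) != 0.
  by rewrite (_ : _ + _ = 2) ?pnatr_eq0//; ring.
by field; rewrite lt0r_neq0//= ?s2.
Qed.

Lemma poincareK : cancel poincare klein.
Proof.
move=> p; have [p1|p1] := orP (le_total (sqnorm p) 1); last first.
  by rewrite poincare_out// klein_out.
have w0 := poincare_denom_gt0 p; have sw0 := sqrtr_ge0 (1 - sqnorm p).
have q1 : sqnorm (poincare p) <= 1.
  by rewrite -subr_ge0 one_sub_sqnorm_poincare// divr_ge0 ?mulr_ge0// ltW.
rewrite klein_in//.
have -> : 1 + sqnorm (poincare p) = 2 / (1 + Num.sqrt (1 - sqnorm p)).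
  have := one_sub_sqnorm_poincare p1; move/eqP; rewrite subr_eq => /eqP e.
  have -> : sqnorm (poincare p) = 1 -
    2 * Num.sqrt (1 - sqnorm p) / (1 + Num.sqrt (1 - sqnorm p)).
    by rewrite [X in X - _]e; ring.
  by field; rewrite lt0r_neq0.
rewrite {1}/poincare scaleA (_ : _ * _ = 1) ?scale1//.
by field; rewrite lt0r_neq0.
Qed.

Lemma disk_poincare p : disk (poincare p) <-> disk p.
Proof. by rewrite -disk_klein poincareK. Qed.

Lemma open_disk_poincare p : open_disk (poincare p) <-> open_disk p.
Proof. by rewrite -open_disk_klein poincareK. Qed.

Lemma scale_continuous (f : plane -> R) : continuous f ->
  continuous (fun p => scale (f p) p).
Proof.
move=> cf p; apply: plane_cvg; first exact: (cvgM (cf p) (@fst_cvg p)).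
exact: (cvgM (cf p) (@snd_cvg p)).
Qed.

Lemma klein_continuous : continuous klein.
Proof.
apply: scale_continuous => p; apply: cvgM; first exact: cvg_cst.
apply: cvgV.
  by rewrite lt0r_neq0// ltr_wpDr// le_min ler01 sqnorm_ge0.
apply: cvgD; first exact: cvg_cst.
apply: (@continuous_min _ _ (fun=> 1) (@sqnorm R)); first exact: cvg_cst.
exact: sqnorm_continuous.
Qed.

Lemma poincare_continuous : continuous poincare.
Proof.
apply: scale_continuous => p; apply: cvgV; first exact/lt0r_neq0/poincare_denom_gt0.
apply: cvgD; first exact: cvg_cst.
apply: (@cvg_comp _ _ _ (fun q => 1 - sqnorm q) Num.sqrt _ (nbhs (1 - sqnorm p))).
  by apply: cvgB; [exact: cvg_cst|exact: sqnorm_continuous].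
exact: sqrt_continuous.
Qed.

End Plane.

(** * The gauge of the unit disk about an interior point *)

Section DiskGauge.
Variable R : realType.
Local Notation plane := (R * R)%type.
Implicit Types (x y z p q d o : plane) (t c : R).
Variable o : plane.
Hypothesis o_in : open_disk o.
Let A := 1 - sqnorm o.

Let A_gt0 : 0 < A. Proof. by rewrite subr_gt0. Qed.

(* The positive root t of [sqnorm (o + d / t) = 1]. *)
Definition disk_gauge d : R :=
  (dot o d + Num.sqrt (dot o d ^+ 2 + (1 - sqnorm o) * sqnorm d)) /
  (1 - sqnorm o).

Let disc_ge0 d : 0 <= dot o d ^+ 2 + A * sqnorm d.
Proof. by rewrite addr_ge0 ?sqr_ge0// mulr_ge0 ?sqnorm_ge0// ltW. Qed.

(** The equation sqnorm (o + d / t) = 1, multiplied by the square of t. *)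
Lemma disk_gauge_quad d :
  A * disk_gauge d ^+ 2 = 2 * dot o d * disk_gauge d + sqnorm d.
Proof.
have := sqr_sqrtr (disc_ge0 d); rewrite /disk_gauge -/A.
move: (Num.sqrt _) => w w2.
have -> : sqnorm d = (w ^+ 2 - dot o d ^+ 2) / A.
  by rewrite w2; field; rewrite lt0r_neq0.
by field; rewrite lt0r_neq0.
Qed.

Lemma sqnorm_gt0 d : d <> 0 -> 0 < sqnorm d.
Proof.
move=> d0; rewrite lt_neqAle sqnorm_ge0 andbT eq_sym.
by apply/eqP => /pair_sqr_eq0.
Qed.

Lemma disk_gauge_gt0 d : d <> 0 -> 0 < disk_gauge d.
Proof.
move=> d0; rewrite divr_gt0//.
have d1 := sqnorm_gt0 d0; have := disc_ge0 d; rewrite -/A => h.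
have w0 := sqrtr_ge0 (dot o d ^+ 2 + A * sqnorm d).
have w2 := sqr_sqrtr h.
have := mulr_gt0 A_gt0 d1; move: w0 w2; move: (Num.sqrt _) => w; nra.
Qed.

Lemma disk_gauge_scale t d : 0 <= t -> disk_gauge (scale t d) = t * disk_gauge d.
Proof.
move=> t0; rewrite /disk_gauge sqnorm_scale -/A.
have -> : dot o (scale t d) = t * dot o d by rewrite /dot /=; ring.
have -> : (t * dot o d) ^+ 2 + A * (t ^+ 2 * sqnorm d) =
    t ^+ 2 * (dot o d ^+ 2 + A * sqnorm d) by ring.
by rewrite sqrtrM ?sqr_ge0// sqrtr_sqr ger0_norm// -mulrDr mulrA.
Qed.

Lemma disk_gauge_continuous : continuous disk_gauge.
Proof.
move=> d; apply: cvgM; last exact: cvg_cst.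
apply: cvgD; first exact: dot_continuous.
apply: (@cvg_comp _ _ _ (fun d => dot o d ^+ 2 + A * sqnorm d) Num.sqrt _
  (nbhs (dot o d ^+ 2 + A * sqnorm d))); last exact: sqrt_continuous.
apply: cvgD; first exact: (cvgM (@dot_continuous _ o d) (@dot_continuous _ o d)).
by apply: cvgM; [exact: cvg_cst|exact: sqnorm_continuous].
Qed.

Lemma dot_sqr_le p q : dot p q ^+ 2 <= sqnorm p * sqnorm q.
Proof.
rewrite -subr_ge0 (_ : _ - _ = det2 p q ^+ 2) ?sqr_ge0//.
by rewrite /dot /sqnorm /det2; ring.
Qed.

(** Two points of the disk are at distance at most 2; the constant 3 leaves room in the estimates.
    If the claim failed, [h3] and [h4] would bound the square of N - A g^2 below by 64/81 N^2,
    whereas [h2] and [h5] bound it above by 4/9 N^2. *)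
Lemma sqnorm_le_disk_gauge d : sqnorm d <= (3 * disk_gauge d) ^+ 2.
Proof.
have [->|d0] := pselect (d = 0).
  by rewrite /sqnorm /= expr0n addr0 sqr_ge0.
have := disk_gauge_quad d; have g0 := disk_gauge_gt0 d0.
have := sqnorm_gt0 d0; have := dot_sqr_le o d.
have : A <= 1 by rewrite gerBl sqnorm_ge0.
have -> : sqnorm o = 1 - A by rewrite /A; ring.
move: (sqnorm d) (dot o d) (disk_gauge d) g0 => N e g g0 A1 eN N0 quad.
rewrite leNgt; apply/negP => lt; have A0 := A_gt0.
have Ng : 9 * g ^+ 2 < N by move: lt; rewrite exprMn; lra.
have h1 : e ^+ 2 <= N by apply: le_trans eN _; rewrite ler_piMl// ?ltW//; lra.
have h2 : (N - A * g ^+ 2) ^+ 2 <= 4 * N * g ^+ 2.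
  have -> : N - A * g ^+ 2 = - (2 * e * g) by rewrite quad; ring.
  have -> : (- (2 * e * g)) ^+ 2 = 4 * e ^+ 2 * g ^+ 2 by ring.
  by rewrite ler_wpM2r ?sqr_ge0// ler_wpM2l.
have h3 : 8 / 9 * N <= N - A * g ^+ 2.
  have : A * g ^+ 2 <= g ^+ 2 by rewrite ler_piMl ?sqr_ge0.
  lra.
have h4 : (8 / 9 * N) ^+ 2 <= (N - A * g ^+ 2) ^+ 2.
  by rewrite lerXn2r ?nnegrE//; lra.
have h5 : 4 * N * g ^+ 2 < 4 / 9 * N ^+ 2.
  have : N * (9 * g ^+ 2) < N * N by rewrite ltr_pM2l.
  by rewrite -expr2; lra.
have := le_lt_trans (le_trans h4 h2) h5; rewrite exprMn.
have : 0 < N ^+ 2 by rewrite exprn_gt0.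
by rewrite expr2 -/(N * N); lra.
Qed.

Lemma disk_gauge_bound d :
  `|d.1| <= 3 * disk_gauge d /\ `|d.2| <= 3 * disk_gauge d.
Proof.
have g0 : 0 <= 3 * disk_gauge d.
  have [->|/disk_gauge_gt0 g0] := pselect (d = 0); last by rewrite mulr_ge0// ltW.
  by rewrite -(@scale0 _ 0) disk_gauge_scale// mul0r mulr0.
have := sqnorm_le_disk_gauge d; rewrite /sqnorm => h.
by split; rewrite -(@ler_pXn2r _ 2)// ?nnegrE// real_normK ?num_real//;
  apply: le_trans h; rewrite ?lerDl ?lerDr sqr_ge0.
Qed.

Lemma gauge_disk_gauge : gauge disk_gauge.
Proof.
split; [exact: disk_gauge_continuous|exact: disk_gauge_scale|
  exact: disk_gauge_gt0|by exists 3 => // d; exact: disk_gauge_bound].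
Qed.

(** The quadratic A t^2 - 2 (dot o d) t - sqnorm d takes the value 1 - sqnorm (o + d) at t = 1.
    Dividing it by t minus its root [disk_gauge d] leaves a linear factor, whose value c at 1 is
    positive because the other root is negative. *)
Lemma one_sub_sqnorm_gauge d : d <> 0 -> exists2 c, 0 < c &
  1 - sqnorm (o + d) = (1 - disk_gauge d) * c.
Proof.
move=> d0; have g0 := disk_gauge_gt0 d0; have quad := disk_gauge_quad d.
have gE : A * disk_gauge d - 2 * dot o d = sqnorm d / disk_gauge d.
  apply: (mulIf (lt0r_neq0 g0)); rewrite divfK ?lt0r_neq0//.
  by rewrite mulrBl -mulrA -expr2 quad; ring.
exists (A + (A * disk_gauge d - 2 * dot o d)).
  by rewrite gE ltr_wpDr// divr_ge0 ?sqnorm_ge0// ltW.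
have -> : 1 - sqnorm (o + d) = A - 2 * dot o d - sqnorm d.
  by rewrite /A /sqnorm /dot /=; ring.
have -> : sqnorm d = A * disk_gauge d ^+ 2 - 2 * dot o d * disk_gauge d.
  by rewrite quad; ring.
by ring.
Qed.

Lemma disk_gauge_le1 d : disk (o + d) <-> disk_gauge d <= 1.
Proof.
have [->|d0] := pselect (d = 0).
  by rewrite (gauge0 gauge_disk_gauge) addr0 ler01; split=> // _; exact: ltW.
have [c c0 e] := one_sub_sqnorm_gauge d0.
by rewrite /disk /= -subr_ge0 e pmulr_lge0// subr_ge0.
Qed.

Lemma disk_gauge_eq1 d : circle (o + d) <-> disk_gauge d = 1.
Proof.
have [->|d0] := pselect (d = 0).
  rewrite (gauge0 gauge_disk_gauge) addr0; split.
    by move=> oc; move: o_in; rewrite /open_disk/= oc ltxx.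
  by move=> /esym/eqP; rewrite oner_eq0.
have [c c0 e] := one_sub_sqnorm_gauge d0.
split=> h.
  move: e; rewrite h subrr => /esym/eqP; rewrite mulf_eq0 (gt_eqF c0) orbF.
  by rewrite subr_eq0 => /eqP.
by move: e; rewrite h subrr mul0r => /eqP; rewrite subr_eq0 => /eqP.
Qed.

End DiskGauge.

(** * Chords of the disk and compactness of the circle *)

Section CircleAndChords.
Variable R : realType.
Local Notation plane := (R * R)%type.
Implicit Types (x y z p q a b u v : plane) (t : R).

Definition mix t x y : plane := scale (1 - t) x + scale t y.

Lemma orient_mix u v x y t :
  orient u v (mix t x y) = (1 - t) * orient u v x + t * orient u v y.
Proof. by rewrite !orientE /=; ring. Qed.

Lemma sqnorm_mix x y t : circle x -> circle y ->
  sqnorm (mix t x y) = 1 - t * (1 - t) * sqnorm (y - x).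
Proof.
move=> /circle_sqr cx /circle_sqr cy; rewrite /sqnorm /=; ring: cx cy.
Qed.

Lemma orient0_mix x y p : x <> y -> orient x y p = 0 -> exists t, p = mix t x y.
Proof.
move=> xy; rewrite orientE => h.
have N0 : 0 < sqnorm (y - x).
  by apply: sqnorm_gt0 => /eqP; rewrite subr_eq0 => /eqP/esym.
pose t := dot (p - x) (y - x) / sqnorm (y - x).
have tN : t * sqnorm (y - x) = dot (p - x) (y - x).
  by rewrite divfK// lt0r_neq0.
exists t; move: t tN N0 => t; rewrite /sqnorm /dot /= => tN N0.
suff [e1 e2] : p.1 = (mix t x y).1 /\ p.2 = (mix t x y).2.
  by move: e1 e2; case: (p) => ? ? /= -> ->.
split; apply: (mulIf (lt0r_neq0 N0)); rewrite /mix /=.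
  rewrite [LHS](_ : _ = x.1 * ((y.1 - x.1) ^+ 2 + (y.2 - x.2) ^+ 2) +
    (y.1 - x.1) * ((p.1 - x.1) * (y.1 - x.1) + (p.2 - x.2) * (y.2 - x.2)) -
    (y.2 - x.2) * ((y.1 - x.1) * (p.2 - x.2) - (y.2 - x.2) * (p.1 - x.1))).
    by rewrite h -tN; ring.
  by ring.
rewrite [LHS](_ : _ = x.2 * ((y.1 - x.1) ^+ 2 + (y.2 - x.2) ^+ 2) +
  (y.2 - x.2) * ((p.1 - x.1) * (y.1 - x.1) + (p.2 - x.2) * (y.2 - x.2)) +
  (y.1 - x.1) * ((y.1 - x.1) * (p.2 - x.2) - (y.2 - x.2) * (p.1 - x.1))).
  by rewrite h -tN; ring.
by ring.
Qed.

Lemma chord_disk x y p : circle x -> circle y -> x <> y -> disk p ->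
  orient x y p = 0 -> exists t, [/\ 0 <= t, t <= 1 & p = mix t x y].
Proof.
move=> cx cy xy dp /(orient0_mix xy)[t pE]; exists t.
have N0 : 0 < sqnorm (y - x).
  by apply: sqnorm_gt0 => /eqP; rewrite subr_eq0 => /eqP/esym.
move: dp; rewrite /disk /= pE sqnorm_mix// gerBl (pmulr_lge0 _ N0) => h.
by split=> //; nra.
Qed.

Lemma chord_open_disk x y p : circle x -> circle y -> x <> y -> open_disk p ->
  orient x y p = 0 -> exists t, [/\ 0 < t, t < 1 & p = mix t x y].
Proof.
move=> cx cy xy dp /(orient0_mix xy)[t pE]; exists t.
have N0 : 0 < sqnorm (y - x).
  by apply: sqnorm_gt0 => /eqP; rewrite subr_eq0 => /eqP/esym.
move: dp; rewrite /open_disk /= pE sqnorm_mix// gtrBl (pmulr_lgt0 _ N0) => h.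
by split=> //; nra.
Qed.

Lemma mix_open_disk x y t : circle x -> circle y -> x <> y -> 0 < t -> t < 1 ->
  open_disk (mix t x y).
Proof.
move=> cx cy xy t0 t1; rewrite /open_disk /= sqnorm_mix// gtrBl.
rewrite !mulr_gt0 ?subr_gt0// sqnorm_gt0// => /eqP.
by rewrite subr_eq0 => /eqP/esym.
Qed.

Lemma circle_norm_le1 x : circle x -> `|x.1| <= 1 /\ `|x.2| <= 1.
Proof.
move=> /circle_sqr cx; rewrite !ler_norml; split; apply/andP; split; nra.
Qed.

Lemma closed_circle : closed (@circle R).
Proof.
apply: (@preimage_closed _ _ (@sqnorm R) [set 1]); last exact: closed_eq.
by move=> p _; exact: sqnorm_continuous.
Qed.

Lemma compact_circle : compact (@circle R).
Proof.
apply: (@subclosed_compact _ _ (`[(-1 : R), 1] `*` `[(-1 : R), 1])).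
- exact: closed_circle.
- by apply: compact_setX; exact: segment_compact.
- move=> p cp; have [h1 h2] := circle_norm_le1 cp.
  by split; rewrite /= in_itv /= -ler_norml.
Qed.

Lemma sqnorm_ball (e : R) p q : 0 < e -> sqnorm (q - p) < e ^+ 2 -> ball p e q.
Proof.
move=> e0; rewrite /sqnorm /= => h.
have lt (s t : R) : s ^+ 2 + t ^+ 2 < e ^+ 2 -> `|s| < e.
  move=> st; rewrite -(@ltr_pXn2r _ 2) ?nnegrE ?(ltW e0)// real_normK ?num_real//.
  by apply: le_lt_trans st; rewrite lerDl sqr_ge0.
split; rewrite /ball /= distrC; first exact: lt h.
by apply: (lt _ (q.1 - p.1)); rewrite addrC.
Qed.

Lemma orient_continuous x y : continuous (fun p => orient x p y).
Proof.
have -> : (fun p => orient x p y) = (fun p => (p.1 - x.1) * (y.2 - x.2) -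
    (p.2 - x.2) * (y.1 - x.1)) by apply/funext => p; rewrite orientE.
move=> p; apply: cvgB; apply: cvgM; try exact: cvg_cst.
  by apply: cvgB; [exact: fst_cvg|exact: cvg_cst].
by apply: cvgB; [exact: snd_cvg|exact: cvg_cst].
Qed.

(** Applied to points of Z on the two sides of a limit point [al]: they bound an arc around it. *)
Lemma orient_both_sides al u w : circle al -> circle u -> circle w ->
  det2 al u < 0 -> 0 < det2 al w -> 0 < orient u al w.
Proof.
move=> ca cu cw au aw.
have -> : orient u al w = det2 al w * (1 - dot al u) - det2 al u * (1 - dot al w).
  move: ca => /circle_sqr ca; rewrite orientE /det2 /dot; ring: ca.
have n v : det2 al v != 0 -> al <> v.
  by move=> /[swap] <-; rewrite /det2 mulrC subrr eqxx.
have u1 : 0 < 1 - dot al u.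
  by rewrite subr_gt0 dot_lt1//; [exact: circle_disk|apply: n; rewrite lt_eqF].
have w1 : 0 < 1 - dot al w.
  by rewrite subr_gt0 dot_lt1//; [exact: circle_disk|apply: n; rewrite gt_eqF].
by rewrite subr_gt0 (@lt_trans _ _ 0)// ?mulr_gt0// pmulr_llt0.
Qed.

End CircleAndChords.

(** * The map of a triangle *)

Section TriangleMap.
Variable R : realType.
Local Notation plane := (R * R)%type.
Implicit Types (x y z p q d o u v : plane) (t c : R).
Variable chord : plane -> plane -> bool.

Definition centroid x y z : plane := scale 3^-1 (x + y + z).

(* 1 minus three times the barycentric coordinate along z of the point at
   displacement d from the centroid; it is linear in d. *)
Definition slope x y z d : R := - 3 * det2 (y - x) d / orient x y z.

(* Sides that are not chords are replaced by arcs of the circle. *)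
Definition side_gauge o x y z d : R :=
  if chord x y then slope x y z d else disk_gauge o d.

Definition tri_gauge x y z d : R :=
  Num.max (slope x y z d) (Num.max (slope y z x d) (slope z x y d)).

(** The gauge, about the centroid, of the disk cut by the half-planes of those sides that are
    chords. It is at least [disk_gauge], from which it inherits positivity and the bound. *)
Definition region_gauge x y z d : R :=
  let o := centroid x y z in
  Num.max (disk_gauge o d) (Num.max (side_gauge o x y z d)
    (Num.max (side_gauge o y z x d) (side_gauge o z x y d))).

Definition tri_map x y z p : plane :=
  centroid x y z + radial (tri_gauge x y z) (region_gauge x y z) (p - centroid x y z).

Definition tri_inv x y z p : plane :=
  centroid x y z + radial (region_gauge x y z) (tri_gauge x y z) (p - centroid x y z).

Definition straight x y z p :=
  [/\ 0 <= orient x y p, 0 <= orient y z p & 0 <= orient z x p].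

Definition side_ok x y p := chord x y -> 0 <= orient x y p.

Definition region x y z p :=
  [/\ disk p, side_ok x y p, side_ok y z p & side_ok z x p].

Lemma maxr_rot (a b c : R) : Num.max a (Num.max b c) = Num.max b (Num.max c a).
Proof. by rewrite maxC -maxA. Qed.

Lemma tri_gauge_rot x y z : tri_gauge y z x = tri_gauge x y z.
Proof. by apply/funext => d; rewrite /tri_gauge [RHS]maxr_rot. Qed.

Lemma centroid_rot x y z : centroid y z x = centroid x y z.
Proof. by rewrite /centroid addrC addrA. Qed.

Lemma region_gauge_rot x y z : region_gauge y z x = region_gauge x y z.
Proof.
apply/funext => d; rewrite /region_gauge centroid_rot; congr (Num.max _ _).
exact/esym/maxr_rot.
Qed.

Lemma tri_map_rot x y z : tri_map y z x = tri_map x y z.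
Proof.
by rewrite /tri_map tri_gauge_rot region_gauge_rot centroid_rot.
Qed.

Lemma straight_rot x y z p : straight y z x p <-> straight x y z p.
Proof. by split=> -[]. Qed.

Section Fixed.
Variables x y z : plane.
Hypothesis xyz : 0 < orient x y z.
Local Notation o := (centroid x y z).

Lemma slopeE p : slope x y z (p - o) = 1 - 3 * orient x y p / orient x y z.
Proof.
rewrite /slope (_ : - 3 * _ = orient x y z - 3 * orient x y p).
  by rewrite mulrBl divff// lt0r_neq0.
by rewrite !orientE /det2 /centroid /=; field.
Qed.

Lemma slope_le1 p : (slope x y z (p - o) <= 1) = (0 <= orient x y p).
Proof.
by rewrite slopeE gerBl pmulr_lge0 ?invr_gt0// pmulr_rge0.
Qed.

Lemma slope_ge1 p : (1 <= slope x y z (p - o)) = (orient x y p <= 0).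
Proof.
by rewrite slopeE lerBrDr gerDl pmulr_lle0 ?invr_gt0// pmulr_rle0.
Qed.

End Fixed.

Lemma slope_continuous x y z : continuous (slope x y z).
Proof.
move=> d; apply: cvgM; last exact: cvg_cst.
apply: cvgM; first exact: cvg_cst.
by apply: cvgB; apply: cvgM; try exact: cvg_cst; [exact: snd_cvg|exact: fst_cvg].
Qed.

Lemma slope_scale x y z t d : slope x y z (scale t d) = t * slope x y z d.
Proof. by rewrite /slope /det2 /=; ring. Qed.

Lemma max_continuous (f g : plane -> R) : continuous f -> continuous g ->
  continuous (fun d => Num.max (f d) (g d)).
Proof. by move=> cf cg d; apply: continuous_max; [exact: cf|exact: cg]. Qed.

Section Fixed.
Variables x y z : plane.
Hypotheses (cx : circle x) (cy : circle y) (cz : circle z).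
Hypothesis xyz : 0 < orient x y z.
Local Notation o := (centroid x y z).

Let yzx : 0 < orient y z x. Proof. by rewrite orient_rot. Qed.
Let zxy : 0 < orient z x y. Proof. by rewrite -orient_rot. Qed.

Lemma centroid_open_disk : open_disk o.
Proof.
have [xy yz zx] := orient_neq xyz.
have h1 := dot_lt1 cx (circle_disk cy) xy.
have h2 := dot_lt1 cy (circle_disk cz) yz.
have h3 := dot_lt1 cz (circle_disk cx) zx.
have -> : open_disk o = (sqnorm o < 1) :> Prop by [].
have -> : sqnorm o = (sqnorm x + sqnorm y + sqnorm z +
    2 * (dot x y + dot y z + dot z x)) / 9.
  by rewrite /sqnorm /dot /centroid /=; field.
by rewrite cx cy cz; lra.
Qed.

Lemma slope_sum d : slope x y z d + slope y z x d + slope z x y d = 0.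
Proof.
by rewrite /slope (orient_rot x y z) -(orient_rot z x y) /det2 /=; ring.
Qed.

(** The barycentric coordinates of the centroid are 1/3 and those of the displaced point (1 - slope)
    / 3, so the displacement has coordinates - slope / 3. *)
Lemma slope_decomp d : d = scale (- 3^-1) (scale (slope x y z d) z +
  scale (slope y z x d) x + scale (slope z x y d) y).
Proof.
have D0 : orient x y z != 0 by rewrite lt0r_neq0.
rewrite /slope (orient_rot x y z) -(orient_rot z x y).
rewrite orientE in D0 *; case: d => d1 d2; rewrite /scale /det2 /=.
by congr (_, _); rewrite /=; field.
Qed.

(** The three slopes sum to 0 and are at most m = [tri_gauge x y z d], so each lies between -2m and
    m. By [slope_decomp], d is up to sign the average of three vectors whose coordinates are at most
    2m in absolute value. *)
Lemma tri_gauge_bound d : `|d.1| <= 2 * tri_gauge x y z d /\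
  `|d.2| <= 2 * tri_gauge x y z d.
Proof.
have := slope_sum d.
have /(congr1 fst)/= e1 := slope_decomp d; have /(congr1 snd)/= e2 := slope_decomp d.
have hx : slope x y z d <= tri_gauge x y z d by rewrite le_max lexx.
have hy : slope y z x d <= tri_gauge x y z d by rewrite !le_max lexx orbT.
have hz : slope z x y d <= tri_gauge x y z d by rewrite !le_max lexx !orbT.
rewrite e1 e2 {e1 e2}; move: (tri_gauge x y z d) (slope x y z d) (slope y z x d)
  (slope z x y d) hx hy hz.
move=> m a b c am bm cm abc.
have mulb s t : - (2 * m) <= s <= 2 * m -> `|t| <= 1 -> - (2 * m) <= s * t <= 2 * m.
  move=> sm t1; rewrite -ler_norml normrM -[leRHS]mulr1.
  by rewrite ler_pM// ler_norml.
have [x1 x2] := circle_norm_le1 cx; have [y1 y2] := circle_norm_le1 cy.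
have [z1 z2] := circle_norm_le1 cz.
have am' : - (2 * m) <= a <= 2 * m by lra.
have bm' : - (2 * m) <= b <= 2 * m by lra.
have cm' : - (2 * m) <= c <= 2 * m by lra.
have := mulb _ _ am' z1; have := mulb _ _ am' z2.
have := mulb _ _ bm' x1; have := mulb _ _ bm' x2.
have := mulb _ _ cm' y1; have := mulb _ _ cm' y2.
by move=> *; split; rewrite ler_norml /=; lra.
Qed.

Lemma tri_gauge_gauge : gauge (tri_gauge x y z).
Proof.
split.
- by do !apply: max_continuous; exact: slope_continuous.
- by move=> t d t0; rewrite /tri_gauge !slope_scale !maxr_pMr.
- move=> d d0; rewrite ltNge; apply/negP => g0; apply: d0.
  have [] := tri_gauge_bound d.
  have h : 2 * tri_gauge x y z d <= 0 by rewrite pmulr_rle0.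
  move=> /le_trans/(_ h) d1 /le_trans/(_ h) d2.
  move: d d1 d2 {g0 h} => [d1 d2] /=; rewrite !normr_le0 => /eqP -> /eqP ->.
  by [].
- by exists 2 => // d; exact: tri_gauge_bound.
Qed.

Lemma side_gauge_continuous u v w : continuous (side_gauge o u v w).
Proof.
rewrite /side_gauge; case: (chord u v); first exact: slope_continuous.
exact: disk_gauge_continuous.
Qed.

Lemma side_gauge_scale u v w t d : 0 <= t ->
  side_gauge o u v w (scale t d) = t * side_gauge o u v w d.
Proof.
move=> t0; rewrite /side_gauge; case: ifP => _; first exact: slope_scale.
by rewrite disk_gauge_scale//; exact: centroid_open_disk.
Qed.

Lemma disk_gauge_le_region d : disk_gauge o d <= region_gauge x y z d.
Proof. by rewrite le_max lexx. Qed.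

Lemma region_gauge_gauge : gauge (region_gauge x y z).
Proof.
have oo := centroid_open_disk; split.
- apply: max_continuous; first exact: disk_gauge_continuous.
  by do !apply: max_continuous; exact: side_gauge_continuous.
- move=> t d t0; rewrite /region_gauge disk_gauge_scale// !side_gauge_scale//.
  by rewrite !maxr_pMr.
- move=> d d0; exact: lt_le_trans (disk_gauge_gt0 oo d0) (disk_gauge_le_region d).
- exists 3 => // d; have := disk_gauge_le_region d.
  rewrite -(ler_pM2l (ltr0Sn R 2)) => h.
  by have [h1 h2] := disk_gauge_bound oo d; split; apply: le_trans h.
Qed.

Lemma tri_gauge_le1 p : tri_gauge x y z (p - o) <= 1 <-> straight x y z p.
Proof.
have h1 := slope_le1 xyz p; have h2 := slope_le1 yzx p.
have h3 := slope_le1 zxy p; rewrite centroid_rot in h2.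
rewrite -(centroid_rot z x y) in h3.
by rewrite !ge_max h1 h2 h3; split=> [/and3P|[-> -> ->]].
Qed.

Lemma side_gauge_le1 u v w p : centroid u v w = o -> 0 < orient u v w ->
  disk p -> side_gauge o u v w (p - o) <= 1 <-> side_ok u v p.
Proof.
move=> oE uvw dp; rewrite /side_gauge /side_ok; case: ifP => _; last first.
  by split=> // _; rewrite -disk_gauge_le1 ?subrKC//; exact: centroid_open_disk.
by rewrite -oE slope_le1//; split=> // h; exact: h.
Qed.

Lemma region_gauge_le1 p : region_gauge x y z (p - o) <= 1 <-> region x y z p.
Proof.
have oo := centroid_open_disk.
have dg := disk_gauge_le1 oo (p - o); rewrite subrKC in dg.
rewrite ge_max; split.
  move=> /andP[/dg dp]; rewrite !ge_max => /and3P[h1 h2 h3]; split=> //.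
  - by rewrite -(side_gauge_le1 _ (w := z)).
  - by rewrite -(side_gauge_le1 _ (w := x))// centroid_rot.
  - by rewrite -(side_gauge_le1 _ (w := y))// -centroid_rot.
move=> [dp h1 h2 h3]; rewrite dg.1//= !ge_max; apply/and3P; split.
- by rewrite side_gauge_le1.
- by rewrite side_gauge_le1// centroid_rot.
- by rewrite side_gauge_le1// -centroid_rot.
Qed.

Lemma region_gauge_tri_map p :
  region_gauge x y z (tri_map x y z p - o) = tri_gauge x y z (p - o).
Proof.
by rewrite /tri_map addrC addKr gauge_radial//;
  [exact: tri_gauge_gauge|exact: region_gauge_gauge].
Qed.

Lemma tri_mapK : cancel (tri_map x y z) (tri_inv x y z).
Proof.
move=> p; rewrite /tri_inv /tri_map [X in radial _ _ X]addrC addKr radialK ?subrKC//.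
  exact: tri_gauge_gauge.
exact: region_gauge_gauge.
Qed.

Lemma tri_invK : cancel (tri_inv x y z) (tri_map x y z).
Proof.
move=> p; rewrite /tri_map /tri_inv [X in radial _ _ X]addrC addKr radialK ?subrKC//.
  exact: region_gauge_gauge.
exact: tri_gauge_gauge.
Qed.

Lemma region_tri_map p : region x y z (tri_map x y z p) <-> straight x y z p.
Proof. by rewrite -region_gauge_le1 region_gauge_tri_map tri_gauge_le1. Qed.

Lemma straight_tri_inv p : straight x y z (tri_inv x y z p) <-> region x y z p.
Proof. by rewrite -region_tri_map tri_invK. Qed.

Lemma translate_continuous (f : plane -> plane) : continuous f ->
  continuous (fun p => o + f (p - o)).
Proof.
move=> cf p; apply: cvgD; first exact: cvg_cst.
apply: (@cvg_comp _ _ _ (fun q => q - o) f _ (nbhs (p - o))); last exact: cf.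
by apply: cvgB; [exact: cvg_id|exact: cvg_cst].
Qed.

Lemma tri_map_continuous : continuous (tri_map x y z).
Proof.
apply/translate_continuous/radial_continuous.
  exact: tri_gauge_gauge.
exact: region_gauge_gauge.
Qed.

Lemma tri_inv_continuous : continuous (tri_inv x y z).
Proof.
apply/translate_continuous/radial_continuous.
  exact: region_gauge_gauge.
exact: tri_gauge_gauge.
Qed.

Lemma bary_sum p : orient y z p + orient z x p + orient x y p = orient x y z.
Proof. by rewrite !orientE; ring. Qed.

Lemma bary_decomp p : scale (orient x y z) p =
  scale (orient y z p) x + scale (orient z x p) y + scale (orient x y p) z.
Proof.
by case: p => p1 p2; rewrite /scale !orientE /=; congr (_, _); rewrite /=; ring.
Qed.

(** Convexity of the disk: expand the squared norm in barycentric coordinates and use that dot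
    products of points of the circle are at most 1. *)
Lemma straight_disk p : straight x y z p -> disk p.
Proof.
move=> [h1 h2 h3]; have e := bary_decomp p; have s := bary_sum p.
have n : orient x y z ^+ 2 * sqnorm p <= orient x y z ^+ 2.
  rewrite -sqnorm_scale e -{1}s.
  move: h1 h2 h3; move: (orient x y p) (orient y z p) (orient z x p) => c a b c0 a0 b0.
  have -> : sqnorm (scale a x + scale b y + scale c z) =
      a ^+ 2 * sqnorm x + b ^+ 2 * sqnorm y + c ^+ 2 * sqnorm z +
      2 * (a * b * dot x y + b * c * dot y z + c * a * dot z x).
    by rewrite /sqnorm /dot /=; ring.
  rewrite cx cy cz.
  have hab : a * b * dot x y <= a * b.
    by rewrite ler_piMr ?mulr_ge0// dot_le1//; exact: circle_disk.
  have hbc : b * c * dot y z <= b * c.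
    by rewrite ler_piMr ?mulr_ge0// dot_le1//; exact: circle_disk.
  have hca : c * a * dot z x <= c * a.
    by rewrite ler_piMr ?mulr_ge0// dot_le1//; exact: circle_disk.
  by nra.
rewrite /disk /= -(@ler_pM2l _ (orient x y z ^+ 2)) ?mulr1//.
by rewrite exprn_gt0.
Qed.

Lemma straight_region p : straight x y z p -> region x y z p.
Proof. by move=> sp; have [*] := sp; split=> //; exact: straight_disk sp. Qed.

Lemma slope_eq1 p : orient x y p = 0 -> slope x y z (p - o) = 1.
Proof. by move=> h; rewrite slopeE// h mulr0 mul0r subr0. Qed.

Lemma tri_gauge_edge p : straight x y z p -> orient x y p = 0 ->
  tri_gauge x y z (p - o) = 1.
Proof.
move=> /tri_gauge_le1 h /slope_eq1 e; apply/eqP; rewrite eq_le h -[leLHS]e.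
by rewrite le_max lexx.
Qed.

Lemma tri_gauge_eq1 p : straight x y z p -> tri_gauge x y z (p - o) = 1 ->
  [\/ orient x y p = 0, orient y z p = 0 | orient z x p = 0].
Proof.
move=> [h1 h2 h3] g1; apply: contrapT => n.
have pos u v w : centroid u v w = o -> 0 < orient u v w -> 0 <= orient u v p ->
    orient u v p <> 0 -> slope u v w (p - o) < 1.
  move=> oE uvw ge /eqP ne; rewrite ltNge -oE slope_ge1// -ltNge.
  by rewrite lt_neqAle eq_sym ne.
have : tri_gauge x y z (p - o) < 1.
  rewrite /tri_gauge !gt_max; apply/and3P; split.
  - by apply: pos => // e; apply: n; constructor 1.
  - by apply: pos (centroid_rot x y z) yzx h2 _ => e; apply: n; constructor 2.
  - by apply: pos (esym (centroid_rot z x y)) zxy h3 _ => e; apply: n; constructor 3.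
by rewrite g1 ltxx.
Qed.

(** On a straight side both gauges are 1, so the radial map fixes it. This makes the maps of
    adjacent triangles agree. *)
Lemma tri_map_chord p : straight x y z p -> orient x y p = 0 -> chord x y ->
  tri_map x y z p = p.
Proof.
move=> sp pxy ch; rewrite /tri_map radial_eq ?subrKC//.
- exact: tri_gauge_gauge.
- exact: region_gauge_gauge.
rewrite tri_gauge_edge//; apply/esym/eqP; rewrite eq_le.
rewrite (region_gauge_le1 p).2; last exact: straight_region.
by rewrite /= !le_max /side_gauge ch slope_eq1// lexx orbT.
Qed.

Lemma tri_map_vertex : tri_map x y z x = x.
Proof.
have sx : straight x y z x.
  by split; rewrite ?orientxyx ?orientxyy// orient_rot ltW.
rewrite /tri_map radial_eq ?subrKC//.
- exact: tri_gauge_gauge.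
- exact: region_gauge_gauge.
rewrite tri_gauge_edge ?orientxyx//; apply/esym/eqP; rewrite eq_le.
rewrite (region_gauge_le1 x).2; last exact: straight_region.
rewrite /= !le_max (_ : disk_gauge _ _ = 1) ?lexx//.
by apply/disk_gauge_eq1; [exact: centroid_open_disk|rewrite subrKC].
Qed.

(** Inside the open disk [disk_gauge] is below 1, so the value 1 must come from the slope of a chord
    side. *)
Lemma region_gauge_eq1 p : region x y z p -> open_disk p ->
  region_gauge x y z (p - o) = 1 ->
  [\/ chord x y /\ orient x y p = 0, chord y z /\ orient y z p = 0 |
      chord z x /\ orient z x p = 0].
Proof.
move=> [dp h1 h2 h3] op g1.
have lt1 : disk_gauge o (p - o) < 1.
  have oo := centroid_open_disk.
  rewrite lt_neqAle (disk_gauge_le1 oo _).1 ?subrKC// andbT.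
  by apply/eqP => /(disk_gauge_eq1 oo); rewrite subrKC => pc; move: op;
    rewrite /open_disk /= pc ltxx.
have side u v w : centroid u v w = o -> 0 < orient u v w -> side_ok u v p ->
    ~ (chord u v /\ orient u v p = 0) -> side_gauge o u v w (p - o) < 1.
  move=> oE uvw ok nz; rewrite /side_gauge; case: ifP => // ch.
  rewrite ltNge -oE slope_ge1//; apply/negP => le.
  by apply: nz; split=> //; apply/eqP; rewrite eq_le le ok.
apply: contrapT => nz.
have : region_gauge x y z (p - o) < 1.
  rewrite /region_gauge !gt_max lt1 /=; apply/and3P; split.
  - by apply: (side x y z) => // h; apply: nz; constructor 1.
  - apply: (side y z x (centroid_rot x y z) yzx h2) => h.
    by apply: nz; constructor 2.
  - apply: (side z x y (esym (centroid_rot z x y)) zxy h3) => h.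
    by apply: nz; constructor 3.
by rewrite g1 ltxx.
Qed.

(** The radial map moves the side away from the centroid, so not back across the line xy, and onto
    the frontier of the region. A frontier point in the open disk would lie on one of the chords yz
    and zx, whose interior is strictly on the inner side of that line. *)
Lemma tri_map_arc p : straight x y z p -> orient x y p = 0 -> ~~ chord x y ->
  circle (tri_map x y z p) /\ orient x y (tri_map x y z p) <= 0.
Proof.
move=> sp pxy nch; set P := tri_map x y z p.
have gg := tri_gauge_gauge; have gh := region_gauge_gauge.
have g1 := tri_gauge_edge sp pxy; have s1 := slope_eq1 pxy.
have d0 : p - o <> 0.
  move=> d0; move: s1; rewrite d0 -(scale0 0) slope_scale mul0r => /esym/eqP.
  by rewrite oner_eq0.
have h0 := gauge_gt0 gh d0.
have h1 : region_gauge x y z (p - o) <= 1.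
  by apply/region_gauge_le1; exact: straight_region.
have PE : P - o = scale (region_gauge x y z (p - o))^-1 (p - o).
  by rewrite /P /tri_map addrC addKr /radial g1 div1r.
have Ple : orient x y P <= 0.
  rewrite -(slope_ge1 xyz) PE slope_scale s1 mulr1.
  by rewrite -[leLHS]invr1 lef_pV2 ?posrE.
split=> //; have rP : region x y z P by apply/region_tri_map.
have [dP _ _ _] := rP; apply: contrapT => nc.
have oP : open_disk P.
  by move: dP; rewrite /disk /open_disk /= le_eqVlt => /predU1P[].
have hP : region_gauge x y z (P - o) = 1 by rewrite region_gauge_tri_map.
have [xy yz zx] := orient_neq xyz.
have [[ch _]|[_ Pyz]|[_ Pzx]] := region_gauge_eq1 rP oP hP.
- by rewrite ch in nch.
- have [t [t0 t1 Pt]] := chord_open_disk cy cz yz oP Pyz.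
  by move: Ple; rewrite Pt orient_mix orientxyy mulr0 add0r leNgt mulr_gt0.
- have [t [t0 t1 Pt]] := chord_open_disk cz cx zx oP Pzx.
  by move: Ple; rewrite Pt orient_mix orientxyx mulr0 addr0 leNgt mulr_gt0// subr_gt0.
Qed.

Lemma orient_arc P : circle P -> orient x y P <= 0 ->
  0 <= orient y z P /\ 0 <= orient z x P.
Proof.
move=> cP le.
have [->|xP] := pselect (P = x).
  by rewrite orientxyy orient_rot; split=> //; exact: ltW.
have [->|yP] := pselect (P = y).
  by rewrite orientxyx -orient_rot; split=> //; exact: ltW.
have h : 0 < orient x P y.
  rewrite orient_swap oppr_gt0 lt_neqAle le andbT; apply/eqP => /orient_eq0.
  have [xy _ _] := orient_neq xyz.
  by move=> /(_ cx cy cP)[//|/esym//|//].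
move: (xyz) h {xP yP}; rewrite !orient_pos// => h1 h2.
by split; apply: ltW; rewrite orient_pos//; move: h1 h2; rewrite /cyc; lra.
Qed.

(** Beyond the line xy the slope of that side is at least 1 and the other two are at most 1, so it
    equals [tri_gauge]; dividing by it brings P back onto the line. *)
Lemma tri_inv_arc P : ~~ chord x y -> circle P -> orient x y P <= 0 ->
  straight x y z (tri_inv x y z P) /\ orient x y (tri_inv x y z P) = 0.
Proof.
move=> nch cP Ple; have [Pyz Pzx] := orient_arc cP Ple.
have gg := tri_gauge_gauge; have gh := region_gauge_gauge.
have rP : region x y z P.
  by split=> // [|ch]; [exact: circle_disk|rewrite ch in nch].
have h1 : region_gauge x y z (P - o) = 1.
  apply/eqP; rewrite eq_le (region_gauge_le1 P).2//= le_max.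
  rewrite (_ : disk_gauge _ _ = 1) ?lexx//.
  by apply/disk_gauge_eq1; [exact: centroid_open_disk|rewrite subrKC].
have s1 : 1 <= slope x y z (P - o) by rewrite slope_ge1.
have gE : tri_gauge x y z (P - o) = slope x y z (P - o).
  apply/eqP; rewrite eq_le le_max lexx andbT !ge_max lexx /=.
  have h2 := slope_le1 yzx P; rewrite centroid_rot in h2.
  have h3 := slope_le1 zxy P; rewrite -(centroid_rot z x y) in h3.
  by apply/andP; split; apply: le_trans s1; rewrite ?h2 ?h3.
split; first exact/straight_tri_inv.
apply/eqP; rewrite eq_le -(slope_ge1 xyz) -(slope_le1 xyz) -eq_le eq_sym.
rewrite /tri_inv addrC addKr /radial h1 slope_scale gE div1r mulVf//.
by rewrite gt_eqF// (lt_le_trans _ s1).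
Qed.

Lemma straight_vertex : straight x y z x.
Proof. by split; rewrite ?orientxyx ?orientxyy// orient_rot ltW. Qed.

(* Otherwise P could be pushed away from the centroid within the region, and
   would cross the line uv. *)
Lemma region_frontier u v P : circle u -> circle v -> u <> v ->
  orient u x v <= 0 -> orient u y v <= 0 -> orient u z v <= 0 ->
  (forall q, region x y z q -> orient u q v <= 0) ->
  region x y z P -> orient u P v = 0 -> region_gauge x y z (P - o) = 1.
Proof.
move=> cu cv uv ux uy uz sub rP P0.
have o3 : 3 * orient u o v = orient u x v + orient u y v + orient u z v.
  by rewrite !orientE /centroid /=; field.
have olt : orient u o v < 0.
  rewrite ltNge; apply/negP => ge.
  have on q : circle q -> orient u q v = 0 -> q = u \/ q = v.
    move=> cq /(orient_eq0 cu cq cv)[->|->|vu]; [by left|by right|].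
    by case: uv; rewrite vu.
  have x0 : orient u x v = 0 by lra.
  have y0 : orient u y v = 0 by lra.
  have z0 : orient u z v = 0 by lra.
  have [xy yz zx] := orient_neq xyz.
  by have [e1|e1] := on x cx x0; have [e2|e2] := on y cy y0;
    have [e3|e3] := on z cz z0; congruence.
apply/eqP; rewrite eq_le (region_gauge_le1 P).2//= leNgt; apply/negP => lt1.
have gh := region_gauge_gauge.
have d0 : P - o <> 0.
  by move=> /eqP; rewrite subr_eq0 => /eqP Po; move: olt; rewrite -Po P0 ltxx.
have g0 := gauge_gt0 gh d0.
pose k := (region_gauge x y z (P - o))^-1.
have k1 : 1 < k by rewrite -[ltLHS]invr1 ltf_pV2 ?posrE.
have : region x y z (o + scale k (P - o)).
  apply/region_gauge_le1; rewrite addrC addKr (gauge_scale gh) ?invr_ge0 ?(ltW g0)//.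
  by rewrite mulVf ?lt0r_neq0.
move=> /sub; have -> : orient u (o + scale k (P - o)) v =
    (1 - k) * orient u o v + k * orient u P v.
  by rewrite !orientE /=; ring.
by rewrite P0 mulr0 addr0 leNgt nmulr_rgt0 ?subr_lt0// olt.
Qed.

End Fixed.
End TriangleMap.

(** * Geodesics and enclosed regions *)

Section Geodesics.
Variable R : realType.
Local Notation plane := (R * R)%type.
Implicit Types (x y z p q d o u v c : plane) (t : R).

(** The three points lie on the polar line of c. Both coordinates of c annihilate [orient x y q],
    and they combine to the factor dot x c = 1. *)
Lemma orient_polar x y q c : dot x c = 1 -> dot y c = 1 -> dot q c = 1 ->
  orient x y q = 0.
Proof.
rewrite /dot => xc yc qc.
have xc' : x.1 * c.1 = 1 - x.2 * c.2 by rewrite -xc; ring.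
have c1 : c.1 * orient x y q = 0.
  rewrite (_ : _ * _ = (y.2 * c.2 + y.1 * c.1 - x.1 * c.1 - x.2 * c.2) * (q.2 - x.2) -
    (y.2 - x.2) * (q.1 * c.1 + q.2 * c.2 - x.1 * c.1 - x.2 * c.2)).
    by rewrite (addrC (y.2 * _)) yc qc; ring: xc'.
  by rewrite orientE; ring.
have c2 : c.2 * orient x y q = 0.
  rewrite (_ : _ * _ = (q.1 * c.1 + q.2 * c.2 - x.1 * c.1 - x.2 * c.2) * (y.1 - x.1) -
    (y.1 * c.1 + y.2 * c.2 - x.1 * c.1 - x.2 * c.2) * (q.1 - x.1)).
    by rewrite yc qc; ring: xc'.
  by rewrite orientE; ring.
by rewrite -[LHS]mul1r -xc mulrDl -!mulrA c1 c2 !mulr0 addr0.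
Qed.

Lemma antipodal x y : circle x -> circle y -> dot x y = -1 -> y = scale (-1) x.
Proof.
move=> cx cy h; have cNx : circle (scale (-1) x).
  by rewrite /circle /= sqnorm_scale cx; ring.
apply/esym/(dot_eq1 cNx (circle_disk cy)).
by move: h; rewrite /dot /=; lra.
Qed.

(* The Euclidean center c of a geodesic is the pole of the chord xy: the circle
   has equation [dot (klein p) c = 1]. *)
Lemma geodesicE x y p : circle x -> circle y -> x <> y ->
  geodesic x y p <-> disk p /\ orient x y (klein p) = 0.
Proof.
move=> cx cy xy.
have kd : disk p -> klein p = scale (2 / (1 + sqnorm p)) p by move=> /klein_in.
have s0 : 0 < 1 + sqnorm p by rewrite ltr_wpDr ?sqnorm_ge0.
have s1 : 1 + sqnorm p != 0 by rewrite lt0r_neq0.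
have polar c r : disk p -> sqnorm c = 1 + r ^+ 2 ->
    sqnorm (p - c) = r ^+ 2 <-> dot (klein p) c = 1.
  move=> dp cr; rewrite kd//.
  have -> : dot (scale (2 / (1 + sqnorm p)) p) c = 2 * dot p c / (1 + sqnorm p).
    by rewrite /dot /=; field.
  have e : sqnorm (p - c) = sqnorm p - 2 * dot p c + sqnorm c.
    by rewrite /sqnorm /dot /=; ring.
  rewrite e cr; split=> h.
    have -> : 2 * dot p c = 1 + sqnorm p by move: h; lra.
    by rewrite divff.
  have := congr1 (fun t => t * (1 + sqnorm p)) h.
  by rewrite divfK// mul1r; lra.
have polarC v c r : circle v -> sqnorm c = 1 + r ^+ 2 ->
    sqnorm (v - c) = r ^+ 2 <-> dot v c = 1.
  move=> cv cr; have -> : sqnorm (v - c) = sqnorm v - 2 * dot v c + sqnorm c.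
    by rewrite /sqnorm /dot /=; ring.
  by rewrite cv cr; split; lra.
split=> [[dp h]|[dp h]]; split=> //.
  case: h => [[xy0 [t pE]]|[c [r r0 [cr xc yc pc]]]]; last first.
    by apply: (@orient_polar _ _ _ c);
      [exact/(polarC _ _ r)|exact/(polarC _ _ r)|exact/(polar _ r)].
  have yE : y = scale (-1) x.
    by apply/eqP; rewrite -subr_eq0; apply/eqP; rewrite -xy0 /scale;
      case: (x) (y) => x1 x2 [y1 y2]; congr (_, _); rewrite /=; ring.
  by rewrite kd// yE pE orientE /=; ring.
have [t qE] := orient0_mix xy h.
have [xy1|xy1] := eqVneq (dot x y) (-1).
  have yE := antipodal cx cy xy1; left; split.
    by rewrite yE; case: (x) => x1 x2; congr (_, _); rewrite /=; ring.
  have := kleinK p; rewrite /poincare; set s := _^-1 => e.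
  exists (s * (1 - 2 * t)); rewrite -e qE yE.
  by rewrite /mix /scale; congr (_, _); rewrite /=; ring.
right; have xyN1 : 0 < 1 + dot x y.
  rewrite lt_neqAle -(addrN 1) (inj_eq (addrI _)) eq_sym xy1/= lerD2l.
  have := dot_sqr_le x y; rewrite cx cy mulr1 => h1.
  by have := sqr_ge0 (dot x y); nra.
have xy2 := dot_lt1 cx (circle_disk cy) xy.
(* The pole of the chord: the multiple of x + y whose dot product with both x and y is 1. *)
pose c := scale (1 + dot x y)^-1 (x + y).
have xyn : 1 + dot x y != 0 by rewrite lt0r_neq0.
have sc : sqnorm c = 2 / (1 + dot x y).
  rewrite sqnorm_scale; have -> : sqnorm (x + y) = 2 * (1 + dot x y).
    have -> : sqnorm (x + y) = sqnorm x + sqnorm y + 2 * dot x y.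
      by rewrite /sqnorm /dot /=; ring.
    by rewrite cx cy; ring.
  by field.
have c1 : 0 < sqnorm c - 1 by rewrite sc subr_gt0 ltr_pdivlMr// mul1r; lra.
have cr : sqnorm c = 1 + Num.sqrt (sqnorm c - 1) ^+ 2.
  by rewrite sqr_sqrtr ?subrKC// ltW.
have xc : dot x c = 1.
  have -> : dot x c = (sqnorm x + dot x y) / (1 + dot x y).
    by rewrite /dot /sqnorm /=; ring.
  by rewrite cx divff.
have yc : dot y c = 1.
  have -> : dot y c = (sqnorm y + dot x y) / (1 + dot x y).
    by rewrite /dot /sqnorm /=; ring.
  by rewrite cy divff.
exists c, (Num.sqrt (sqnorm c - 1)); first by rewrite sqrtr_gt0.
split=> //; [exact/polarC|exact/polarC|apply/polar => //].
rewrite qE; have -> : dot (mix t x y) c = (1 - t) * dot x c + t * dot y c.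
  by rewrite /dot /=; ring.
by rewrite xc yc; ring.
Qed.

Lemma geodesic_sym x y : circle x -> circle y -> x <> y ->
  geodesic x y = geodesic y x.
Proof.
move=> cx cy xy; have e p : orient y x p = - orient x y p.
  by rewrite !orientE; ring.
apply/seteqP; split=> p.
  move=> /(geodesicE _ cx cy xy)[dp h]; apply/(geodesicE _ cy cx (nesym xy)).
  by rewrite e h oppr0.
move=> /(geodesicE _ cy cx (nesym xy))[dp h]; apply/(geodesicE _ cx cy xy).
by split=> //; apply/eqP; rewrite -oppr_eq0 -e h.
Qed.

Lemma crossing_geodesics x y a b : circle x -> circle y -> circle a -> circle b ->
  0 < orient x a y -> 0 < orient y b x -> crossing (x, y) (a, b).
Proof.
move=> cx cy ca cb xay ybx.
have [xa ay yx] := orient_neq xay; have [yb bx _] := orient_neq ybx.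
have xya : orient x y a < 0 by rewrite orient_swap oppr_lt0.
have xyb : 0 < orient x y b by rewrite -(orient_rot x y b).
have ab : a <> b by move=> e; move: xya; rewrite e (lt_gtF xyb).
split=> /=.
  move=> ge; have : geodesic a b a.
    apply/geodesicE => //; rewrite klein_circle// orientxyx.
    by split=> //; exact: circle_disk.
  rewrite -ge => /(geodesicE _ cx cy (nesym yx))[_]; rewrite klein_circle// => e.
  by move: xya; rewrite e ltxx.
pose den := orient x y b - orient x y a.
have den0 : 0 < den by rewrite subr_gt0 (lt_trans xya).
(* The parameter at which the affine function [orient x y] vanishes on the segment from a to b. *)
pose s := - orient x y a / den.
have s0 : 0 < s by rewrite divr_gt0// oppr_gt0.
have s1 : s < 1 by rewrite ltr_pdivrMr// mul1r /den; lra.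
have om := mix_open_disk ca cb ab s0 s1.
have dm : disk (mix s a b) by exact: ltW om.
exists (poincare (mix s a b)); split; last exact/open_disk_poincare.
split; apply/geodesicE => //; rewrite ?poincareK; try exact: nesym; split;
  try exact/disk_poincare.
  by rewrite orient_mix /s /den; field; rewrite lt0r_neq0.
by rewrite orient_mix orientxyx orientxyy !mulr0 addr0.
Qed.

End Geodesics.

(** * The region enclosed by the unit sphere of a gauge in the Klein model *)

Section Enclosed.
Variable R : realType.
Local Notation plane := (R * R)%type.
Implicit Types (p q d o : plane) (t : R).
Variables (g : plane -> R) (o : plane).
Hypothesis gg : gauge g.

Let H p := g (klein p - o).

Let H_continuous : continuous H.
Proof.
move=> p; apply: (@cvg_comp _ _ _ (fun q => klein q - o) g _ (nbhs (klein p - o))).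
  by apply: cvgB; [exact: klein_continuous|exact: cvg_cst].
exact: (@gauge_continuous R g gg (klein p - o)).
Qed.

Lemma norm_le_klein p : `|p| <= `|klein p|.
Proof.
have h : 1 <= 2 / (1 + Num.min 1 (sqnorm p)).
  rewrite ler_pdivlMr ?mul1r; last first.
    by rewrite ltr_wpDr// le_min ler01 sqnorm_ge0.
  have : Num.min 1 (sqnorm p) <= 1 by rewrite ge_min lexx.
  by lra.
rewrite !prod_normE /klein /=; move: (2 / _) h => k h.
rewrite !normrM ger0_norm ?(le_trans ler01 h)//.
by rewrite -maxr_pMr ?(le_trans ler01 h)// ler_peMl// le_max normr_ge0.
Qed.

Lemma norm_le_poincare p : `|p| <= 2 * `|poincare p|.
Proof.
have w0 := poincare_denom_gt0 p.
have w2 : 1 + Num.sqrt (1 - sqnorm p) <= 2.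
  suff : Num.sqrt (1 - sqnorm p) <= 1 by lra.
  by rewrite -[leRHS]sqrtr1 ler_wsqrtr// gerBl sqnorm_ge0.
have pE : p = scale (1 + Num.sqrt (1 - sqnorm p)) (poincare p).
  by rewrite /poincare scaleA divff ?lt0r_neq0// scale1.
rewrite {1}pE !prod_normE /= !normrM -maxr_pMr// (ger0_norm (ltW w0)).
by rewrite ler_wpM2r// le_max normr_ge0.
Qed.

Let gauge_norm : exists2 C, 0 < C & forall d, `|d| <= C * g d.
Proof.
have [C C0 h] := gauge_bound gg; exists C => // e.
by rewrite prod_normE ge_max; have [-> ->] := h e.
Qed.

(** Below 1, the component cannot cross the level 1, by the intermediate value theorem, so it stays
    in the bounded unit ball. Above 1, the ray from o through [klein p], carried to the Poincare
    model, stays above 1 and is unbounded. *)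
Lemma enclosed_gauge : enclosed [set p | g (klein p - o) = 1] =
  [set p | g (klein p - o) <= 1].
Proof.
have [C C0 Cg] := gauge_norm.
apply/seteqP; split => p; rewrite /enclosed /=; last first.
  rewrite le_eqVlt => /predU1P[->|lt1]; [by left|right].
  split; first by move=> e; rewrite e ltxx in lt1.
  set K := connected_component _ _.
  have Kp : K p by apply: connected_component_refl => e; rewrite e ltxx in lt1.
  have KH q : K q -> H q < 1.
    move=> Kq; rewrite ltNge; apply/negP => q1.
    have /connected_intervalP iH : connected (H @` K).
      apply: connected_continuous_connected; first exact: component_connected.
      exact/continuous_subspaceT.
    have Hp1q : H p <= 1 <= H q by rewrite (ltW lt1) q1.
    have [r Kr Hr] := iH _ _ (ex_intro2 _ _ p Kp erefl)
      (ex_intro2 _ _ q Kq erefl) 1 Hp1q.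
    exact: (connected_component_sub Kr Hr).
  exists (C + `|o|); split; first by rewrite num_real.
  move=> M CM q /KH Hq; apply: le_trans (norm_le_klein q) _.
  rewrite -(subrK o (klein q)); apply: le_trans (ler_normD _ _) _.
  apply: le_trans (ltW CM); rewrite lerD2r; apply: le_trans (Cg _) _.
  by rewrite ger_pMr// ltW.
move=> [->//|[pn1 [M [_ bM]]]]; rewrite leNgt; apply/negP => gt1.
set d := klein p - o in gt1 pn1.
have dn0 : 0 < `|d|.
  rewrite normr_gt0; apply/eqP => d0; move: gt1; rewrite d0 (gauge0 gg).
  by rewrite ltr10.
pose ray t := poincare (o + scale t d).
pose B := ray @` [set t | 1 <= t].
have cB : connected B.
  apply: connected_continuous_connected.
    by apply/connected_intervalP => s t /= s1 _ u /andP[su _]; exact: le_trans su.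
  apply: continuous_subspaceT => t.
  apply: (@cvg_comp _ _ _ (fun s => o + scale s d) (@poincare R) _
    (nbhs (o + scale t d))); last exact: poincare_continuous.
  apply: cvgD; first exact: cvg_cst.
  by apply: plane_cvg; apply: cvgM; try exact: cvg_cst; exact: cvg_id.
have Bp : B p.
  by exists 1; [exact: lexx|]; rewrite /ray scale1 /d subrKC kleinK.
have BC : B `<=` ~` [set p | g (klein p - o) = 1].
  move=> _ [t /= t1 <-]; rewrite /ray poincareK addrC addKr (gauge_scale gg).
    move=> e; suff : 1 < t * g d by rewrite e ltxx.
    by rewrite (lt_le_trans gt1)// ler_peMl// gauge_ge0.
  exact: le_trans t1.
have bB := connected_component_max Bp BC cB.
pose N := `|M| + 1.
have MN : M < N by rewrite (le_lt_trans (ler_norm M))// ltrDl.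
(* Chosen so that the norm of [scale t d] exceeds 2 * N plus the norm of o; the factor 2 is the one
   lost in [norm_le_poincare]. *)
pose t := 1 + (2 * N + `|o|) / `|d|.
have N0 : 0 < N by rewrite ltr_wpDl.
have t1 : 1 <= t by rewrite lerDl divr_ge0// addr_ge0// mulr_ge0// ltW.
have := bM N MN (ray t); rewrite /= => /(_ _)/[dup].
have Bt : B (ray t) by exists t.
move=> /(_ (bB _ Bt)) h _.
have h2 : `|o + scale t d| <= 2 * N.
  by apply: le_trans (norm_le_poincare _) _; rewrite ler_wpM2l.
have h3 : t * `|d| <= 2 * N + `|o|.
  have -> : t * `|d| = `|scale t d|.
    rewrite !prod_normE /= !normrM -maxr_pMr// ger0_norm//.
    exact: le_trans t1.
  rewrite -(addrK o (scale t d)) (addrC (scale t d)).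
  by apply: le_trans (ler_normB _ _) _; rewrite lerD2r.
move: h3; rewrite /t mulrDl mul1r divfK ?lt0r_neq0// gerDr leNgt.
by rewrite dn0.
Qed.

End Enclosed.

(** * Points fixed by the map of a triangle *)

Section TriangleMapFix.
Variable R : realType.
Local Notation plane := (R * R)%type.
Implicit Types (x y z p q u v : plane) (t : R).
Variable chord : plane -> plane -> bool.

Definition vertex x y z u := [\/ u = x, u = y | u = z].

Lemma vertex_rot x y z u : vertex y z x u <-> vertex x y z u.
Proof.
by split=> -[]; [constructor 2|constructor 3|constructor 1|
  constructor 3|constructor 1|constructor 2].
Qed.

Lemma mixC t x y : mix t x y = mix (1 - t) y x.
Proof. by rewrite /mix subKr addrC. Qed.

Lemma mixxx t x : mix t x x = x.
Proof. by case: x => x1 x2; rewrite /mix /scale; congr (_, _); rewrite /=; ring. Qed.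

Lemma straight_mix x y z t : 0 < orient x y z -> 0 <= t <= 1 ->
  straight x y z (mix t x y) /\ orient x y (mix t x y) = 0.
Proof.
move=> xyz /andP[t0 t1].
have e : orient x y (mix t x y) = 0.
  by rewrite orient_mix orientxyx orientxyy !mulr0 addr0.
split=> //; split; first by rewrite e.
  rewrite orient_mix orientxyx mulr0 addr0 orient_rot mulr_ge0 ?subr_ge0//.
  exact: ltW.
rewrite orient_mix orientxyy mulr0 add0r -orient_rot mulr_ge0//.
exact: ltW.
Qed.

(** Treats vertices (u = v) and chord sides together, in either order of u and v; a rotation of the
    triangle reduces everything to its first side. *)
Lemma tri_map_fix x y z u v t : circle x -> circle y -> circle z ->
  0 < orient x y z -> vertex x y z u -> vertex x y z v -> 0 <= t <= 1 ->
  (u <> v -> chord u v /\ chord v u) ->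
  straight x y z (mix t u v) /\ tri_map chord x y z (mix t u v) = mix t u v.
Proof.
move=> cx cy cz xyz ux vx t01.
have t01' : 0 <= 1 - t <= 1 by move: t01; lra.
have base p q w s : circle p -> circle q -> circle w -> 0 < orient p q w ->
    0 <= s <= 1 -> chord p q ->
    straight p q w (mix s p q) /\ tri_map chord p q w (mix s p q) = mix s p q.
  move=> cp cq cw pqw s01 ch; have [sp e] := straight_mix pqw s01.
  by split=> //; exact: tri_map_chord.
have yzx : 0 < orient y z x by rewrite orient_rot.
have zxy : 0 < orient z x y by rewrite -orient_rot.
have sxy := fun p => (straight_rot x y z p).1.
have syz := fun p => (straight_rot z x y p).2.
have [uv|uv] := pselect (u = v).
  move=> _; rewrite uv mixxx; case: vx => ->.
  - by split; [exact: straight_vertex|exact: tri_map_vertex].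
  - by split; [apply: sxy; exact: straight_vertex|rewrite -tri_map_rot tri_map_vertex].
  - by split; [apply: syz; exact: straight_vertex|
      rewrite (tri_map_rot _ z x y) tri_map_vertex].
move=> /(_ uv)[cuv cvu]; case: ux vx uv cuv cvu => -> [] -> // uv cuv cvu.
- exact: base.
- rewrite mixC; have [h1 h2] := base z x y (1 - t) cz cx cy zxy t01' cvu.
  by split; [exact: syz|rewrite (tri_map_rot _ z x y)].
- by rewrite mixC; exact: base.
- have [h1 h2] := base y z x t cy cz cx yzx t01 cuv.
  by split; [exact: sxy|rewrite -tri_map_rot].
- have [h1 h2] := base z x y t cz cx cy zxy t01 cuv.
  by split; [exact: syz|rewrite (tri_map_rot _ z x y)].
- rewrite mixC; have [h1 h2] := base y z x (1 - t) cy cz cx yzx t01' cvu.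
  by split; [exact: sxy|rewrite -tri_map_rot].
Qed.

End TriangleMapFix.

Lemma near_forall_lt (T : Type) (F : set_system T) (A : nat -> T -> Prop) N :
  Filter F -> (forall n, \forall x \near F, A n x) ->
  \forall x \near F, forall n, (n < N)%N -> A n x.
Proof.
move=> FF nA; elim: N => [|N IH]; first by apply: nearW.
apply: filterS2 (nA N) IH => x AN IH n; rewrite ltnS leq_eqVlt.
by move=> /orP[/eqP ->//|]; exact: IH.
Qed.

(** * Barycentric coordinates *)

Section Barycentric.
Variables (R : realType) (K : set {fset (R * R)%type}).
Local Notation plane := (R * R)%type.
Local Notation real := (realization R K).
Implicit Types (x y z p q u v w : plane) (t : R) (a b : real) (f h : plane -> R).

Definition lin x y z f : plane := scale (f x) x + scale (f y) y + scale (f z) z.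

Lemma fset3P x y z v : reflect (vertex x y z v) (v \in [fset x; y; z]%fset).
Proof.
rewrite !inE; apply: (iffP orP) => [[/orP[]|]/eqP ->|].
- by constructor 1.
- by constructor 2.
- by constructor 3.
- by case=> ->; rewrite eqxx ?orbT; [left|left|right].
Qed.

Lemma fset3_rot x y z : [fset y; z; x]%fset = [fset x; y; z]%fset.
Proof.
apply/fsetP => v; apply/fset3P/fset3P; first exact: (vertex_rot x y z v).1.
exact: (vertex_rot x y z v).2.
Qed.

Lemma big_fset3 x y z f : x <> y -> y <> z -> z <> x ->
  \sum_(v <- [fset x; y; z]%fset) f v = f x + f y + f z.
Proof.
move=> /eqP xy /eqP yz /eqP zx.
rewrite fsetUC big_fsetU1/=; last by rewrite !inE negb_or zx eq_sym.
by rewrite big_fsetU1/= ?inE// big_seq_fset1 addrC.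
Qed.

Lemma realization_inj a b : bary a =1 bary b -> a = b.
Proof.
case: a b => f f0 fs [h h0 hs] /= /funext e; subst h.
by congr Realization; exact: Prop_irrelevance.
Qed.

Lemma open_realization (U : set real) : open U = weak_open U.
Proof. by []. Qed.

Lemma bary_ge0 a v : 0 <= bary a v.
Proof. by case: a => f f0 ?; exact: f0. Qed.

(** The record only provides the sum over some simplex; both sums equal the sum over the union of
    the two simplices, as the coordinates vanish elsewhere. *)
Lemma sum_face a (s : {fset plane}) : face s a -> \sum_(v <- s) bary a v = 1.
Proof.
case: a => f f0 [s' Ks' [fs' s1]] /= fs; rewrite /face /= in fs; rewrite -s1 {s1}.
transitivity (\sum_(v <- (s `|` s')%fset) f v).
  by apply: big_fset_incl => [|v _ vs]; [exact: fsubsetUl|exact: fs].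
by apply/esym/big_fset_incl => [|v _ vs]; [exact: fsubsetUr|exact: fs'].
Qed.

Lemma faceS a (s s' : {fset plane}) : (forall v, v \in s -> v \in s') ->
  face s a -> face s' a.
Proof.
by move=> ss' fs v vs'; apply: fs; apply: contra vs'; exact: ss'.
Qed.

Lemma face3_sum x y z a : x <> y -> y <> z -> z <> x ->
  face [fset x; y; z]%fset a -> bary a x + bary a y + bary a z = 1.
Proof. by move=> xy yz zx /sum_face; rewrite big_fset3. Qed.

Lemma lin_rot x y z f : lin y z x f = lin x y z f.
Proof. by rewrite /lin addrC addrA. Qed.

Lemma orient_lin x y z f : f x + f y + f z = 1 ->
  orient x y (lin x y z f) = f z * orient x y z.
Proof.
move=> s; have fy : f y = 1 - f x - f z by rewrite -s; ring.
by rewrite !orientE /lin /= fy; ring.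
Qed.

Lemma straight_lin x y z f : 0 < orient x y z -> (forall v, 0 <= f v) ->
  f x + f y + f z = 1 -> straight x y z (lin x y z f).
Proof.
move=> xyz f0 s; split; first by rewrite orient_lin// mulr_ge0// ltW.
  rewrite -lin_rot orient_lin; last by rewrite -s; ring.
  by rewrite mulr_ge0// orient_rot ltW.
rewrite (_ : lin x y z f = lin z x y f); last by rewrite [LHS]lin_rot.
rewrite orient_lin; last by rewrite -s; ring.
by rewrite mulr_ge0// -orient_rot ltW.
Qed.

Lemma straight_face x y z a : 0 < orient x y z -> face [fset x; y; z]%fset a ->
  straight x y z (lin x y z (bary a)).
Proof.
move=> xyz fa; have [xy yz zx] := orient_neq xyz.
by apply: straight_lin => //; [exact: bary_ge0|exact: face3_sum].
Qed.

Lemma lin_inj x y z f h : 0 < orient x y z -> f x + f y + f z = 1 ->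
  h x + h y + h z = 1 -> lin x y z f = lin x y z h ->
  [/\ f x = h x, f y = h y & f z = h z].
Proof.
move=> xyz sf sh e; have D := lt0r_neq0 xyz.
have ez : f z = h z by apply: (mulIf D); rewrite -(orient_lin sf) -(orient_lin sh) e.
have ex : f x = h x.
  have D' : orient y z x != 0 by rewrite orient_rot.
  have sf' : f y + f z + f x = 1 by rewrite -sf; ring.
  have sh' : h y + h z + h x = 1 by rewrite -sh; ring.
  by apply: (mulIf D'); rewrite -(orient_lin sf') -(orient_lin sh') !(lin_rot x y z) e.
by split=> //; move: sf sh; rewrite ex ez; lra.
Qed.

Lemma face_lin_inj x y z a b : 0 < orient x y z ->
  face [fset x; y; z]%fset a -> face [fset x; y; z]%fset b ->
  lin x y z (bary a) = lin x y z (bary b) -> a = b.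
Proof.
move=> xyz fa fb e; have [xy yz zx] := orient_neq xyz.
have [ex ey ez] := lin_inj xyz (face3_sum xy yz zx fa) (face3_sum xy yz zx fb) e.
apply: realization_inj => v; have [/fset3P[]->//|vs] := boolP (v \in [fset x; y; z]%fset).
by rewrite fa// fb.
Qed.

(** The position in the plane is a sum over the support of the point, hence independent of the
    triangle through which it is computed. *)
Lemma face_lin_eq x y z x' y' z' a : x <> y -> y <> z -> z <> x ->
  x' <> y' -> y' <> z' -> z' <> x' -> face [fset x; y; z]%fset a ->
  face [fset x'; y'; z']%fset a -> lin x y z (bary a) = lin x' y' z' (bary a).
Proof.
move=> xy yz zx xy' yz' zx' fa fa'.
have sum (c : plane -> R) : bary a x * c x + bary a y * c y + bary a z * c z =
    bary a x' * c x' + bary a y' * c y' + bary a z' * c z'.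
  rewrite -!(big_fset3 (fun v => bary a v * c v))//.
  transitivity (\sum_(v <- ([fset x; y; z] `|` [fset x'; y'; z'])%fset) bary a v * c v).
    by apply: big_fset_incl => [|v _ vs]; [exact: fsubsetUl|rewrite fa// mul0r].
  by apply/esym/big_fset_incl => [|v _ vs]; [exact: fsubsetUr|rewrite fa'// mul0r].
by rewrite /lin /scale; congr (_, _); rewrite /=; exact: sum.
Qed.

Lemma realization_point x y z p : K [fset x; y; z]%fset -> 0 < orient x y z ->
  straight x y z p -> exists2 a : real, face [fset x; y; z]%fset a &
    lin x y z (bary a) = p.
Proof.
move=> Ks xyz [h1 h2 h3]; have [xy yz zx] := orient_neq xyz.
have D := lt0r_neq0 xyz.
pose f v := if v == x then orient y z p / orient x y z else
  if v == y then orient z x p / orient x y z else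
  if v == z then orient x y p / orient x y z else 0.
have fx : f x = orient y z p / orient x y z by rewrite /f eqxx.
have fy : f y = orient z x p / orient x y z.
  by rewrite /f ifN ?eqxx//; apply/eqP; exact: nesym.
have fz : f z = orient x y p / orient x y z.
  have zx' : (z == x) = false by apply/eqP.
  have zy' : (z == y) = false by apply/eqP/nesym.
  by rewrite /f zx' zy' eqxx.
have f0 v : 0 <= f v.
  by rewrite /f; do !case: ifP => _; rewrite ?divr_ge0 ?(ltW xyz).
have fs v : v \notin [fset x; y; z]%fset -> f v = 0.
  by rewrite !inE !negb_or /f => /andP[/andP[/negbTE -> /negbTE ->] /negbTE ->].
have s1 : \sum_(v <- [fset x; y; z]%fset) f v = 1.
  by rewrite big_fset3// fx fy fz -!mulrDl bary_sum divff.
exists (Realization f0 (ex_intro2 _ _ _ Ks (conj fs s1))); first by move=> v /fs.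
have := bary_decomp x y z p; rewrite /lin /= fx fy fz => e.
rewrite -[RHS]scale1 -(mulVf D) -[RHS]scaleA e.
by rewrite /scale; congr (_, _); rewrite /=; field.
Qed.

Definition mix_coord t u v w : R := (1 - t) * (w == u)%:R + t * (w == v)%:R.

Lemma lin_mix_coord x y z t u v : x <> y -> y <> z -> z <> x ->
  vertex x y z u -> vertex x y z v ->
  mix_coord t u v x + mix_coord t u v y + mix_coord t u v z = 1 /\
  lin x y z (mix_coord t u v) = mix t u v.
Proof.
move=> /eqP xy /eqP yz /eqP zx; rewrite /lin /mix /mix_coord /scale.
have [yx zy xz] : [/\ y != x, z != y & x != z] by rewrite eq_sym xy eq_sym yz eq_sym zx.
by case=> ->; case=> ->; rewrite !eqxx ?(negbTE xy) ?(negbTE yz) ?(negbTE zx)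
  ?(negbTE yx) ?(negbTE zy) ?(negbTE xz); (split; [|apply: plane_ext]); rewrite /=; ring.
Qed.

(** The conclusion mentions only u and v. Points of different triangles with the same image on a
    common edge thus have the same coordinates, which is how [psi_inj] concludes. *)
Lemma bary_mix x y z t u v a : 0 < orient x y z -> vertex x y z u ->
  vertex x y z v -> face [fset x; y; z]%fset a ->
  lin x y z (bary a) = mix t u v -> bary a =1 mix_coord t u v.
Proof.
move=> xyz ux vx fa e w; have [xy yz zx] := orient_neq xyz.
have [s l] := lin_mix_coord t xy yz zx ux vx; rewrite -l in e.
have [ex ey ez] := lin_inj xyz (face3_sum xy yz zx fa) s e.
have [/fset3P[]->//|ws] := boolP (w \in [fset x; y; z]%fset).
rewrite fa// /mix_coord.
have [/eqP wu|_] := boolP (w == u).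
  by case/negP: ws; apply/fset3P; rewrite wu.
have [/eqP wv|_] := boolP (w == v).
  by case/negP: ws; apply/fset3P; rewrite wv.
by rewrite !mulr0 addr0.
Qed.

Lemma lin_edge x y z u v a : 0 < orient x y z -> vertex x y z u ->
  vertex x y z v -> face [fset u; v]%fset a ->
  exists t, [/\ 0 <= t <= 1, lin x y z (bary a) = mix t u v & bary a v = t \/ u = v].
Proof.
move=> xyz ux vx fa; have [xy yz zx] := orient_neq xyz.
have sub w : w \in [fset u; v]%fset -> w \in [fset x; y; z]%fset.
  by rewrite !in_fset2 => /orP[]/eqP ->; exact/fset3P.
have f3 := faceS sub fa.
have [uv|/eqP uv] := eqVneq u v.
  exists 0; split; [by rewrite lexx ler01| |by right].
  have s := sum_face fa; move: s fa; rewrite uv fsetUid big_seq_fset1 => s fa.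
  have [s0 <-] := lin_mix_coord 0 xy yz zx vx vx.
  have e w : bary a w = mix_coord 0 v v w.
    rewrite /mix_coord subr0 mul1r mul0r addr0.
    by have [->//|wv] := eqVneq w v; apply: fa; rewrite inE.
  by rewrite /lin !e.
have s := sum_face fa; rewrite big_fsetU1 ?inE//= ?big_seq_fset1 in s; last exact/eqP.
exists (bary a v); split; [|clear f3|by left].
  by rewrite bary_ge0/= -s lerDr bary_ge0.
have [s0 <-] := lin_mix_coord (bary a v) xy yz zx ux vx.
have e w : bary a w = mix_coord (bary a v) u v w.
  rewrite /mix_coord; have -> : 1 - bary a v = bary a u by rewrite -s; ring.
  have [->|wu] := eqVneq w u.
    by rewrite mulr1 (negbTE (introN eqP uv)) mulr0 addr0.
  have [->|wv] := eqVneq w v; first by rewrite mulr0 mulr1 add0r.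
  by rewrite !mulr0 addr0; apply: fa; rewrite !inE negb_or wu.
by rewrite /lin (e x) (e y) (e z).
Qed.

Lemma face_edge x y z a : 0 < orient x y z -> face [fset x; y; z]%fset a ->
  orient x y (lin x y z (bary a)) = 0 <-> face [fset x; y]%fset a.
Proof.
move=> xyz fa; have [xy yz zx] := orient_neq xyz; have s := face3_sum xy yz zx fa.
rewrite orient_lin//; split.
  move=> /eqP; rewrite mulf_eq0 (gt_eqF xyz) orbF => /eqP z0 v vs.
  have [->//|vz] := eqVneq v z; apply: fa.
  by rewrite !inE; move: vs; rewrite !inE => /negbTE ->.
move=> f2; rewrite (f2 z) ?mul0r// !inE negb_or; apply/andP; split; apply/eqP => //.
exact: nesym.
Qed.

End Barycentric.

(** * The triangulation *)

Section Triangles.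
Variables (R : realType) (Z : set (R * R)) (r : R * R -> nat).
Hypothesis Zcircle : Z `<=` @circle R.
Hypothesis r_inj : forall x y, Z x -> Z y -> r x = r y -> x = y.
Local Notation plane := (R * R)%type.
Implicit Types (x y z w p q a b u v : plane) (n : nat).

Lemma orient_posZ x y z : Z x -> Z y -> Z z ->
  (0 < orient x y z) = cyc (pos x) (pos y) (pos z).
Proof. by move=> /Zcircle cx /Zcircle cy /Zcircle cz; exact: orient_pos. Qed.

Lemma pos_neq x y : Z x -> Z y -> x <> y -> pos x != pos y.
Proof.
by move=> /Zcircle cx /Zcircle cy xy; apply/eqP => /(pos_inj cx cy).
Qed.

Lemma orient_split a q z b : Z a -> Z q -> Z z -> Z b -> q <> z ->
  0 < orient a q b -> 0 < orient a z b -> 0 < orient a q z \/ 0 < orient z q b.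
Proof.
move=> Za Zq Zz Zb qz; rewrite !orient_posZ//.
have := pos_neq Zq Zz qz; rewrite /cyc => qz' h1 h2; apply/orP; lra.
Qed.

Lemma orient_widen_l a q z b : Z a -> Z q -> Z z -> Z b ->
  0 < orient a q z -> 0 < orient a z b -> 0 < orient a q b.
Proof. by move=> Za Zq Zz Zb; rewrite !orient_posZ// /cyc; lra. Qed.

Lemma orient_widen_r a q z b : Z a -> Z q -> Z z -> Z b ->
  0 < orient z q b -> 0 < orient a z b -> 0 < orient a q b.
Proof. by move=> Za Zq Zz Zb; rewrite !orient_posZ// /cyc; lra. Qed.

Lemma orient_total x y z : Z x -> Z y -> Z z -> x <> y -> y <> z -> z <> x ->
  0 < orient x y z \/ 0 < orient x z y.
Proof.
move=> Zx Zy Zz xy yz zx; rewrite !orient_posZ//.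
have := pos_neq Zx Zy xy; have := pos_neq Zy Zz yz; have := pos_neq Zz Zx zx.
by rewrite /cyc => *; apply/orP; lra.
Qed.

(** For distinct a and b of rank less than n: b is the vertex following a, counterclockwise, in the
    polygon of stage n. *)
Definition free n a b := forall q, Z q -> (r q < n)%N -> ~ 0 < orient a q b.

Lemma free_le n m a b : (n <= m)%N -> free m a b -> free n a b.
Proof. by move=> nm f q Zq qn; apply: f => //; exact: leq_trans qn nm. Qed.

(** There is at most one point of each rank, so induction on n replaces finiteness of the set of
    points of rank below n. Transitivity is asked on P alone because the order along arcs is only
    available for points of Z. *)
Lemma rank_min (lt : plane -> plane -> Prop) (P : set plane) n : P `<=` Z ->
  (forall p, ~ lt p p) ->
  (forall p q x, P p -> P q -> P x -> lt p q -> lt q x -> lt p x) ->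
  (exists2 q, P q & (r q < n)%N) ->
  exists b, [/\ P b, (r b < n)%N & forall q, P q -> (r q < n)%N -> ~ lt q b].
Proof.
move=> PZ irr tr; elim: n => [[q]//|n IH] [q Pq qn].
have [[w Pw wn]|nw] := pselect (exists2 w, P w & r w = n); last first.
  have lt_n p : P p -> (r p < n.+1)%N -> (r p < n)%N.
    move=> Pp; rewrite ltnS leq_eqVlt => /orP[/eqP pn|//].
    by case: nw; exists p.
  have [|b [Pb bn bmin]] := IH; first by exists q => //; exact: lt_n.
  exists b; split=> //; first exact: ltnW.
  by move=> p Pp /(lt_n _ Pp); exact: bmin.
have eq_w p : P p -> (r p < n.+1)%N -> (r p < n)%N \/ p = w.
  move=> Pp; rewrite ltnS leq_eqVlt => /orP[/eqP pn|]; [right|by left].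
  by apply: r_inj; [exact: PZ|exact: PZ|rewrite pn wn].
have [qP|nq] := pselect (exists2 q, P q & (r q < n)%N).
  have [b [Pb bn bmin]] := IH qP.
  have [wb|wb] := pselect (lt w b).
    exists w; split=> //; first by rewrite wn.
    move=> p Pp /eq_w[//|pn|->]; last exact: irr.
    by move=> pw; apply: (bmin p) => //; exact: tr wb.
  exists b; split=> //; first exact: ltnW.
  by move=> p Pp /eq_w[//||->//]; exact: bmin.
exists w; split=> //; first by rewrite wn.
by move=> p Pp /eq_w[//|pn _|->]; [apply: nq; exists p|exact: irr].
Qed.

Lemma next_point n z : Z z -> (exists q, [/\ Z q, (r q < n)%N & q <> z]) ->
  exists b, [/\ Z b, (r b < n)%N, b <> z & free n z b].
Proof.
move=> Zz [q [Zq qn qz]].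
have [||||b [[Zb bz] bn bmin]] := @rank_min (fun p q => 0 < orient z p q)
    (Z `&` [set p | p <> z]) n.
- by move=> p [].
- by move=> p; rewrite orientxyy ltxx.
- by move=> p s x [Zp _] [Zs _] [Zx _]; exact: orient_widen_l.
- by exists q.
exists b; split=> // p Zp pn zpb; apply: (bmin p) => //; split=> //.
by have [/nesym] := orient_neq zpb.
Qed.

Lemma prev_point n z : Z z -> (exists q, [/\ Z q, (r q < n)%N & q <> z]) ->
  exists a, [/\ Z a, (r a < n)%N, a <> z & free n a z].
Proof.
move=> Zz [q [Zq qn qz]].
have [||||a [[Za az] an amin]] := @rank_min (fun p q => 0 < orient q p z)
    (Z `&` [set p | p <> z]) n.
- by move=> p [].
- by move=> p; rewrite orientxxy ltxx.
- move=> p s x [Zp _] [Zs _] [Zx _] h1 h2; exact: (orient_widen_r Zx Zp Zs).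
- by exists q.
exists a; split=> // p Zp pn apz; apply: (amin p) => //; split=> //.
by have [] := orient_neq apz.
Qed.

(* z subdivides the arc from a to b of the polygon formed by the points of
   rank less than that of z. *)
Record tri a z b : Prop := Tri {
  tri_a : Z a; tri_z : Z z; tri_b : Z b;
  tri_ltaz : (r a < r z)%N; tri_ltbz : (r b < r z)%N;
  tri_orient : 0 < orient a z b;
  tri_free : free (r z) a b }.

(** Take the neighbours of z among the points of smaller rank; the two given points make these
    neighbours distinct. *)
Lemma tri_exists p q z : Z p -> Z q -> Z z -> p <> q ->
  (r p < r z)%N -> (r q < r z)%N -> exists a b, tri a z b.
Proof.
move=> Zp Zq Zz pq pz qz.
have neq_z x : (r x < r z)%N -> x <> z by move=> /[swap] ->; rewrite ltnn.
have pE : exists q, [/\ Z q, (r q < r z)%N & q <> z].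
  by exists p; split=> //; exact: neq_z.
have [a [Za az anz fa]] := prev_point Zz pE.
have [b [Zb bz bnz fb]] := next_point Zz pE.
have ab : a <> b.
  move=> ab; subst b.
  have [x [Zx xz xa]] : exists x, [/\ Z x, (r x < r z)%N & x <> a].
    have [pa|] := pselect (p = a); last by exists p.
    by exists q; split=> // qa; apply: pq; rewrite pa.
  have := fa _ Zx xz; have := fb _ Zx xz; have xnz := neq_z _ xz.
  have [] := @orient_total z x a Zz Zx Za (nesym xnz) xa anz => // h _.
  by rewrite orient_rot orient_rot in h.
have ozb : 0 < orient a z b.
  have [//|] := @orient_total a z b Za Zz Zb anz (nesym bnz) (nesym ab).
  by rewrite -orient_rot -orient_rot => /(fb _ Za az).
exists a, b; split=> // x Zx xz axb.
have [h|h] := @orient_split a x z b Za Zx Zz Zb (neq_z _ xz) axb ozb.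
  exact: (fa _ Zx xz h).
exact: (fb _ Zx xz h).
Qed.

Lemma tri_uniq a b a' b' z : tri a z b -> tri a' z b' -> a = a' /\ b = b'.
Proof.
move=> [Za Zz Zb az bz o f] [Za' _ Zb' az' bz' o' f'].
split; apply: contrapT => ne.
- have := f _ Za' az'; have := f' _ Za az.
  have [az0 _ _] := orient_neq o; have [az0' _ _] := orient_neq o'.
  have := pos_neq Za Za' ne; have := pos_neq Za Zz az0; have := pos_neq Za' Zz az0'.
  move=> {ne az0 az0'}; move: o o'; rewrite !orient_posZ// /cyc.
  by move=> o o' d1 d2 d3 /negP h1 /negP h2; lra.
- have := f _ Zb' bz'; have := f' _ Zb bz.
  have [_ zb0 _] := orient_neq o; have [_ zb0' _] := orient_neq o'.
  have := pos_neq Zb Zb' ne; have := pos_neq Zz Zb zb0; have := pos_neq Zz Zb' zb0'.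
  move=> {ne zb0 zb0'}; move: o o'; rewrite !orient_posZ// /cyc.
  by move=> o o' d1 d2 d3 /negP h1 /negP h2; lra.
Qed.

Lemma tri_free_az a z b : tri a z b -> free (r z).+1 a z.
Proof.
move=> [Za Zz Zb az bz o f] q Zq; rewrite ltnS leq_eqVlt => /orP[/eqP qz|qz].
  by rewrite (r_inj Zq Zz qz) orientxyy ltxx.
by move=> h; apply: (f q) => //; exact: (@orient_widen_l a q z b).
Qed.

Lemma tri_free_zb a z b : tri a z b -> free (r z).+1 z b.
Proof.
move=> [Za Zz Zb az bz o f] q Zq; rewrite ltnS leq_eqVlt => /orP[/eqP qz|qz].
  by rewrite (r_inj Zq Zz qz) orientxxy ltxx.
by move=> h; apply: (f q) => //; exact: (@orient_widen_r a q z b).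
Qed.

Definition joined x y := [/\ Z x, Z y, x <> y &
  free (maxn (r x) (r y)) x y \/ free (maxn (r x) (r y)) y x].

Lemma joined_sym x y : joined x y -> joined y x.
Proof. by move=> [Zx Zy /nesym xy h]; split=> //; rewrite maxnC; tauto. Qed.

Lemma tri_joined_az a z b : tri a z b -> joined a z.
Proof.
move=> t; have [Za Zz Zb az bz o f] := t.
have [anz _ _] := orient_neq o.
split=> //; left; apply: free_le (tri_free_az t).
by rewrite (maxn_idPr _) ltnW.
Qed.

Lemma tri_joined_zb a z b : tri a z b -> joined z b.
Proof.
move=> t; have [Za Zz Zb az bz o f] := t.
have [_ zb _] := orient_neq o.
split=> //; left; apply: free_le (tri_free_zb t).
by rewrite (maxn_idPl _) ltnW.
Qed.

Lemma tri_joined_ab a z b : tri a z b -> joined a b.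
Proof.
move=> t; have [Za Zz Zb az bz o f] := t.
have [_ _ /nesym ab] := orient_neq o.
split=> //; left; apply: free_le f.
by rewrite geq_max (ltnW az) (ltnW bz).
Qed.

(** The empty arc of xy contains u or v, whose rank is then at least those of x and y; likewise x or
    y has at least the ranks of u and v. Each of the four combinations gives two distinct points the
    same rank. *)
Lemma joined_noncrossing x y u v : joined x y -> joined u v ->
  0 < orient x u y -> 0 < orient y v x -> False.
Proof.
move=> [Zx Zy xy fxy] [Zu Zv uv fuv] xuy yvx.
have xvu : 0 < orient v x u.
  by move: xuy yvx {xy uv}; rewrite !orient_posZ// /cyc; lra.
have yuv : 0 < orient u y v.
  by move: xuy yvx {xy uv}; rewrite !orient_posZ// /cyc; lra.
have hxy : (maxn (r x) (r y) <= r u)%N \/ (maxn (r x) (r y) <= r v)%N.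
  case: fxy => f; [left|right]; rewrite leqNgt; apply/negP => lt.
    exact: (f u).
  exact: (f v).
have huv : (maxn (r u) (r v) <= r x)%N \/ (maxn (r u) (r v) <= r y)%N.
  case: fuv => f; [right|left]; rewrite leqNgt; apply/negP => lt.
    exact: (f y).
  exact: (f x).
have neq p q : Z p -> Z q -> r p = r q -> p <> q -> False.
  by move=> Zp Zq pq; apply; exact: r_inj.
have [/nesym ux yu _] := orient_neq xuy.
have [yv vx _] := orient_neq yvx.
move: hxy huv; rewrite !geq_max.
move=> -[/andP[h1 h2]|/andP[h1 h2]] [/andP[h3 h4]|/andP[h3 h4]].
- by apply: (neq u x) => //; apply/eqP; rewrite eqn_leq h3 h1.
- by apply: (neq u y) => //; apply/eqP; rewrite eqn_leq h3 h2.
- by apply: (neq v x) => //; apply/eqP; rewrite eqn_leq h4 h1.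
- by apply: (neq y v) => //; apply/eqP; rewrite eqn_leq h2 h4.
Qed.

Lemma rank_neq x y : Z x -> Z y -> x <> y -> r x != r y.
Proof. by move=> Zx Zy xy; apply/eqP => /(r_inj Zx Zy). Qed.

Lemma tri_side_ab a z b q : tri a z b -> Z q -> (r q < r z)%N ->
  q <> a -> q <> b -> 0 < orient b q a.
Proof.
move=> [Za Zz Zb az bz o f] Zq qz qa qb.
have [_ _ ba] := orient_neq o.
have [h|] := @orient_total b q a Zb Zq Za (nesym qb) qa (nesym ba) => //.
by rewrite orient_rot orient_rot => /(f _ Zq qz).
Qed.

(** The source of maximality. If y has the larger rank, some point other than x also precedes it, so
    y is the apex of a triangle. As x has smaller rank and is neither end of the base, the base
    separates x from y. *)
Lemma not_joined_crossed x y : Z x -> Z y -> x <> y -> ~ joined x y ->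
  exists a b, [/\ joined a b, 0 < orient x a y & 0 < orient y b x].
Proof.
wlog lt_r : x y / (r x < r y)%N => [hw|] Zx Zy xy nxy.
  have [lt|lt|/(r_inj Zx Zy)//] := ltngtP (r x) (r y); first exact: hw.
  have nyx : ~ joined y x by move=> /joined_sym.
  have [a [b [jab yax xby]]] := hw y x lt Zy Zx (nesym xy) nyx.
  by exists b, a; split=> //; exact: joined_sym.
have mE : maxn (r x) (r y) = r y by apply/maxn_idPr/ltnW.
have [p [Zp py xpy]] : exists p, [/\ Z p, (r p < r y)%N & 0 < orient x p y].
  apply: contrapT => np; apply: nxy; split=> //; left=> q Zq; rewrite mE => qy h.
  by apply: np; exists q.
have [x' [y' [+ _ _]]] : exists a b, [/\ tri a y b, True & True].
  have [px _ _] := orient_neq xpy.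
  by have [a [b t]] := tri_exists Zx Zp Zy px lt_r py; exists a, b.
move=> t; have [Za _ Zb az bz o f] := t.
have xa : x <> x' by move=> xE; apply: nxy; rewrite xE; exact: tri_joined_az t.
have xb : x <> y'.
  by move=> xE; apply: nxy; rewrite xE; apply: joined_sym; exact: tri_joined_zb t.
have bxa := tri_side_ab t Zx lt_r xa xb.
exists x', y'; split; first exact: tri_joined_ab t.
- by move: o bxa {xy nxy xa xb}; rewrite !orient_posZ// /cyc; lra.
- by move: o bxa {xy nxy xa xb}; rewrite !orient_posZ// /cyc; lra.
Qed.

(** The one of largest rank among p, a, b has two points before it, hence is itself an apex. So a
    triangle of minimal apex rank consists of the three points of least rank. *)
Lemma tri_rank3 a z b p : tri a z b -> Z p -> (r p < r z)%N -> p <> a ->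
  p <> b -> exists a' z' b', tri a' z' b' /\ (r z' < r z)%N.
Proof.
move=> [Za Zz Zb az bz o _] Zp pz pa pb; have [_ _ ba] := orient_neq o.
have := rank_neq Za Zb (nesym ba); have := rank_neq Zp Za pa.
have := rank_neq Zp Zb pb; move=> pb' pa' ab'.
have [m [x [y [Zm Zx Zy xy [xm ym mz]]]]] : exists m x y,
    [/\ Z m, Z x, Z y, x <> y & [/\ r x < r m, r y < r m & r m < r z]%N].
  have [mp|mp] := leqP (r a) (r p); have [mb|mb] := leqP (r b) (r p).
  - exists p, a, b; split=> //; first exact: nesym.
    by split=> //; rewrite ltn_neqAle eq_sym ?pa' ?pb'.
  - exists b, a, p; split=> //; first exact: nesym.
    by split=> //; exact: leq_ltn_trans mp mb.
  - exists a, b, p; split=> //; first exact: nesym.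
    by split=> //; exact: leq_ltn_trans mb mp.
  - have [ab|ba'] := leqP (r a) (r b).
      exists b, a, p; split=> //; first exact: nesym.
      by split=> //; rewrite ltn_neqAle ab'.
    by exists a, b, p; split=> //; first exact: nesym.
have [a' [b' t']] := tri_exists Zx Zy Zm xy xm ym.
by exists a', m, b'.
Qed.

Lemma tri_exists_min x y z : Z x -> Z y -> Z z -> x <> y -> y <> z -> z <> x ->
  exists a m b, tri a m b /\
    forall a' z' b', tri a' z' b' -> (r m <= r z')%N.
Proof.
move=> Zx Zy Zz xy yz zx.
have [n0 [a0 [z0 [b0 [t0 n0E]]]]] :
    exists n a z b, tri a z b /\ r z = n.
  suff [a [m [b t]]] : exists a m b, tri a m b by exists (r m), a, m, b.
  have := rank_neq Zx Zy xy; have := rank_neq Zy Zz yz; have := rank_neq Zz Zx zx.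
  have ex p q m : Z p -> Z q -> Z m -> p <> q -> (r p < r m)%N ->
      (r q < r m)%N -> exists a m b, tri a m b.
    move=> Zp Zq Zm pq pm qm.
    by have [a [b t]] := tri_exists Zp Zq Zm pq pm qm; exists a, m, b.
  case: (ltngtP (r z) (r x)) => // h1 _; case: (ltngtP (r y) (r z)) => // h2 _;
    case: (ltngtP (r x) (r y)) => // h3 _;
    first [by apply: (ex x y z) | by apply: (ex y z x)
    | by apply: (ex z x y) | lia].
pose T n := `[< exists a z b, tri a z b /\ r z = n >].
have exT : exists n, T n by exists n0; apply/asboolP; exists a0, z0, b0.
case: (ex_minnP exT) => m /asboolP[a [z1 [b [t <-]]]] mmin.
exists a, z1, b; split=> // a' z' b' t'; apply: mmin.
by apply/asboolP; exists a', z', b'.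
Qed.

Lemma seq_rank_max (s : seq plane) : s != [::] ->
  exists2 y, y \in s & forall v, v \in s -> (r v <= r y)%N.
Proof.
elim: s => // x [|x' s] IH _.
  by exists x => [|v]; rewrite inE// => /eqP ->.
have [y ys ymax] := IH isT.
have [yx|/ltnW xy] := leqP (r y) (r x).
  exists x => [|v]; first by rewrite inE eqxx.
  by rewrite inE => /predU1P[->//|/ymax vy]; exact: leq_trans yx.
exists y => [|v]; first by rewrite inE ys orbT.
by rewrite inE => /predU1P[->//|/ymax].
Qed.

(** Any other point of smaller rank lies beyond the base, so each of the two arcs between it and z
    contains a or b. *)
Lemma joined_tri a z b x : tri a z b -> joined x z -> (r x < r z)%N ->
  x = a \/ x = b.
Proof.
move=> t [Zx _ _ f] xz; have [Za Zz Zb az bz o _] := t.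
apply: contrapT => /not_orP[xa xb].
have bxa := tri_side_ab t Zx xz xa xb.
rewrite (maxn_idPr (ltnW xz)) in f.
have xaz : 0 < orient x a z.
  by move: o bxa {xa xb}; rewrite !orient_posZ// /cyc; lra.
have zbx : 0 < orient z b x.
  by move: o bxa {xa xb}; rewrite !orient_posZ// /cyc; lra.
by case: f => [/(_ _ Za az)|/(_ _ Zb bz)].
Qed.

(** The vertex y of largest rank decides. If y is an apex, the others are earlier neighbours of it,
    hence the ends of its base; otherwise y, and with it the whole clique, is among the three points
    of least rank. *)
Lemma clique_tri (s : seq plane) : (exists a z b, tri a z b) ->
  s != [::] -> (forall v, v \in s -> Z v) ->
  (forall u v, u \in s -> v \in s -> u <> v -> joined u v) ->
  exists a z b, tri a z b /\ forall v, v \in s -> [\/ v = a, v = z | v = b].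
Proof.
move=> [a0 [z0 [b0 t0]]] s0 sZ sj.
have [Za0 Zz0 Zb0 _ _ o0 _] := t0.
have [a0z0 z0b0 b0a0] := orient_neq o0.
have [y ys ymax] := seq_rank_max s0.
have lt_y v : v \in s -> v <> y -> (r v < r y)%N.
  move=> vs vy; rewrite ltn_neqAle ymax// andbT; apply: rank_neq => //; exact: sZ.
have [[a [b t]]|nt] := pselect (exists a b, tri a y b).
  exists a, y, b; split=> // v vs.
  have [->|vy] := pselect (v = y); first by constructor 2.
  have [||->|->] := joined_tri t (x := v).
  - exact: sj.
  - exact: lt_y.
  - by constructor 1.
  - by constructor 3.
have [a [m [b [t mmin]]]] := tri_exists_min Za0 Zz0 Zb0 a0z0 z0b0 b0a0.
have [Za Zm Zb am bm o _] := t; have [_ _ ba] := orient_neq o.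
have ym : (r y < r m)%N \/ y = m.
  have [ym|my|ym] := ltngtP (r y) (r m); first by left.
    case: nt; have [a' [b' t']] := tri_exists Za Zb (sZ _ ys) (nesym ba)
      (ltn_trans am my) (ltn_trans bm my); by exists a', b'.
  by right; apply: r_inj => //; exact: sZ.
exists a, m, b; split=> // v vs; apply: contrapT => nv.
have vm : (r v < r m)%N.
  rewrite ltn_neqAle; apply/andP; split.
    by apply: rank_neq => //; [exact: sZ|move=> e; apply: nv; constructor 2].
  by case: ym => [/ltnW|<-]; [exact/leq_trans/ymax|exact: ymax].
have [||a' [z' [b' [/mmin + lt]]]] := tri_rank3 t (sZ _ vs) vm.
- by move=> e; apply: nv; constructor 1.
- by move=> e; apply: nv; constructor 3.
- by rewrite leqNgt lt.
Qed.

(** * Nested arcs and the relative position of triangles *)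

Definition subarc p q a b := [/\ 0 <= orient p a b, 0 <= orient p b q,
  a <> b & p <> b].

Lemma subarc_half x y a b : Z x -> Z y -> Z a -> Z b -> a <> b -> x <> y ->
  (x = a \/ 0 < orient x a y) -> ~ 0 < orient a y b -> subarc x y a b.
Proof.
move=> Zx Zy Za Zb ab xy xa /negP ayb.
have ya : y <> a.
  by case: xa => [<-|/orient_neq[_ /nesym]//]; exact: nesym.
have by' : b = y \/ 0 < orient a b y.
  have [->|yb] := pselect (b = y); [by left|right].
  have [//|] := @orient_total a b y Za Zb Zy ab yb ya.
  by rewrite (negbTE ayb).
case: xa => [xa|xay].
  subst x; split=> //; first by rewrite orientxxy.
  by case: by' => [->|/ltW//]; rewrite orientxyy.
case: by' => [bE|aby].
  subst b; split=> //; first exact: ltW.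
  by rewrite orientxyy.
have xab : 0 < orient x a b.
  by move: xay aby {ab xy ya}; rewrite !orient_posZ// /cyc; lra.
have xby : 0 < orient x b y.
  by move: xay aby {ab xy ya}; rewrite !orient_posZ// /cyc; lra.
split=> //; [exact: ltW|exact: ltW|].
by have [] := orient_neq xby.
Qed.

Lemma subarc_tri x y z a b : Z x -> Z y -> Z z -> Z a -> Z b -> a <> b ->
  0 < orient x y z -> ~ 0 < orient a x b -> ~ 0 < orient a y b ->
  ~ 0 < orient a z b -> [\/ subarc x y a b, subarc y z a b | subarc z x a b].
Proof.
move=> Zx Zy Zz Za Zb ab xyz axb ayb azb.
have [xy yz zx] := orient_neq xyz.
suff : [\/ x = a \/ 0 < orient x a y, y = a \/ 0 < orient y a z |
           z = a \/ 0 < orient z a x].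
  case=> h; [constructor 1|constructor 2|constructor 3]; exact: subarc_half.
have [xa|xa] := pselect (x = a); first by constructor 1; left.
have [ya|ya] := pselect (y = a); first by constructor 2; left.
have [za|za] := pselect (z = a); first by constructor 3; left.
have [xay|xya] := orient_total Zx Za Zy xa (nesym ya) (nesym xy).
  by constructor 1; right.
have [yaz|yza] := orient_total Zy Za Zz ya (nesym za) (nesym yz).
  by constructor 2; right.
constructor 3; right.
by move: xyz xya yza {ab xy yz zx xa ya za}; rewrite !orient_posZ// /cyc; lra.
Qed.

Lemma subarc_in p q a b z : Z p -> Z q -> Z a -> Z b -> Z z -> p <> q ->
  subarc p q a b -> 0 < orient a z b -> 0 < orient p z q.
Proof.
move=> Zp Zq Za Zb Zz npq [+ + ab pb] azb.
rewrite !le_eqVlt => pab pbq.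
have {}pab : p = a \/ 0 < orient p a b.
  have [->|pa] := pselect (p = a); [by left|right].
  move: pab => /predU1P[/esym /orient_eq0|//].
  by move=> /(_ (Zcircle Zp) (Zcircle Za) (Zcircle Zb))[//|//|/nesym].
have {}pbq : b = q \/ 0 < orient p b q.
  have [->|bq] := pselect (b = q); [by left|right].
  move: pbq => /predU1P[/esym /orient_eq0|//].
  by move=> /(_ (Zcircle Zp) (Zcircle Zb) (Zcircle Zq))[//|//|/esym].
have pzb : 0 < orient p z b.
  case: pab => [->//|pab].
  by move: azb pab {npq ab pb pbq}; rewrite !orient_posZ// /cyc; lra.
case: pbq => [<-//|pbq].
by move: pzb pbq {npq ab pb pab}; rewrite !orient_posZ// /cyc; lra.
Qed.

Lemma subarc_overlap u w a b x : Z u -> Z w -> Z a -> Z b -> Z x ->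
  0 < orient a x b -> 0 < orient u x w -> ~ 0 < orient a u b ->
  ~ 0 < orient a w b -> subarc u w a b.
Proof.
move=> Zu Zw Za Zb Zx axb uxw aub awb.
have [_ _ /nesym ab] := orient_neq axb; have [_ _ /nesym uw] := orient_neq uxw.
apply: subarc_half => //.
have [->|ua] := pselect (u = a); [by left|right].
have := pos_neq Zu Za ua; move: axb uxw aub {awb ab uw ua}.
rewrite !orient_posZ// /cyc => h1 h2 /negP h3 h4; lra.
Qed.

(** Boolean, to serve as the parameter of the triangle maps; for distinct points of Z it says that
    the open arc from u to v meets Z. *)
Definition chord u v : bool := `[< ~ successor Z u v >].

Lemma chord_ex u v : Z u -> Z v -> u <> v -> chord u v ->
  exists2 q, Z q & 0 < orient u q v.
Proof.
move=> Zu Zv uv /asboolP ns; apply: contrapT => nq; apply: ns; split=> //.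
by move=> q Zq; rewrite ccwE => uqv; apply: nq; exists q.
Qed.

Lemma ex_chord u v q : Z q -> 0 < orient u q v -> chord u v.
Proof.
by move=> Zq uqv; apply/asboolP => -[_ _ _ /(_ _ Zq)]; rewrite ccwE.
Qed.

(** The arc from a to b lies within the arc of one side of the triangle. As q is on that arc, this
    side is a chord, so the region avoids its cap, which contains the cap of ab. *)
Lemma region_side x y z a b q p : Z x -> Z y -> Z z -> Z a -> Z b -> Z q ->
  0 < orient x y z -> ~ 0 < orient a x b -> ~ 0 < orient a y b ->
  ~ 0 < orient a z b -> 0 < orient a q b -> region chord x y z p ->
  orient a p b <= 0.
Proof.
move=> Zx Zy Zz Za Zb Zq xyz axb ayb azb aqb [dp h1 h2 h3].
rewrite leNgt; apply/negP => apb.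
have [_ _ /nesym ab] := orient_neq aqb; have [xy yz zx] := orient_neq xyz.
have side u v : Z u -> Z v -> u <> v -> subarc u v a b -> side_ok chord u v p -> False.
  move=> Zu Zv uv suv ok; have ch := ex_chord Zq (subarc_in Zu Zv Za Zb Zq uv suv aqb).
  have [uab ubv _ ub] := suv.
  have := cap_sub_lt (Zcircle Zu) (Zcircle Zv) (Zcircle Za) (Zcircle Zb) dp
    uv ab ub uab ubv apb.
  by rewrite orient_swap oppr_gt0 ltNge (ok ch).
have [s|s|s] := subarc_tri Zx Zy Zz Za Zb ab xyz axb ayb azb.
- exact: (side x y).
- exact: (side y z).
- exact: (side z x).
Qed.

Lemma region_Z x y z p : Z x -> Z y -> Z z -> 0 < orient x y z -> Z p ->
  region chord x y z p -> vertex x y z p.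
Proof.
move=> Zx Zy Zz xyz Zp [dp h1 h2 h3]; apply: contrapT => nv.
have px : p <> x by move=> e; apply: nv; constructor 1.
have py : p <> y by move=> e; apply: nv; constructor 2.
have pz : p <> z by move=> e; apply: nv; constructor 3.
have [xy yz zx] := orient_neq xyz.
have side u v : Z u -> Z v -> p <> u -> p <> v -> u <> v -> side_ok chord u v p ->
    0 < orient u v p.
  move=> Zu Zv pu pv uv ok.
  have [upv|//] := orient_total Zu Zp Zv (nesym pu) pv (nesym uv).
  by have := ok (ex_chord Zp upv); rewrite -oppr_le0 -orient_swap leNgt upv.
have o1 := side x y Zx Zy px py xy h1.
have o2 := side y z Zy Zz py pz yz h2.
have o3 := side z x Zz Zx pz px zx h3.
by move: xyz o1 o2 o3 {px py pz xy yz zx side}; rewrite !orient_posZ// /cyc; lra.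
Qed.

(** As p is interior to the chord xy, its ends are either strictly on opposite sides of uv, which
    would be a crossing of edges, or both on the line uv. *)
Lemma chords_meet u v x y p : joined u v -> joined x y -> open_disk p ->
  orient u v p = 0 -> orient x y p = 0 -> (u = x /\ v = y) \/ (u = y /\ v = x).
Proof.
move=> juv jxy op uvp xyp.
have [Zu Zv uv _] := juv; have [Zx Zy xy _] := jxy.
have [cu cv cx cy] := And4 (Zcircle Zu) (Zcircle Zv) (Zcircle Zx) (Zcircle Zy).
have [t [t0 t1 pE]] := chord_open_disk cx cy xy op xyp.
move: uvp; rewrite pE orient_mix => e.
have [lt|gt|x0] := ltgtP (orient u v x) 0.
- exfalso; apply: (joined_noncrossing juv jxy).
    by rewrite orient_swap oppr_gt0.
  rewrite orient_rot -(pmulr_rgt0 _ t0).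
  by have : (1 - t) * orient u v x < 0; [rewrite pmulr_rlt0 ?subr_gt0|lra].
- exfalso; apply: (joined_noncrossing juv (joined_sym jxy)); last by rewrite orient_rot.
  rewrite orient_swap oppr_gt0 -(pmulr_rlt0 _ t0).
  by have : 0 < (1 - t) * orient u v x; [rewrite pmulr_rgt0 ?subr_gt0|lra].
- have y0 : orient u v y = 0.
    by move: e; rewrite x0 mulr0 add0r => /eqP; rewrite mulf_eq0 (gt_eqF t0) => /eqP.
  have [//|vx|xu] := orient_eq0 cu cv cx x0.
    have [//|vy|yu] := orient_eq0 cu cv cy y0; first by case: xy; rewrite -vx -vy.
    by right.
  have [//|vy|yu] := orient_eq0 cu cv cy y0; first by left.
  by case: xy; rewrite xu yu.
Qed.

Lemma tri_chord_ab a z b : tri a z b -> chord a b.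
Proof. by move=> t; have [_ Zz _ _ _ o _] := t; exact: ex_chord o. Qed.

(** One of the three vertices of the earlier triangle is neither a' nor b', so it lies beyond the
    base of the later one. Hence this base is a chord and is not bulged. *)
Lemma tri_chord_ba a z b a' z' b' : tri a z b -> tri a' z' b' ->
  (r z < r z')%N -> chord b' a'.
Proof.
move=> [Za Zz Zb az bz o f] t' zz'.
have [az0 zb0 ba0] := orient_neq o.
have side q : Z q -> (r q <= r z)%N -> q <> a' -> q <> b' -> chord b' a'.
  move=> Zq qz qa qb; apply: (ex_chord Zq); apply: (tri_side_ab t') => //.
  exact: leq_ltn_trans zz'.
have [aa|aa] := pselect (a = a').
  have [zb|zb] := pselect (z = b').
    by apply: (side b) => //; [exact: ltnW|rewrite -aa|rewrite -zb; exact: nesym].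
  by apply: (side z) => //; rewrite -aa; exact: nesym.
have [ab|ab] := pselect (a = b'); last by apply: (side a) => //; exact: ltnW.
have [za|za] := pselect (z = a').
  by apply: (side b) => //; [exact: ltnW|rewrite -za; exact: nesym|rewrite -ab].
by apply: (side z) => //; rewrite -ab; exact: nesym.
Qed.

(* The triangle of larger rank lies beyond its chord a'b', the other one on the
   near side, so the common point is on this chord. *)
Lemma tri_map_meet a z b a' z' b' p p' : tri a z b -> tri a' z' b' ->
  (r z < r z')%N -> straight a z b p -> straight a' z' b' p' ->
  tri_map chord a z b p = tri_map chord a' z' b' p' ->
  exists u v t, [/\ vertex a z b u, vertex a z b v, vertex a' z' b' u,
    vertex a' z' b' v & [/\ 0 <= t <= 1, p = mix t u v & p' = mix t u v]].
Proof.
move=> tr tr' zz' sp sp' e.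
have [Za Zz Zb az bz o f] := tr; have [Za' Zz' Zb' az' bz' o' f'] := tr'.
have [ca cz cb] := And3 (Zcircle Za) (Zcircle Zz) (Zcircle Zb).
have [ca' cz' cb'] := And3 (Zcircle Za') (Zcircle Zz') (Zcircle Zb').
have [_ _ ba'] := orient_neq o'.
set P := tri_map chord a z b p in e.
have rP : region chord a z b P by apply/region_tri_map.
have rP' : region chord a' z' b' P by rewrite e; apply/region_tri_map.
have chab := tri_chord_ab tr'; have chba := tri_chord_ba tr tr' zz'.
have nin v : vertex a z b v -> ~ 0 < orient a' v b'.
  by case=> ->; apply: f' => //; [exact: ltn_trans zz'|exact: ltn_trans zz'].
have na := nin a (Or31 _ _ erefl); have nz := nin z (Or32 _ _ erefl).
have nb := nin b (Or33 _ _ erefl).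
have side q : region chord a z b q -> orient a' q b' <= 0.
  exact: (region_side Za Zz Zb Za' Zb' Zz' o na nz nb o').
have P0 : orient b' a' P = 0.
  have [_ _ _ /(_ chba) ge] := rP'; apply/eqP; rewrite eq_le ge andbT.
  by rewrite -orient_rot side.
have [dP _ _ _] := rP.
have [t [t0 t1 PE]] := chord_disk cb' ca' ba' dP P0.
have t01 : 0 <= t <= 1 by rewrite t0 t1.
have va' : vertex a' z' b' a' by constructor 1.
have vb' : vertex a' z' b' b' by constructor 3.
have fix' := tri_map_fix ca' cz' cb' o' vb' va' t01 (fun=> conj chba chab).
have p'E : p' = mix t b' a'.
  by apply: (can_inj (tri_mapK chord ca' cz' cb' o')); rewrite -e fix'.2.
have [[va vb]|nv] := pselect (vertex a z b a' /\ vertex a z b b').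
  have fx := tri_map_fix ca cz cb o vb va t01 (fun=> conj chba chab).
  exists b', a', t; split=> //; split=> //.
  by apply: (can_inj (tri_mapK chord ca cz cb o)); rewrite -/P PE fx.2.
(* The line a'b' meets the circle only at a' and b', so here P is a common vertex. *)
have [cP|nc] := pselect (circle P).
  have PZ' : Z P /\ vertex a' z' b' P.
    by have [//|<-|->] := orient_eq0 cb' ca' cP P0.
  have vP := region_Z Za Zz Zb o PZ'.1 rP.
  have fx := tri_map_fix (chord := chord) ca cz cb o vP vP t01
    (fun ne => False_ind _ (ne erefl)).
  have fx' := tri_map_fix (chord := chord) ca' cz' cb' o' PZ'.2 PZ'.2 t01
    (fun ne => False_ind _ (ne erefl)).
  exists P, P, t; split=> //; [exact: PZ'.2|exact: PZ'.2|split=> //].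
    by apply: (can_inj (tri_mapK chord ca cz cb o)); rewrite -/P fx.2 mixxx.
  by apply: (can_inj (tri_mapK chord ca' cz' cb' o')); rewrite -e fx'.2 mixxx.
have oP : open_disk P.
  by move: dP; rewrite /disk /open_disk /= le_eqVlt => /predU1P[].
(* In the open disk P is on the frontier of the first region, hence on one of its chord sides;
   sharing an inner point with a'b', this side is a'b'. *)
exfalso; apply: nv.
have le v : ~ 0 < orient a' v b' -> orient a' v b' <= 0 by move=> /negP; rewrite -leNgt.
have g1 := region_frontier ca cz cb o ca' cb' (nesym ba') (le _ na) (le _ nz)
  (le _ nb) side rP.
rewrite orient_rot P0 in g1; have {}g1 := g1 erefl.
have jab := joined_sym (tri_joined_ab tr').
have [[_ q0]|[_ q0]|[_ q0]] := region_gauge_eq1 ca cz cb o rP oP g1.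
- have [[<- <-]|[<- <-]] := chords_meet (tri_joined_az tr) jab oP q0 P0;
    by split; first [by constructor 1|by constructor 2|by constructor 3].
- have [[<- <-]|[<- <-]] := chords_meet (tri_joined_zb tr) jab oP q0 P0;
    by split; first [by constructor 1|by constructor 2|by constructor 3].
- have [[<- <-]|[<- <-]] := chords_meet (joined_sym (tri_joined_ab tr)) jab oP q0 P0;
    by split; first [by constructor 1|by constructor 2|by constructor 3].
Qed.

(** * Local finiteness and covering *)

Hypothesis Z_isolated : Z `<=` isolated Z.
Hypothesis Z_both_sides : forall p, limit_set 1 Z p -> limit_from_both_sides Z p.

Lemma limit_pointZ p : limit_point Z p -> limit_set 1 Z p.
Proof.
move=> lp; split=> //; apply: closed_circle => U /lp[q [_ Zq Uq]].
by exists q; split=> //; exact: Zcircle.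
Qed.

Lemma isolated_nbhs z : Z z -> exists2 V : set plane, nbhs z V &
  forall q, Z q -> V q -> q = z.
Proof.
move=> /Z_isolated[_ [V zV VZ]]; exists V => // q Zq Vq.
by have : (V `&` Z) q by []; rewrite VZ.
Qed.

Definition small_at (e : R) n x := forall a b p, Z a -> Z b -> Z x -> free n a b ->
  0 < orient a x b -> disk p -> 0 <= orient a p b -> ball x e p.

Lemma small_near (e : R) al : 0 < e -> circle al ->
  \forall x \near al & n \near \oo, small_at e n x.
Proof.
(* If [al] is in Z, no other point of Z is near, and once inserted [al] is in no empty arc. *)
move=> e0 cal; have [Zal|nZ] := pselect (Z al).
  have [V aV VZ] := isolated_nbhs Zal.
  exists (V, [set n | (r al < n)%N]); first by split=> //; exact: nbhs_infty_gt.
  move=> [x n] [/= Vx rn] a b p Za Zb Zx f axb.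
  by rewrite (VZ _ Zx Vx) in axb; case: (f _ Zal rn axb).
(* If [al] is neither in Z nor a limit point, no point of Z is near. *)
have [la|] := pselect (limit_point Z al); last first.
  rewrite not_limit_pointE => -[X aX ZX].
  exists (X, setT); first by split=> //; exact: filterT.
  move=> [x n] [/= Xx _] a b p Za Zb Zx; case: nZ.
  by rewrite -(ZX x).
(* On the disk the squared distance to [al] is at most 2 (1 - dot), and 2 * eta is the square of e /
   2. *)
pose eta := (e / 2) ^+ 2 / 2.
have e2 : 0 < e / 2 by rewrite divr_gt0.
have eta0 : 0 < eta by rewrite divr_gt0// exprn_gt0.
have dot_near : \forall q \near al, 1 - eta < dot al q.
  have : dot al q @[q --> al] --> dot al al by exact: dot_continuous.
  move=> /cvgr_gt; apply; rewrite (_ : dot al al = sqnorm al) ?cal ?gtrBl//.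
have [[u [Zu ug u0]] [w [Zw wg w0]]] :
   (exists q, [/\ Z q, 1 - eta < dot al q & det2 al q < 0]) /\
   (exists q, [/\ Z q, 1 - eta < dot al q & 0 < det2 al q]).
  by have [] := Z_both_sides (limit_pointZ la) dot_near; split.
have [cu cw] := (Zcircle Zu, Zcircle Zw).
have uaw := orient_both_sides cal cu cw u0 w0.
have uw : u <> w by have [_ _ /nesym] := orient_neq uaw.
pose X := [set x | 0 < orient u x w] `&` ball al (e / 2).
exists (X, [set n | (r u < n)%N /\ (r w < n)%N]).
  split; last first.
    exact: filterI (nbhs_infty_gt (r u)) (nbhs_infty_gt (r w)).
  apply: filterI; last exact: nbhsx_ballx.
  have : orient u q w @[q --> al] --> orient u al w by exact: orient_continuous.
  by move=> /cvgr_gt; apply.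
move=> [x n] [/= [uxw xal] [run rwn]] a b p Za Zb Zx f axb dp apb.
(* Once u and w are inserted, the arc from a to b contains neither of them and is caught inside the
   arc from u to w. *)
have [uab ubw ab ub] := subarc_overlap Zu Zw Za Zb Zx axb uxw (f _ Zu run) (f _ Zw rwn).
have upw := cap_sub cu cw (Zcircle Za) (Zcircle Zb) dp ab ub uab ubw apb.
have := cap_dot_ge cal cu cw dp uw (ltW u0) (ltW w0) upw => h.
have {}h : 1 - eta < dot al p by rewrite (lt_le_trans _ h)// lt_min ug wg.
apply: (@ball_splitr _ _ al) => //; apply: sqnorm_ball => //.
rewrite sqnorm_sub_circle// (_ : dot p al = dot al p); last first.
  by rewrite /dot; ring.
have -> : (e / 2) ^+ 2 = 2 * eta by rewrite /eta; field.
by move: dp; rewrite /disk /=; lra.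
Qed.

(** Compactness, in its near-covering form, replaces the local stages of [small_near] by a uniform
    one. Off the circle [small_at] is vacuous, as x must be in Z. *)
Lemma small_caps (e : R) : 0 < e -> \forall n \near \oo, forall x, small_at e n x.
Proof.
move=> e0; have h := (compact_near_coveringP (@circle R)).1 (@compact_circle R) nat \oo
  (small_at e) _ (fun x cx => small_near e0 cx).
apply: filterS (h _) => n {}h x a b p Za Zb Zx.
exact: h (Zcircle Zx) a b p Za Zb Zx.
Qed.

Lemma away_from_limits P : ~ limit_set 1 Z P -> exists2 d : R, 0 < d &
  \forall n \near \oo, forall a b x p, Z a -> Z b -> Z x -> free n a b ->
    0 < orient a x b -> disk p -> 0 <= orient a p b -> ~ ball P d p.
Proof.
move=> nL; have : ~ limit_point Z P by move=> /limit_pointZ.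
rewrite not_limit_pointE => -[X /nbhs_ballP[d /= d0 dX] ZX].
have d2 : 0 < d / 2 by rewrite divr_gt0.
have d4 : 0 < d / 2 / 2 by rewrite divr_gt0.
exists (d / 2 / 2) => //; apply: filterS (small_caps d4).
move=> n small a b x p Za Zb Zx f axb dp apb Pp.
have xp := small x a b p Za Zb Zx f axb dp apb.
have xa : ball x (d / 2 / 2) a.
  apply: (small x a b a) => //; first exact/circle_disk/Zcircle.
  by rewrite orientxxy.
have Px : ball P (d / 2) x by exact: ball_splitl Pp xp.
have Pa : ball P d a.
  apply: (@ball_splitr _ _ x); first exact: ball_sym.
  by apply: le_ball xa; lra.
have xP : x = P.
  apply: (ZX x); split=> //; apply: dX; apply: le_ball Px; lra.
have aP : a = P by apply: (ZX a); split=> //; exact: dX.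
by have [] := orient_neq axb; rewrite aP xP.
Qed.

Definition adjacent n a b :=
  [/\ Z a, Z b, a <> b, (r a < n)%N & (r b < n)%N] /\ free n a b.

(** A point outside the region is beyond a chord side. The last hypothesis deals with zx: either P
    is already known to lie in the cap that the new triangle subdivides, or, for the initial
    triangle, zx is itself a side of the polygon. *)
Lemma cover_step x y z n P : Z x -> Z y -> Z z -> 0 < orient x y z ->
  disk P -> (adjacent n x y /\ adjacent n y z) ->
  0 <= orient x P z \/ adjacent n z x ->
  region chord x y z P \/ exists a b,
    [/\ adjacent n a b, chord a b & 0 <= orient a P b].
Proof.
move=> Zx Zy Zz xyz dP [axy ayz] hzx.
have side u v : adjacent n u v -> ~ side_ok chord u v P -> exists a b,
    [/\ adjacent n a b, chord a b & 0 <= orient a P b].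
  move=> auv /not_implyP[ch /negP h]; exists u, v; split=> //.
  by rewrite orient_swap oppr_ge0 ltW// ltNge.
have [sxy|/side h] := pselect (side_ok chord x y P); last by right; exact: h.
have [syz|/side h] := pselect (side_ok chord y z P); last by right; exact: h.
have [szx|nzx] := pselect (side_ok chord z x P); first by left; split.
case: hzx => [xPz|azx]; last by right; exact: side nzx.
left; split=> //; case: nzx => _.
by rewrite -orient_rot.
Qed.

(** Induction on the stage: if P is beyond the side ab, then either the point of rank n subdivides
    its arc and [cover_step] applies to the new triangle, or ab remains a side. *)
Lemma cover n P a0 m b0 : tri a0 m b0 ->
  (forall a z b, tri a z b -> (r m <= r z)%N) -> disk P -> (r m < n)%N ->
  (exists a z b, tri a z b /\ region chord a z b P) \/
  (exists a b, [/\ adjacent n a b, chord a b & 0 <= orient a P b]).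
Proof.
move=> t0 m_min dP; elim: n => // n IH; rewrite ltnS leq_eqVlt => /orP[/eqP rm|].
  have [Za Zm Zb am bm o f] := t0; have [anm mb ba] := orient_neq o.
  rewrite -rm; have := @cover_step a0 m b0 (r m).+1 P Za Zm Zb o dP.
  case.
  - split; split; [split=> //; exact: ltnW|exact: (tri_free_az t0)|
      split=> //; exact: ltnW|exact: (tri_free_zb t0)].
  - right; split; first by split=> //; exact: ltnW.
    move=> q Zq; rewrite ltnS leq_eqVlt => /orP[/eqP/(r_inj Zq Zm) ->|qm].
      by move: o {anm mb ba}; rewrite !orient_posZ// /cyc; lra.
    move=> bqa; have [bq qa _] := orient_neq bqa.
    have [a' [z' [b' [/m_min + lt]]]] := tri_rank3 t0 Zq qm qa (nesym bq).
    by rewrite leqNgt lt.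
  - by left; exists a0, m, b0.
  - by right.
move=> /IH[|[a [b [[[Za Zb ab an bn] f] ch aPb]]]]; [by left|].
have [[z [Zz zn azb]]|nz] := pselect (exists z, [/\ Z z, r z = n & 0 < orient a z b]);
  last first.
  right; exists a, b; split=> //; split; first by split=> //; exact: ltnW.
  move=> q Zq; rewrite ltnS leq_eqVlt => /orP[/eqP qn|qn].
    by move=> h; apply: nz; exists q.
  exact: f.
have t : tri a z b by split=> //; rewrite zn.
have [anz zb ba] := orient_neq azb.
rewrite -zn; have := @cover_step a z b (r z).+1 P Za Zz Zb azb dP.
case.
- split; split; [split=> //; exact: ltnW (tri_ltaz t)|exact: (tri_free_az t)|
    split=> //; exact: ltnW (tri_ltbz t)|exact: (tri_free_zb t)].
- by left.
- by left; exists a, z, b.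
- by right.
Qed.

(** * The homeomorphism psi *)

(** The condition on the ranks keeps one of the isomorphic pairs (u, v) and (v, u), as a cluster
    consists of pairwise nonisomorphic objects. *)
Definition triangulation : set (plane * plane) :=
  [set e | [/\ joined e.1 e.2, (r e.1 < r e.2)%N, chord e.1 e.2 & chord e.2 e.1]].

Local Notation S := triangulation.
Local Notation K := (cluster_complex Z S).

Lemma successor_joined u v : successor Z u v -> joined u v.
Proof.
move=> s; have [Zu Zv uv h] := s; split=> //; left=> q Zq _.
by rewrite -ccwE; exact: h.
Qed.

Lemma in_triangulation u v : in_upto_iso S u v <->
  [/\ joined u v, chord u v & chord v u].
Proof.
split=> [[[e1 e2] [/= j _ c1 c2] [[-> ->]|[-> ->]]]|[j c1 c2]].
- by split.
- by split=> //; exact: joined_sym.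
have [Zu Zv uv _] := j.
have [lt|lt|/(r_inj Zu Zv)//] := ltngtP (r u) (r v).
  by exists (u, v); [split|left].
by exists (v, u); [split=> //; exact: joined_sym|right].
Qed.

Lemma edgeE u v : edge Z S u v <-> joined u v.
Proof.
split=> [[/in_triangulation[]//|/successor_joined//|/successor_joined/joined_sym//]|j].
have [c1|/asboolPn/contrapT s] := boolP (chord u v); last by constructor 2.
have [c2|/asboolPn/contrapT s] := boolP (chord v u); last by constructor 3.
by constructor 1; apply/in_triangulation.
Qed.

Hypothesis tri_nonempty : exists a z b, tri a z b.

Lemma complex_tri (s : {fset plane}) : K s ->
  exists a z b, tri a z b /\ forall v, v \in s -> v \in [fset a; z; b]%fset.
Proof.
move=> [/andP[s0 _] sZ sE].
have [|||a [z [b [t h]]]] := clique_tri (s := enum_fset s) tri_nonempty.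
- by rewrite -size_eq0 -lt0n.
- exact: sZ.
- by move=> u v us vs uv; apply/edgeE; exact: sE.
by exists a, z, b; split=> // v vs; apply/fset3P; exact: h.
Qed.

Lemma tri_complex a z b : tri a z b -> K [fset a; z; b]%fset.
Proof.
move=> t; have [Za Zz Zb _ _ o _] := t; have [az zb ba] := orient_neq o.
split.
- rewrite fsetUC cardfsU1 cardfs2 !inE.
  by case: eqP => // _; case: eqP => // _; case: eqP.
- by move=> v /fset3P[->|->|->].
move=> u v /fset3P ua /fset3P va uv; apply/edgeE.
have [jaz jzb jab] := And3 (tri_joined_az t) (tri_joined_zb t) (tri_joined_ab t).
by case: ua va uv => -> [] -> // _; apply: joined_sym.
Qed.

Local Notation real := (realization R K).
Implicit Types (c d : real).

Lemma realization_tri c : exists t : plane * plane * plane,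
  tri t.1.1 t.1.2 t.2 /\ face [fset t.1.1; t.1.2; t.2]%fset c.
Proof.
have [s Ks fs] : exists2 s, K s & face s c.
  by case: c => f f0 [s Ks [fs s1]]; exists s.
have [a [z [b [t h]]]] := complex_tri Ks.
by exists (a, z, b); split=> //; exact: faceS h fs.
Qed.

(** An arbitrary triangle containing the point; [psiE] shows that the choice does not matter. *)
Definition carrier c := projT1 (cid (realization_tri c)).

Definition psi c : plane := let t := carrier c in
  poincare (tri_map chord t.1.1 t.1.2 t.2 (lin t.1.1 t.1.2 t.2 (bary c))).

Lemma tri_rank_notin a z b a' z' b' : tri a z b -> tri a' z' b' ->
  (r z < r z')%N -> z' \notin [fset a; z; b]%fset.
Proof.
move=> [_ _ _ az bz _ _] _ zz'; apply/negP => /fset3P[] e; move: zz'; rewrite e.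
- by move=> /(ltn_trans az); rewrite ltnn.
- by rewrite ltnn.
- by move=> /(ltn_trans bz); rewrite ltnn.
Qed.

(** The apex z' is not a vertex of the earlier triangle, so its coordinate vanishes and the point
    lies on the chord a'b'. Only an endpoint with nonzero coordinate is known to be a vertex of the
    earlier triangle, whence the separate cases 0 and 1 of the parameter. *)
Lemma tri_map_agree a z b a' z' b' c : tri a z b -> tri a' z' b' ->
  (r z < r z')%N -> face [fset a; z; b]%fset c -> face [fset a'; z'; b']%fset c ->
  tri_map chord a z b (lin a z b (bary c)) =
  tri_map chord a' z' b' (lin a' z' b' (bary c)).
Proof.
move=> t t' zz' fc fc'.
have [Za Zz Zb az bz o f] := t; have [Za' Zz' Zb' az' bz' o' f'] := t'.
have [naz nzb nba] := orient_neq o; have [naz' nzb' nba'] := orient_neq o'.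
have z0 := fc _ (tri_rank_notin t t' zz').
have f2 : face [fset b'; a']%fset c.
  move=> v vs; have [->//|vz] := eqVneq v z'; apply: fc'.
  by move: vs; rewrite !inE => /norP[/negbTE -> /negbTE ->]; rewrite (negbTE vz).
have [va' vb'] : vertex a' z' b' a' /\ vertex a' z' b' b'.
  by split; [constructor 1|constructor 3].
have [t0 [t01 e te]] := lin_edge o' vb' va' f2.
have {}te : bary c a' = t0 by case: te.
have e' : lin a z b (bary c) = mix t0 b' a'.
  by rewrite -e; exact: face_lin_eq.
rewrite e e'.
have chab := tri_chord_ab t'; have chba := tri_chord_ba t t' zz'.
have [cb' ca'] := (Zcircle Zb', Zcircle Za').
rewrite (tri_map_fix (chord := chord) ca' (Zcircle Zz') cb' o' vb' va' t01 _).2//.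
have tb : bary c b' = 1 - t0.
  have := face3_sum naz' nzb' nba' fc'; rewrite z0 te => <-; ring.
have inT v : bary c v != 0 -> vertex a z b v.
  by move=> v0; apply/fset3P; apply: contraNT v0 => /fc ->.
have [s0|s0] := eqVneq t0 0.
  have vb : vertex a z b b' by apply: inT; rewrite tb s0 subr0 oner_eq0.
  have -> : mix t0 b' a' = mix t0 b' b'.
    by rewrite mixxx s0 /mix /scale; apply: plane_ext; rewrite /=; ring.
  exact: (tri_map_fix (chord := chord) (Zcircle Za) (Zcircle Zz) (Zcircle Zb) o vb vb t01
    (fun ne => False_ind _ (ne erefl))).2.
have va : vertex a z b a' by apply: inT; rewrite te.
have [s1|s1] := eqVneq t0 1.
  have -> : mix t0 b' a' = mix t0 a' a'.
    by rewrite mixxx s1 /mix /scale; apply: plane_ext; rewrite /=; ring.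
  exact: (tri_map_fix (chord := chord) (Zcircle Za) (Zcircle Zz) (Zcircle Zb) o va va t01
    (fun ne => False_ind _ (ne erefl))).2.
have vb : vertex a z b b' by apply: inT; rewrite tb subr_eq0 eq_sym.
exact: (tri_map_fix (chord := chord) (Zcircle Za) (Zcircle Zz) (Zcircle Zb) o vb va t01
  (fun=> conj chba chab)).2.
Qed.

Lemma psiE a z b c : tri a z b -> face [fset a; z; b]%fset c ->
  psi c = poincare (tri_map chord a z b (lin a z b (bary c))).
Proof.
rewrite /psi /carrier; case: cid => -[[a' z'] b'] /= [t' fc'] t fc.
congr poincare; have [lt|gt|e] := ltngtP (r z) (r z').
- exact/esym/tri_map_agree.
- exact: tri_map_agree.
- have zz := r_inj (tri_z t) (tri_z t') e; subst z'.
  by have [-> ->] := tri_uniq t t'.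
Qed.

Lemma psi_inj : injective psi.
Proof.
move=> c d.
have [[[a z] b] /= [t fc]] := realization_tri c.
have [[[a' z'] b'] /= [t' fd]] := realization_tri d.
rewrite (psiE t fc) (psiE t' fd) => /(can_inj (@poincareK R)).
have [Za Zz Zb az bz o _] := t; have [Za' Zz' Zb' az' bz' o' _] := t'.
have sc := straight_face o fc; have sd := straight_face o' fd.
have [lt|gt|e] := ltngtP (r z) (r z').
- move=> /(tri_map_meet t t' lt sc sd)[u [v [s [ua va ua' va' [_ e1 e2]]]]].
  apply: realization_inj => w.
  by rewrite (bary_mix o ua va fc e1) (bary_mix o' ua' va' fd e2).
- move=> /esym /(tri_map_meet t' t gt sd sc)[u [v [s [ua va ua' va' [_ e1 e2]]]]].
  apply: realization_inj => w.
  by rewrite (bary_mix o' ua va fd e1) (bary_mix o ua' va' fc e2).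
- have zz := r_inj (tri_z t) (tri_z t') e; subst z'.
  have [? ?] := tri_uniq t t'; subst a' b'.
  move=> /(can_inj (tri_mapK chord (Zcircle Za) (Zcircle Zz) (Zcircle Zb) o)).
  exact: face_lin_inj.
Qed.

Lemma psi_region a z b c : tri a z b -> face [fset a; z; b]%fset c ->
  region chord a z b (klein (psi c)).
Proof.
move=> t fc; have [Za Zz Zb _ _ o _] := t.
rewrite (psiE t fc) poincareK.
apply/(region_tri_map chord (Zcircle Za) (Zcircle Zz) (Zcircle Zb) o).
exact: straight_face.
Qed.

Lemma region_psi a z b P : tri a z b -> region chord a z b (klein P) ->
  exists2 c, face [fset a; z; b]%fset c & psi c = P.
Proof.
move=> t rP; have [Za Zz Zb _ _ o _] := t.
have [ca cz cb] := And3 (Zcircle Za) (Zcircle Zz) (Zcircle Zb).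
have [c fc e] := realization_point (tri_complex t) o
  ((straight_tri_inv chord ca cz cb o (klein P)).2 rP).
by exists c => //; rewrite (psiE t fc) e tri_invK// kleinK.
Qed.

(** A limit point of Z is not in Z. Were it beyond a side, nearby points of Z would make this side a
    chord, against membership in the region. So it is strictly inside all three sides, which is
    impossible on the circle. *)
Lemma region_not_limit x y z p : Z x -> Z y -> Z z -> 0 < orient x y z ->
  region chord x y z p -> ~ limit_set 1 Z p.
Proof.
move=> Zx Zy Zz xyz rp lp; have [cp lim] := lp; have [dp h1 h2 h3] := rp.
have nZ : ~ Z p.
  move=> /isolated_nbhs[V pV VZ]; have [q [qp Zq Vq]] := lim V pV.
  by move: qp; rewrite (VZ q Zq Vq) eqxx.
have [cx cy cz] := And3 (Zcircle Zx) (Zcircle Zy) (Zcircle Zz).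
have side u v : Z u -> Z v -> u <> v -> side_ok chord u v p -> 0 < orient u v p.
  move=> Zu Zv uv ok; rewrite ltNge le_eqVlt; apply/negP => /orP[/eqP h0|h0].
    by have [//|vp|pu] := orient_eq0 (Zcircle Zu) (Zcircle Zv) cp h0;
      apply: nZ; rewrite -?vp ?pu.
  have near : \forall q \near p, 0 < orient u q v.
    have : orient u q v @[q --> p] --> orient u p v by exact: orient_continuous.
    by move=> /cvgr_gt; apply; rewrite orient_swap oppr_gt0.
  have [q [_ Zq uqv]] := lim _ near.
  by have := ok (ex_chord Zq uqv); rewrite leNgt h0.
have [xy yz zx] := orient_neq xyz.
have o1 := side x y Zx Zy xy h1; have o2 := side y z Zy Zz yz h2.
have o3 := side z x Zz Zx zx h3.
by move: xyz o1 o2 o3 {xy yz zx}; rewrite !orient_pos// /cyc; lra.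
Qed.

Lemma limit_klein P : limit_set 1 Z (klein P) <-> limit_set 1 Z P.
Proof.
split=> -[cP lP]; last by rewrite klein_circle.
by rewrite -(kleinK P) poincare_circle.
Qed.

Lemma psi_range c : (@disk R `\` limit_set 1 Z) (psi c).
Proof.
have [[[a z] b] /= [t fc]] := realization_tri c; have [Za Zz Zb _ _ o _] := t.
have rP := psi_region t fc; split; first by apply/disk_klein; have [] := rP.
by move=> /limit_klein; exact: (region_not_limit Za Zz Zb o rP).
Qed.

Lemma tri_cap a z b p : region chord a z b p -> chord b a -> 0 <= orient a p b.
Proof. by move=> [_ _ _ h] /h; rewrite -orient_rot. Qed.

Lemma min_tri : exists a m b, tri a m b /\
  forall a' z' b', tri a' z' b' -> (r m <= r z')%N.
Proof.
have [a [z [b [Za Zz Zb _ _ o _]]]] := tri_nonempty.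
by have [az zb ba] := orient_neq o; exact: (tri_exists_min Za Zz Zb az zb ba).
Qed.

(** [cover] is applied at a stage so late that, by [away_from_limits], no cap over a chord of the
    polygon contains the point. *)
Lemma psi_surj P : (@disk R `\` limit_set 1 Z) P -> exists c, psi c = P.
Proof.
move=> [dP nL].
have [d d0 [N _ away]] : exists2 d : R, 0 < d & \forall n \near \oo,
    forall a b x p, Z a -> Z b -> Z x -> free n a b -> 0 < orient a x b ->
    disk p -> 0 <= orient a p b -> ~ ball (klein P) d p.
  by apply: away_from_limits => /limit_klein.
have [a0 [m [b0 [t0 m_min]]]] := min_tri.
have dk : disk (klein P) by apply/disk_klein.
have [|[a [z [b [t rP]]]]|[a [b [adj ch aPb]]]] :=
  @cover (maxn N (r m).+1) (klein P) a0 m b0 t0 m_min dk.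
- by rewrite leq_max leqnn orbT.
- by have [c _ e] := region_psi t rP; exists c.
have [[Za Zb ab _ _] f] := adj; have [x Zx axb] := chord_ex Za Zb ab ch.
case: (away (maxn N (r m).+1) _ a b x (klein P) Za Zb Zx f axb dk aPb).
  by rewrite /= leq_maxl.
exact: ballxx.
Qed.

Lemma psi_continuous : continuous psi.
Proof.
apply/continuousP => V oV; rewrite open_realization => s Ks c sc Vc.
have [a [z [b [t h]]]] := complex_tri Ks; have fc := faceS h sc.
have [Za Zz Zb _ _ o _] := t.
have [ca cz cb] := And3 (Zcircle Za) (Zcircle Zz) (Zcircle Zb).
pose F q := poincare (tri_map chord a z b q).
have cF : {for lin a z b (bary c), continuous F}.
  apply: (@continuous_comp _ _ _ (tri_map chord a z b) (@poincare R)).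
    exact: tri_map_continuous.
  exact: poincare_continuous.
have VF : V (F (lin a z b (bary c))) by rewrite /F -(psiE t fc).
have /nbhs_ballP[e /= e0 eV] := cF V (open_nbhs_nbhs (conj oV VF)).
(* One third for each vertex of the triangle; the coordinates of the vertices in the plane are at
   most 1 in absolute value. *)
have e3 : 0 < e / 3 by rewrite divr_gt0.
exists (e / 3) => // d sd cd; have fd := faceS h sd.
rewrite /preimage /= (psiE t fd); apply: (eV (lin a z b (bary d))).
have close v : `|bary d v - bary c v| < e / 3.
  have [vs|vs] := boolP (v \in s); first exact: cd.
  by rewrite sc// sd// subrr normr0.
have le v (i : R) : `|i| <= 1 -> `|(bary d v - bary c v) * i| < e / 3.
  by move=> i1; apply: le_lt_trans (close v); rewrite normrM ler_piMr.
have [[a1 a2] [z1 z2] [b1 b2]] :=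
  And3 (circle_norm_le1 ca) (circle_norm_le1 cz) (circle_norm_le1 cb).
have tri3 (s1 s2 s3 : R) : `|s1| < e / 3 -> `|s2| < e / 3 -> `|s3| < e / 3 ->
    `|s1 + s2 + s3| < e.
  move=> h1 h2 h3; apply: le_lt_trans (ler_normD _ _) _.
  have := ler_normD s1 s2; lra.
have h1 := tri3 _ _ _ (le a _ a1) (le z _ z1) (le b _ b1).
have h2 := tri3 _ _ _ (le a _ a2) (le z _ z2) (le b _ b2).
have e1 : (lin a z b (bary d)).1 - (lin a z b (bary c)).1 =
    (bary d a - bary c a) * a.1 + (bary d z - bary c z) * z.1 +
    (bary d b - bary c b) * b.1 by rewrite /lin /=; ring.
have e2 : (lin a z b (bary d)).2 - (lin a z b (bary c)).2 =
    (bary d a - bary c a) * a.2 + (bary d z - bary c z) * z.2 +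
    (bary d b - bary c b) * b.2 by rewrite /lin /=; ring.
rewrite -e1 distrC in h1; rewrite -e2 distrC in h2.
by split; [exact: h1|exact: h2].
Qed.

(** Recovers a barycentric coordinate as a continuous function of [psi c]; the moving point is the
    middle argument of [orient], as in [orient_continuous]. *)
Lemma psi_coord a z b c : tri a z b -> face [fset a; z; b]%fset c ->
  forall x y w, [\/ [/\ x = a, y = z & w = b], [/\ x = z, y = b & w = a] |
                    [/\ x = b, y = a & w = z]] ->
  bary c w = orient y (tri_inv chord a z b (klein (psi c))) x / orient a z b.
Proof.
move=> t fc x y w xyw; have [Za Zz Zb _ _ o _] := t.
have [ca cz cb] := And3 (Zcircle Za) (Zcircle Zz) (Zcircle Zb).
have [az zb ba] := orient_neq o; have s := face3_sum az zb ba fc.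
rewrite (psiE t fc) poincareK tri_mapK// orient_rot.
have D : orient a z b != 0 by rewrite lt0r_neq0.
apply: (mulIf D); rewrite divfK//; case: xyw => -[-> -> ->].
- by rewrite orient_lin.
- have s2 : bary c z + bary c b + bary c a = 1 by rewrite -s; ring.
  by rewrite -(lin_rot a z b) (orient_lin s2) (orient_rot a z b).
- have s3 : bary c b + bary c a + bary c z = 1 by rewrite -s; ring.
  by rewrite (lin_rot b a z) (orient_lin s3) -(orient_rot b a z).
Qed.

(** Continuity of the inverse on one triangle, indexed by the rank of its apex so that
    [near_forall_lt] can combine finitely many. If P is outside the closed region, so are nearby
    points; otherwise the three coordinates are close. *)
Lemma psi_inv_near (g : plane -> real) P (U : set real) n :
  (forall Q, (@disk R `\` limit_set 1 Z) Q -> psi (g Q) = Q) ->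
  (@disk R `\` limit_set 1 Z) P -> open U -> U (g P) ->
  \forall Q \near P, forall a z b, tri a z b -> r z = n ->
    region chord a z b (klein Q) -> (@disk R `\` limit_set 1 Z) Q -> U (g Q).
Proof.
move=> gK BP oU UgP.
have [[a [z [b [t zn]]]]|nt] := pselect (exists a z b, tri a z b /\ r z = n);
  last by apply: (@filterE _ (nbhs P)) => Q a z b t zn; case: nt; exists a, z, b.
have uniq a' z' b' : tri a' z' b' -> r z' = n -> [/\ a' = a, z' = z & b' = b].
  move=> t' zn'; have zz : z' = z.
    by apply: r_inj; [exact: tri_z t'|exact: tri_z t|rewrite zn zn'].
  by subst z'; have [-> ->] := tri_uniq t' t.
have [Za Zz Zb _ _ o _] := t.
have [ca cz cb] := And3 (Zcircle Za) (Zcircle Zz) (Zcircle Zb).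
have face_g Q : (@disk R `\` limit_set 1 Z) Q -> region chord a z b (klein Q) ->
    face [fset a; z; b]%fset (g Q).
  move=> BQ rQ; have [c fc cQ] := region_psi t rQ.
  by have -> : g Q = c by apply: psi_inj; rewrite gK.
have [rP|nrP] := pselect (region chord a z b (klein P)); last first.
  have lt1 : 1 < region_gauge chord a z b (klein P - centroid a z b).
    by rewrite ltNge; apply/negP => /(region_gauge_le1 chord ca cz cb o).
  have cg : {for P, continuous (fun Q => region_gauge chord a z b (klein Q - centroid a z b))}.
    apply: (@continuous_comp _ _ _ (fun Q => klein Q - centroid a z b)).
      by apply: cvgB; [exact: klein_continuous|exact: cvg_cst].
    exact/gauge_continuous/region_gauge_gauge.
  have gt1 : \forall Q \near P, 1 < region_gauge chord a z b (klein Q - centroid a z b).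
    by move/cvgr_gt : cg; apply.
  apply: filterS gt1 => Q gQ a' z' b' t' zn' + _.
  have [-> -> ->] := uniq _ _ _ t' zn'.
  by move=> /(region_gauge_le1 chord ca cz cb o); rewrite leNgt gQ.
have fP := face_g P BP rP.
rewrite open_realization in oU; have [e e0 eU] := oU _ (tri_complex t) (g P) fP UgP.
have coord x y w : [\/ [/\ x = a, y = z & w = b], [/\ x = z, y = b & w = a] |
      [/\ x = b, y = a & w = z]] ->
    \forall Q \near P, (@disk R `\` limit_set 1 Z) Q ->
      region chord a z b (klein Q) -> `|bary (g Q) w - bary (g P) w| < e.
  move=> xyw; pose h Q := orient y (tri_inv chord a z b (klein Q)) x / orient a z b.
  have ch : h Q @[Q --> P] --> h P.
    apply: cvgM; last exact: cvg_cst.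
    apply: (@continuous_comp _ _ _ (fun Q => tri_inv chord a z b (klein Q))
      (fun p => orient y p x)); last exact: orient_continuous.
    apply: (@continuous_comp _ _ _ (@klein R) (tri_inv chord a z b)).
      exact: klein_continuous.
    exact: tri_inv_continuous.
  have dist_lt : \forall Q \near P, `|h P - h Q| < e.
    by move/cvgr_dist_lt : ch; apply.
  apply: filterS dist_lt => Q hQ BQ rQ.
  have := psi_coord t fP xyw; rewrite gK// -/(h P) => ->.
  have := psi_coord t (face_g Q BQ rQ) xyw; rewrite gK// -/(h Q) => ->.
  by rewrite distrC.
have c1 := coord a z b (Or31 _ _ (And3 erefl erefl erefl)).
have c2 := coord z b a (Or32 _ _ (And3 erefl erefl erefl)).
have c3 := coord b a z (Or33 _ _ (And3 erefl erefl erefl)).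
apply: filterS3 c1 c2 c3 => Q h1 h2 h3 a' z' b' t' zn'.
have [-> -> ->] := uniq _ _ _ t' zn' => rQ BQ.
apply: eU; first exact: face_g.
by move=> v /fset3P[->|->|->]; [exact: h2|exact: h3|exact: h1].
Qed.

Lemma psi_inv_continuous (g : plane -> real) :
  (forall Q, (@disk R `\` limit_set 1 Z) Q -> psi (g Q) = Q) ->
  {within @disk R `\` limit_set 1 Z, continuous g}.
Proof.
move=> gK; apply/subspace_continuousP => P BP V.
rewrite nbhsE => -[U [oU UgP] UV].
have [dP nL] := BP.
have [d d0 [N _ away]] : exists2 d : R, 0 < d & \forall n \near \oo,
    forall a b x p, Z a -> Z b -> Z x -> free n a b -> 0 < orient a x b ->
    disk p -> 0 <= orient a p b -> ~ ball (klein P) d p.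
  by apply: away_from_limits => /limit_klein.
have [a0 [m [b0 [t0 m_min]]]] := min_tri.
(* From rank N on, the caps over the bases avoid a ball about the point. The bound also exceeds
   [r m], so that beyond it the initial triangle is an earlier one and [tri_chord_ba] puts the
   region into such a cap. *)
have near1 := near_forall_lt (maxn N (r m).+1) (nbhs_filter P)
  (fun n => psi_inv_near n gK BP oU UgP).
have near2 : \forall Q \near P, ball (klein P) d (klein Q).
  by apply: klein_continuous; exact: nbhsx_ballx.
apply: filterS2 near1 near2 => Q h1 h2 BQ; apply: UV.
have rQ := psi_range (g Q); have gQ := gK Q BQ.
have [[[a z] b] /= [t fc]] := realization_tri (g Q).
have reg := psi_region t fc; rewrite gQ in reg.
have [lt|ge] := ltnP (r z) (maxn N (r m).+1).
  exact: (h1 _ lt a z b t erefl reg BQ).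
have [Za Zz Zb _ _ o f] := t; move: ge; rewrite geq_max => /andP[Nz mz].
have dk : disk (klein Q) by have [] := reg.
by case: (away _ Nz a b z (klein Q) Za Zb Zz f o dk (tri_cap reg (tri_chord_ba t0 t mz))).
Qed.

Lemma psi_homeomorphism : homeomorphism_on psi setT (@disk R `\` limit_set 1 Z).
Proof.
have [a0 [z0 [b0 t0]]] := tri_nonempty; have [_ _ _ _ _ o0 _] := t0.
(* A default value for the inverse outside its domain. *)
have [c0 _ _] := realization_point (tri_complex t0) o0 (straight_vertex o0).
have /choice[g gK] : forall Q, exists c, (@disk R `\` limit_set 1 Z) Q -> psi c = Q.
  move=> Q; have [BQ|nB] := pselect ((@disk R `\` limit_set 1 Z) Q).
    by have [c cQ] := psi_surj BQ; exists c.
  by exists c0.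
exists g; split.
- exact/continuous_subspaceT/psi_continuous.
- exact: psi_inv_continuous.
- move=> c _; split; first exact: psi_range.
  by apply: psi_inj; rewrite gK//; exact: psi_range.
- by move=> Q BQ; split=> //; exact: gK.
Qed.

(** * The map psi on vertices, edges and triangles *)

Lemma psi_face (A : set real) (B : set plane) :
  (forall c, A c -> B (psi c)) -> (forall P, B P -> exists2 c, A c & psi c = P) ->
  homeomorphism_on psi A B.
Proof.
move=> AB BA; have [g [cpsi cg gK pK]] := psi_homeomorphism.
exists g; split.
- exact/continuous_subspaceT/psi_continuous.
- apply: continuous_subspaceW cg => P /BA[c _ <-]; exact: psi_range.
- by move=> c Ac; split; [exact: AB|exact: (gK c I).2].
- by move=> P /[dup] BP /BA[c Ac <-]; rewrite (gK c I).2.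
Qed.

(** A triangle up to rotation, so that any of its edges can be taken as the first side. *)
Definition rtri x y z := [\/ tri x y z, tri y z x | tri z x y].

Lemma rtri_facts x y z : rtri x y z -> [/\ Z x, Z y, Z z & 0 < orient x y z].
Proof.
by case=> -[Z1 Z2 Z3 _ _ o _]; split=> //; [rewrite -orient_rot|rewrite orient_rot].
Qed.

Lemma rtri_complex x y z : rtri x y z -> K [fset x; y; z]%fset.
Proof.
case=> t; first exact: tri_complex.
  by rewrite -fset3_rot; exact: tri_complex.
by rewrite (fset3_rot z x y); exact: tri_complex.
Qed.

Lemma rpsiE x y z c : rtri x y z -> face [fset x; y; z]%fset c ->
  psi c = poincare (tri_map chord x y z (lin x y z (bary c))).
Proof.
case=> t fc; first exact: psiE.
  by rewrite -tri_map_rot -lin_rot; apply: psiE => //; rewrite fset3_rot.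
rewrite (tri_map_rot _ z x y) (lin_rot z x y); apply: psiE => //.
by rewrite -(fset3_rot z x y).
Qed.

Lemma joined_rtri u v : joined u v -> exists w, rtri u v w \/ rtri v u w.
Proof.
move=> j; have [Zu Zv uv _] := j.
have [|||a [z [b [t h]]]] := clique_tri (s := [:: u; v]) tri_nonempty.
- by [].
- by move=> x; rewrite !inE => /orP[]/eqP ->.
- by move=> x y; rewrite !inE => /orP[]/eqP -> /orP[]/eqP -> //= _; exact: joined_sym.
have hu := h u (mem_head _ _); have hv : vertex a z b v.
  by apply: h; rewrite !inE eqxx orbT.
case: hu hv uv => -> [] -> // _.
- by exists b; left; constructor 1.
- by exists z; right; constructor 2.
- by exists b; right; constructor 1.
- by exists a; left; constructor 3.
- by exists z; left; constructor 2.
- by exists a; right; constructor 3.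
Qed.

Lemma edge_point x y z p : rtri x y z -> straight x y z p -> orient x y p = 0 ->
  exists2 c, face [fset x; y]%fset c & psi c = poincare (tri_map chord x y z p).
Proof.
move=> t sp e; have [_ _ _ o] := rtri_facts t.
have [c fc cp] := realization_point (rtri_complex t) o sp.
exists c; last by rewrite (rpsiE t fc) cp.
by apply/(face_edge o fc); rewrite cp.
Qed.

Lemma edge_face x y z c : rtri x y z -> face [fset x; y]%fset c ->
  [/\ face [fset x; y; z]%fset c, straight x y z (lin x y z (bary c)) &
      orient x y (lin x y z (bary c)) = 0].
Proof.
move=> t f2; have [_ _ _ o] := rtri_facts t.
have f3 : face [fset x; y; z]%fset c.
  by apply: faceS f2 => v; rewrite !inE => ->.
by split=> //; [exact: straight_face|exact/(face_edge o f3)].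
Qed.

Lemma psi_vertex z c : Z z -> face [fset z]%fset c -> psi c = z.
Proof.
move=> Zz fc.
have [|||a [m [b [t h]]]] := clique_tri (s := [:: z]) tri_nonempty.
- by [].
- by move=> x; rewrite !inE => /eqP ->.
- by move=> x y; rewrite !inE => /eqP -> /eqP ->.
have vz := h z (mem_head _ _); have [Za Zm Zb _ _ o _] := t.
have f2 : face [fset z; z]%fset c by rewrite fsetUid.
have [s [s01 e _]] := lin_edge o vz vz f2.
have f3 : face [fset a; m; b]%fset c.
  by apply: faceS fc => v; rewrite inE => /eqP ->; exact/fset3P.
rewrite (psiE t f3) e (tri_map_fix (chord := chord) (Zcircle Za) (Zcircle Zm)
  (Zcircle Zb) o vz vz s01 _).2//.
by rewrite mixxx poincare_circle//; exact: Zcircle.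
Qed.

Lemma psi_successor z w : successor Z z w ->
  homeomorphism_on psi (face [fset z; w]%fset) (circle_arc z w).
Proof.
move=> s; have [Zz Zw zw nq] := s; have [cz cw] := (Zcircle Zz, Zcircle Zw).
have nch : ~~ chord z w by apply/asboolPn => n; exact: n s.
(* The edge is a side of some triangle; the opposite orientation would put its third vertex on the
   arc from z to its successor. *)
have [v t] : exists v, rtri z w v.
  have [v [t|t]] := joined_rtri (successor_joined s); first by exists v.
  have [_ _ Zv o] := rtri_facts t; case: (nq v Zv).
  by rewrite ccwE (orient_rot w z v).
have [_ _ Zv o] := rtri_facts t; have cv := Zcircle Zv.
apply: psi_face => [c fc|P [cP arc]].
  have [f3 sp e] := edge_face t fc.
  rewrite (rpsiE t f3); have [cP le] := tri_map_arc cz cw cv o sp e nch.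
  rewrite poincare_circle//; split=> //; rewrite ccwE orient_swap oppr_gt0.
  move: le; rewrite le_eqVlt => /predU1P[|lt]; last by constructor 3.
  move=> /(orient_eq0 cz cw cP)[//|wP|]; last by constructor 1.
  by constructor 2.
have le : orient z w P <= 0.
  case: arc => [->|->|]; rewrite ?orientxyx ?orientxyy//.
  by rewrite ccwE orient_swap oppr_gt0 => /ltW.
have [sp e] := tri_inv_arc cz cw cv o nch cP le.
have [c fc ce] := edge_point t sp e.
by exists c => //; rewrite ce tri_invK// poincare_circle.
Qed.

Lemma psi_chord_rtri x y z : rtri x y z -> chord x y ->
  homeomorphism_on psi (face [fset x; y]%fset) (geodesic x y).
Proof.
move=> t ch; have [Zx Zy Zz o] := rtri_facts t.
have [cx cy cz] := And3 (Zcircle Zx) (Zcircle Zy) (Zcircle Zz).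
have [xy _ _] := orient_neq o.
apply: psi_face => [c fc|P].
  have [f3 sp e] := edge_face t fc; rewrite (rpsiE t f3).
  rewrite (tri_map_chord cx cy cz o sp e ch); apply/(geodesicE _ cx cy xy).
  rewrite poincareK; split=> //; apply/disk_poincare.
  exact: straight_disk cx cy cz o _ sp.
move=> /(geodesicE _ cx cy xy)[dP e].
have [s [s0 s1 kE]] : exists s, [/\ 0 <= s, s <= 1 & klein P = mix s x y].
  by apply: chord_disk => //; exact/disk_klein.
have s01 : 0 <= s <= 1 by rewrite s0 s1.
have [sp _] := straight_mix o s01; rewrite -kE in sp.
have [c fc ce] := edge_point t sp e.
by exists c => //; rewrite ce (tri_map_chord cx cy cz o sp e ch) kleinK.
Qed.

Lemma psi_chord x y : in_upto_iso S x y ->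
  homeomorphism_on psi (face [fset x; y]%fset) (geodesic x y).
Proof.
move=> /in_triangulation[j cxy cyx]; have [Zx Zy xy _] := j.
have [v [t|t]] := joined_rtri j; first exact: psi_chord_rtri t cxy.
rewrite fsetUC geodesic_sym//; try exact: Zcircle.
exact: psi_chord_rtri t cyx.
Qed.

Lemma region_gauge_psi a z b c : tri a z b -> face [fset a; z; b]%fset c ->
  region_gauge chord a z b (klein (psi c) - centroid a z b) =
  tri_gauge a z b (lin a z b (bary c) - centroid a z b).
Proof.
move=> t fc; have [Za Zz Zb _ _ o _] := t; rewrite (psiE t fc) poincareK.
by rewrite region_gauge_tri_map//; exact: Zcircle.
Qed.

Lemma psi_triangle (s : {fset plane}) : K s -> #|` s| = 3%N ->
  homeomorphism_on psi (face s) (enclosed (psi @` face_boundary s)).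
Proof.
move=> Ks card3; have [a [z [b [t h]]]] := complex_tri Ks.
have [Za Zz Zb _ _ o _] := t; have [az zb ba] := orient_neq o.
have [ca cz cb] := And3 (Zcircle Za) (Zcircle Zz) (Zcircle Zb).
have {h} -> : s = [fset a; z; b]%fset.
  apply/eqP; rewrite eqEfcard; apply/andP; split.
    by apply/fsubsetP => v; exact: h.
  rewrite card3 fsetUC cardfsU1 cardfs2 !inE.
  by case: (_ || _); case: (_ != _).
have gb := region_gauge_gauge chord ca cz cb o.
(* The boundary of the triangle is the level 1 of [tri_gauge], so its image is the level 1 of
   [region_gauge], to which [enclosed_gauge] applies. *)
have bdE : psi @` face_boundary [fset a; z; b]%fset =
    [set P | region_gauge chord a z b (klein P - centroid a z b) = 1].
  apply/seteqP; split=> [_ [c [fc [v vs v0]] <-]|P] /=.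
    rewrite (region_gauge_psi t fc); have sp := straight_face o fc.
    have ss := face3_sum az zb ba fc.
    have s2 : bary c z + bary c b + bary c a = 1 by rewrite -ss; ring.
    have s3 : bary c b + bary c a + bary c z = 1 by rewrite -ss; ring.
    have edge w : vertex a z b w -> bary c w = 0 ->
        tri_gauge a z b (lin a z b (bary c) - centroid a z b) = 1.
      have o2 : 0 < orient z b a by rewrite orient_rot.
      have o3 : 0 < orient b a z by rewrite -orient_rot.
      case=> -> w0; last first.
      - by apply: tri_gauge_edge => //; rewrite orient_lin// w0 mul0r.
      - rewrite (tri_gauge_rot b a z) (centroid_rot b a z).
        apply: tri_gauge_edge => //; first exact/(straight_rot b a z).
        by rewrite (lin_rot b a z) (orient_lin s3) w0 mul0r.
      - rewrite -tri_gauge_rot -centroid_rot.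
        apply: tri_gauge_edge => //; first exact/straight_rot.
        by rewrite -lin_rot (orient_lin s2) w0 mul0r.
    exact: edge (fset3P _ _ _ _ vs) v0.
  move=> g1; have rP : region chord a z b (klein P).
    by apply/(region_gauge_le1 chord ca cz cb o); rewrite g1.
  have [c fc cP] := region_psi t rP; exists c => //; split=> //.
  rewrite -cP (region_gauge_psi t fc) in g1.
  have ss := face3_sum az zb ba fc.
  have zero (i j : R) : j != 0 -> i * j = 0 -> i = 0.
    by move=> j0 /eqP; rewrite mulf_eq0 (negbTE j0) orbF => /eqP.
  have D := lt0r_neq0 o.
  have [e|e|e] := tri_gauge_eq1 o (straight_face o fc) g1.
  - exists b; first by apply/fset3P; constructor 3.
    by rewrite orient_lin// in e; exact: zero D e.
  - exists a; first by apply/fset3P; constructor 1.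
    rewrite -(lin_rot a z b) orient_lin in e; last by rewrite -ss; ring.
    by rewrite orient_rot in e; exact: zero D e.
  - exists z; first by apply/fset3P; constructor 2.
    rewrite (lin_rot b a z) orient_lin in e; last by rewrite -ss; ring.
    by rewrite -orient_rot in e; exact: zero D e.
rewrite bdE enclosed_gauge//; apply: psi_face => [c fc|P] /=.
  rewrite (region_gauge_psi t fc); apply/(tri_gauge_le1 o).
  exact: straight_face.
by move=> /(region_gauge_le1 chord ca cz cb o); exact: region_psi.
Qed.

(** * The cluster property *)

Lemma triangulation_precluster : precluster Z S.
Proof.
split=> [[x y] /= [[Zx Zy xy _] _ /asboolP c1 /asboolP c2]|].
  by split=> //; exact: nesym.
move=> [x y] [u v] [/= jxy rxy _ _] [/= juv ruv _ _] ne; split; last first.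
  move=> [[ux vy]|[uy vx]]; first by apply: ne; rewrite ux vy.
  by subst u v; move: (ltn_trans rxy ruv); rewrite ltnn.
have [Zx Zy xy _] := jxy; have [Zu Zv uv _] := juv.
have [[cx cy] [cu cv]] := ((Zcircle Zx, Zcircle Zy), (Zcircle Zu, Zcircle Zv)).
move=> [gne [p [[/(geodesicE _ cx cy xy)[_ e1] /(geodesicE _ cu cv uv)[_ e2]] op]]].
have ok : open_disk (klein p) by apply/open_disk_klein.
apply: gne => /=.
have [[-> ->]//|[-> ->]] := chords_meet jxy juv ok e1 e2.
exact: geodesic_sym cv cu (nesym uv).
Qed.

(** A pair that is not joined is crossed by an edge ab; since x and y lie on its two sides, ab is
    not a pair of successive points and so belongs to the triangulation up to order. A joined pair
    in the wrong order is isomorphic to a member. *)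
Lemma triangulation_cluster_max : Defs.cluster Z S.
Proof.
split; first exact: triangulation_precluster.
move=> T [Ti Tc] ST; apply/seteqP; split=> // -[x y] Txy.
have [/= Zx Zy yx ns1 ns2] := Ti _ Txy.
have c1 : chord x y by apply/asboolP. have c2 : chord y x by apply/asboolP.
have [j|nj] := pselect (joined x y); last first.
  have [a [b [jab xay ybx]]] := not_joined_crossed Zx Zy (nesym yx) nj.
  exfalso; have [Za Zb ab _] := jab.
  have [[cx cy] [ca cb]] := ((Zcircle Zx, Zcircle Zy), (Zcircle Za, Zcircle Zb)).
  have ayb : 0 < orient a y b.
    by move: xay ybx {ab yx}; rewrite !orient_posZ// /cyc; lra.
  have bxa : 0 < orient b x a.
    by move: xay ybx {ab yx}; rewrite !orient_posZ// /cyc; lra.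
  have [xa ay _] := orient_neq xay; have [yb bx _] := orient_neq ybx.
  have : in_upto_iso S a b.
    by apply/in_triangulation; split=> //; [exact: ex_chord ayb|exact: ex_chord bxa].
  have cr := crossing_geodesics cx cy ca cb xay ybx.
  move=> [e Se [eE|eE]].
    have ne : (x, y) <> e by rewrite -eE => -[/xa].
    by have [nc _] := Tc _ _ Txy (ST _ Se) ne; apply: nc; rewrite -eE.
  have {eE} eE : e = (b, a) by case: e eE {Se} => e1 e2 [-> ->].
  have ne : (x, y) <> e by rewrite eE => -[/esym/bx].
  have [nc _] := Tc _ _ Txy (ST _ Se) ne; apply: nc; rewrite eE.
  move: cr; rewrite /crossing /= (geodesic_sym cb ca)//; exact: nesym.
have [lt|gt|/(r_inj Zx Zy)/esym//] := ltngtP (r x) (r y); first by split.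
have Syx : S (y, x) by split=> //; exact: joined_sym.
have ne : (x, y) <> (y, x) by move=> [/esym/yx].
by have [_ []] := Tc _ _ Txy (ST _ Syx) ne; right.
Qed.

Lemma triangulation_is_cluster : triangulation_cluster Z S.
Proof.
split; first exact: triangulation_cluster_max.
exists psi; split; last exact: psi_homeomorphism.
split.
- by move=> z c; exact: psi_vertex.
- exact: psi_successor.
- exact: psi_chord.
- exact: psi_triangle.
Qed.

End Triangles.

(** * Countability of Z and conclusion *)

Lemma isolated_rank (R : realType) (Z : set (R * R)) : Z `<=` isolated Z ->
  exists r : R * R -> nat, forall x y, Z x -> Z y -> r x = r y -> x = y.
Proof.
move=> iso.
(* The code of a point consists of n, which measures its isolation, and of two rationals
   approximating it within 1/(n+1). Points with the same code differ by less than 2/(n+1) in each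
   coordinate, hence are equal. *)
have code z : exists q : rat * rat * nat, Z z ->
    [/\ forall w, Z w -> ball z (2 / q.2.+1%:R) w -> w = z,
        `|z.1 - ratr q.1.1| < q.2.+1%:R^-1 & `|z.2 - ratr q.1.2| < q.2.+1%:R^-1].
  have [Zz|nZ] := pselect (Z z); last by exists (0, 0, 0%N).
  have [_ [V /nbhs_ballP[e /= e0 eV] VZ]] := iso z Zz.
  have [n n0] : exists n : nat, n.+1%:R^-1 < e / 2.
    exists (Num.truncn (e / 2)^-1); rewrite invf_plt ?posrE ?divr_gt0//.
    exact: truncnS_gt.
  have dense (t : R) : exists q : rat, `|t - ratr q| < n.+1%:R^-1.
    have [|q] := @rat_in_itvoo R (t - n.+1%:R^-1) (t + n.+1%:R^-1).
      by rewrite ltrBlDr -addrA ltrDl addr_gt0// invr_gt0.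
    rewrite in_itv /= => /andP[h1 h2]; exists q.
    rewrite ltr_norml; move: (ratr q) (n.+1%:R^-1) h1 h2 => s k h1 h2.
    by apply/andP; split; lra.
  have [q1 h1] := dense z.1; have [q2 h2] := dense z.2.
  exists (q1, q2, n) => _; split=> // w Zw zw.
  have : (V `&` Z) w.
    split=> //; apply: eV; apply: le_ball zw => /=.
    by move: n0; move: (n.+1%:R^-1) => k; lra.
  by rewrite VZ.
have [f fP] := choice code.
exists (choice.pickle \o f) => x y Zx Zy /= /(pcan_inj (@choice.pickleK _)) e.
have [hx x1 x2] := fP x Zx; have [_ y1 y2] := fP y Zy.
apply/esym/hx => //; rewrite -e in y1 y2.
have close (s t u : R) : `|s - u| < (f x).2.+1%:R^-1 ->
    `|t - u| < (f x).2.+1%:R^-1 -> `|s - t| < 2 / (f x).2.+1%:R.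
  move: (_^-1) => k su tu; rewrite (_ : s - t = (s - u) - (t - u)); last by ring.
  by apply: le_lt_trans (ler_normB _ _) _; lra.
by split; [exact: close x1 y1|exact: close x2 y2].
Qed.

Theorem theorem4p22 (R : realType) (Z : set (R * R)%type)
    (Z_adm : admissible Z)
    (LZ_empty : exists N : nat, forall n : nat,
        (1 <= n)%N -> (N <= n)%N -> limit_set n Z = set0) :
  exists S : set ((R * R) * (R * R))%type, triangulation_cluster Z S.
Proof.
have [Zc Ziso Zlim /pcard_leP[f]] := Z_adm.
have [r r_inj] := isolated_rank Ziso.
have neq i j : (i < 4)%N -> (j < 4)%N -> i <> j -> f i <> f j.
  move=> i4 j4 ij; apply: contra_not ij.
  by have := @inj _ _ _ f i j; apply; exact/mem_set.
have fZ i : (i < 4)%N -> Z (f i) by move=> h; exact: (@funS _ _ _ _ f i h).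
have [a [z [b [t _]]]] := tri_exists_min Zc r_inj (fZ 0 isT) (fZ 1 isT) (fZ 2 isT)
  (neq 0 1 isT isT (fun e => ltac:(discriminate e)))
  (neq 1 2 isT isT (fun e => ltac:(discriminate e)))
  (neq 2 0 isT isT (fun e => ltac:(discriminate e))).
exists (triangulation Z r).
by apply: triangulation_is_cluster => //; exists a, z, b.
Qed.
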